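(* Let $N\ge3$, $1<p<\frac{N+2}{N-2}$, and set $$K(N,p)=(N-2)^{-\frac{p+1}{2}}\,|\mathbb S^{N-1}|^{\frac{1-p}{2}}\,\Gamma\!\left(N-\frac{(p+1)(N-2)}{2}\right),$$ where $|\mathbb S^{N-1}|=2\pi^{N/2}/\Gamma(N/2)$. Let $R\in[0,1)$ satisfy $$R^{\frac{2N}{p+1}-(N-2)}\min\left\{e^{\frac{4}{R(p+1)}},e^{\frac{4}{(1-R)(p+1)}}\right\}<K(N,p)^{-\frac{2}{p+1}}S^{-1}$$ (with the convention $e^{4/(R(p+1))}=+\infty$ when $R=0$). Then there exists $\alpha(R)>0$ such that for all $\alpha>\alpha(R)$ one has $S_\alpha<S_{\alpha,\mathrm{rad}}$, and no groundstate of $(\mathcal P)$ is radially symmetric.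
   Context: Let $B=B(0,1)\subset\mathbb R^N$. For $\alpha>0$ and $R\in(0,1)$ define the radial weight $V=V_{R,\alpha}$ by $V(r)=(1-r/R)^\alpha$ for $0\le r<R$ and $V(r)=\left(1-\frac{1-r}{1-R}\right)^\alpha$ for $R\le r\le 1$; for $R=0$ set $V(|x|)=|x|^\alpha$ and for $R=1$ set $V(|x|)=(1-|x|)^\alpha$. Problem $(\mathcal P)$: $-\Delta u=V(|x|)|u|^{p-1}u$ in $B$, $u=0$ on $\partial B$. $S_{\alpha}=\inf_{0\ne u\in H^1_0(B)}\frac{\int_B|Du|^2}{(\int_B V|u|^{p+1})^{2/(p+1)}}$ and $S_{\alpha,\mathrm{rad}}$ is the same infimum over radial functions $0\ne u\in H^1_{0,\mathrm{rad}}(B)$. $S=\inf_{0\ne u\in H^1_0(B)}\frac{\int_B|Du|^2}{(\int_B|u|^{p+1})^{2/(p+1)}}$ is the best constant of the embedding $H^1_0(B)\subset L^{p+1}(B)$. A groundstate of $(\mathcal P)$ is $u_\alpha=S_\alpha^{1/(p-1)}u^*_\alpha$ with $u^*_\alpha$ a positive minimiser of $S_\alpha$ normalised by $\int_BV|u^*_\alpha|^{p+1}=1$ (a positive least-energy solution). *)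

(* Defs.v *)
From HB Require Import structures.
From mathcomp Require Import all_boot all_order all_algebra.
From mathcomp Require Import all_classical all_reals all_analysis.
Unset Printing Implicit Defensive.
Import Order.TTheory GRing.Theory Num.Theory.
Import numFieldNormedType.Exports.
Local Open Scope classical_set_scope.
Local Open Scope ring_scope.

Definition enorm {R : realType} {N : nat} (x : 'rV[R]_N) : R :=
  Num.sqrt (\sum_(i < N) x 0 i ^+ 2).

Definition ball1 {R : realType} (N : nat) : set 'rV[R]_N :=
  [set x | enorm x < 1].

Definition borelRN {R : realType} (N : nat) : set (set 'rV[R]_N) :=
  <<s [set U : set 'rV[R]_N | open U] >>.

Definition borel_fun {R : realType} {N : nat} (f : 'rV[R]_N -> R) : Prop :=
  forall A : set R, measurable A -> borelRN N (f @^-1` A).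

(* Lebesgue integral on R^N of nonnegative functions, as the iterated
   one-dimensional Lebesgue integral (Tonelli). *)
Fixpoint iint {R : realType} (n : nat) : ('rV[R]_n -> \bar R) -> \bar R :=
  match n with
  | 0 => fun f => f 0
  | n'.+1 => fun f =>
      (\int[@lebesgue_measure R]_(t in setT)
         iint n' (fun y : 'rV[R]_n' => f (row_mx (const_mx t : 'rV[R]_1) y)))%E
  end.

Definition lebN {R : realType} (N : nat) (A : set 'rV[R]_N) : \bar R :=
  iint N (fun x => (\1_A x)%:E).

Definition ae {R : realType} (N : nat) (P : 'rV[R]_N -> Prop) : Prop :=
  exists A, borelRN N A /\ lebN N A = 0%E /\ [set x | ~ P x] `<=` A.

Fixpoint smooth_k {R : realType} {N : nat} (k : nat) (f : 'rV[R]_N -> R^o) : Prop :=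
  match k with
  | 0 => continuous f
  | k'.+1 => (forall x, differentiable f x) /\ forall v, smooth_k k' ('D_v f)
  end.

Definition Ccinf_ball {R : realType} (N : nat) (phi : 'rV[R]_N -> R^o) : Prop :=
  (forall k, smooth_k k phi) /\
  compact (closure [set x | phi x != 0]) /\
  closure [set x | phi x != 0] `<=` ball1 N.

Definition partial {R : realType} {N : nat} (i : 'I_N) (phi : 'rV[R]_N -> R^o)
  (x : 'rV[R]_N) : R := 'D_(delta_mx 0 i) phi x.

(* H^1_0(B): u (Borel) with weak gradient g, limits in the H^1 norm of
   functions of C_c^infty(B). *)
Definition H10 {R : realType} (N : nat) (u : 'rV[R]_N -> R)
  (g : 'rV[R]_N -> 'rV[R]_N) : Prop :=
  borel_fun u /\ (forall i, borel_fun (fun x => g x 0 i)) /\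
  exists phi : nat -> 'rV[R]_N -> R^o,
    (forall k, Ccinf_ball N (phi k)) /\
    ((fun k => iint N (fun x => ((phi k x - u x) ^+ 2)%:E)) @ \oo --> 0%E) /\
    ((fun k => iint N (fun x =>
        (\sum_(i < N) (partial i (phi k) x - g x 0 i) ^+ 2)%:E)) @ \oo --> 0%E).

Definition nonzero {R : realType} (N : nat) (u : 'rV[R]_N -> R) : Prop :=
  ~ ae N (fun x => u x = 0).

Definition radial {R : realType} (N : nat) (u : 'rV[R]_N -> R) : Prop :=
  exists h : R -> R, ae N (fun x => u x = h (enorm x)).

Definition Vw {R : realType} (R0 alpha r : R) : R :=
  if R0 == 0 then r `^ alpha
  else if R0 == 1 then (1 - r) `^ alpha
  else if r < R0 then (1 - r / R0) `^ alpha
  else (1 - (1 - r) / (1 - R0)) `^ alpha.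

Definition quot {R : realType} (N : nat) (W : 'rV[R]_N -> R) (p : R)
  (u : 'rV[R]_N -> R) (g : 'rV[R]_N -> 'rV[R]_N) : R :=
  fine (iint N (fun x => (\1_(ball1 N) x * \sum_(i < N) g x 0 i ^+ 2)%:E)) /
  (fine (iint N (fun x => (\1_(ball1 N) x * (W x * `|u x| `^ (p + 1)))%:E)))
     `^ (2 / (p + 1)).

Definition Sinf {R : realType} (N : nat) (W : 'rV[R]_N -> R) (p : R)
  (P : ('rV[R]_N -> R) -> Prop) : R :=
  inf [set q | exists u g, [/\ H10 N u g, nonzero N u, P u & q = quot N W p u g]].

Definition S_alpha {R : realType} (N : nat) (p R0 alpha : R) : R :=
  Sinf N (fun x : 'rV[R]_N => Vw R0 alpha (enorm x)) p (fun _ => True).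
Definition S_alpha_rad {R : realType} (N : nat) (p R0 alpha : R) : R :=
  Sinf N (fun x : 'rV[R]_N => Vw R0 alpha (enorm x)) p (radial N).
Definition S_sob {R : realType} (N : nat) (p : R) : R :=
  Sinf N (fun _ : 'rV[R]_N => 1) p (fun _ => True).

Definition groundstate {R : realType} (N : nat) (p R0 alpha : R)
  (u : 'rV[R]_N -> R) : Prop :=
  exists ustar g,
    [/\ H10 N ustar g /\ nonzero N ustar,
        ae N (fun x => enorm x < 1 -> 0 < ustar x),
        quot N (fun x : 'rV[R]_N => Vw R0 alpha (enorm x)) p ustar g = S_alpha N p R0 alpha,
        iint N (fun x => (\1_(ball1 N) x *
               (Vw R0 alpha (enorm x) * `|ustar x| `^ (p + 1)))%:E) = 1%E &
        u = (fun x => S_alpha N p R0 alpha `^ (1 / (p - 1)) * ustar x)].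

Definition Gamma {R : realType} (s : R) : R :=
  fine (\int[@lebesgue_measure R]_(t in [set t : R | (0 < t)%R])
          ((t `^ (s - 1)) * expR (- t))%:E)%E.

Definition sphere_area {R : realType} (N : nat) : R :=
  2 * pi `^ (N%:R / 2) / Gamma (N%:R / 2).

Definition KNp {R : realType} (N : nat) (p : R) : R :=
  (N%:R - 2) `^ (- ((p + 1) / 2)) * sphere_area N `^ ((1 - p) / 2) *
  Gamma (N%:R - (p + 1) * (N%:R - 2) / 2).

(* left-hand side of the smallness condition on R, with the convention
   e^{4/(R(p+1))} = +oo when R = 0 *)
Definition condLHS {R : realType} (N : nat) (p R0 : R) : R :=
  R0 `^ (2 * N%:R / (p + 1) - (N%:R - 2)) *
  (if R0 == 0 then expR (4 / ((1 - R0) * (p + 1)))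
   else Order.min (expR (4 / (R0 * (p + 1)))) (expR (4 / ((1 - R0) * (p + 1))))).

(* Main.v *)
(** In the radial class, integrating [u'] along rays and Cauchy-Schwarz give, for a.e. [r],
    [|u(r)|^2 <= G(r) |Du|_2^2 / |S^(N-1)|] with [G(r) = (r^(2-N) - 1) / (N - 2)].  Hence
    with [q = (p + 1) / 2] the radial infimum is at least [(|S^(N-1)|^(1-q) J)^(-1/q)],
    where [J = \int_0^1 V(r) r^(N-1) G(r)^q dr].  Near the origin [V(r) <= e^(-alpha r / R0)],
    which contributes [(N-2)^(-q) (R0/alpha)^m Gamma(m)], [m = N - q (N - 2)]; near [r = 1]
    [G] vanishes and the contribution is [O(alpha^(-2))], of lower order since [0 < m < 2].
    For the full infimum, an almost optimal function for [S] is rescaled to a ball of radius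
    [1/alpha], centred at the origin or tangent to the unit sphere from inside, where
    [V >= (1 - kappa/alpha)^alpha -> e^(-kappa)] with [kappa = 2/R0], resp. [2/(1-R0)].
    The upper and lower bounds have the same order in [alpha], and the condition on [R0]
    says exactly that the leading constants are strictly ordered. *)
Require Import Defs.
From HB Require Import structures.
From mathcomp Require Import all_boot all_order all_algebra.
From mathcomp Require Import all_classical all_reals all_analysis.
From mathcomp Require Import measurable_realfun ring lra.
Import Order.TTheory GRing.Theory Num.Theory.
Import numFieldNormedType.Exports.
Local Open Scope classical_set_scope.
Local Open Scope ring_scope.

(** * Lebesgue measure on row vectors *)

(** Two obstacles shape the proof. First, the integral on R^N is given as an iterated
    one-dimensional integral, so it is identified with integration against a measure [muN] built by
    the same recursion, on the sigma-algebra generated by the open sets; Tonelli, null sets and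
    affine substitutions then become available. Second, a member of [H10] is only an L^2 limit of
    test functions that need not be radial, so it cannot be differentiated along rays. The ray
    estimate is therefore proved for test functions in integrated form, against an arbitrary bounded
    radial weight [rho]: the integral of [rho u^2] is at most the Dirichlet integral times that of
    [rho r^(N-1) G]. Such an inequality survives the limit, and choosing for [rho] the indicator of
    the radii where the pointwise bound fails recovers that bound almost everywhere. The dimension
    is written [k.+3], so that N - 1 and N - 2 are the successors [k.+2] and [k.+1]. Since [fine]
    sends infinity to 0 and division by 0 gives 0, a quotient is meaningful only once its two
    integrals are known to be finite and nonzero. *)

Notation rvec R n := (g_sigma_algebraType [set U : set 'rV[R]_n | open U]).

Section borel.
Context {R : realType}.

Lemma measurable_rvec_open n (U : set 'rV[R]_n) :
  open U -> measurable (U : set (rvec R n)).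
Proof. by move=> oU; apply: sub_sigma_algebra. Qed.

Lemma continuous_rvec_measurable n (f : 'rV[R]_n -> R) :
  continuous f -> measurable_fun setT (f : rvec R n -> R).
Proof.
move=> cf; apply: (measurability _ (RGenOpens.measurableE R)).
move=> _ [_ [a [b ->] <-]]; rewrite setTI; apply: measurable_rvec_open.
by apply: open_comp => [x _|]; [exact: cf|exact: interval_open].
Qed.

Lemma measurable_coord n (i : 'I_n) :
  measurable_fun setT (fun x : rvec R n => (x : 'rV[R]_n) 0 i).
Proof. by apply: continuous_rvec_measurable => x; exact: coord_continuous. Qed.

Lemma rvec_rat_approx n (x : 'rV[R]_n) (e : R) : 0 < e ->
  exists q : 'rV[rat]_n, forall i, `|x 0 i - ratr (q 0 i)| < e.
Proof.
move=> e0.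
have H i : exists q : rat, `|x 0 i - ratr q| < e.
  have /rat_in_itvoo[q] : x 0 i - e < x 0 i + e by lra.
  by rewrite in_itv/= => /andP[h1 h2]; exists q; rewrite ltr_norml; lra.
have [f fE] := choice H.
by exists (\row_i f i) => i; rewrite mxE.
Qed.

(** Second countability: an open set is the union of the countably many boxes with rational centre
    and radius [1/(k+1)] that it contains, and a box is a finite intersection of coordinate
    conditions. *)
Lemma measurable_rvecP d (T : measurableType d) n (f : T -> rvec R n) :
  (forall i, measurable_fun setT (fun x => (f x : 'rV[R]_n) 0 i)) ->
  measurable_fun setT f.
Proof.
move=> mf; apply: (@measurability _ _ T (rvec R n) setT f [set U : set 'rV[R]_n | open U] erefl).
move=> _ [U oU <-]; rewrite setTI.
pose B (qk : 'rV[rat]_n * nat) : set 'rV[R]_n :=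
  [set y | forall i, `|ratr (qk.1 0 i) - y 0 i| < qk.2.+1%:R^-1].
have -> : f @^-1` U = \bigcup_(qk in [set: 'rV[rat]_n * nat])
    [set x | B qk `<=` U /\ B qk (f x)].
  apply/seteqP; split => x /=; last by move=> [qk _ [BU Bf]]; exact: BU.
  move=> Ufx; have := open_nbhs_nbhs (conj oU Ufx).
  rewrite -nbhs_ballE => -[e /= e0 eU].
  (* With [2/(k+1) < e], a box of radius [1/(k+1)] whose centre is within [1/(k+1)] of [f x] stays
     inside the [e]-ball of [f x]. *)
  pose k := Num.truncn (2 / e).
  have k0 : 0 < k.+1%:R^-1 :> R by rewrite invr_gt0 ltr0n.
  have ke : k.+1%:R^-1 * 2 < e.
    have := Num.Theory.truncnS_gt (2 / e).
    rewrite -/k ltr_pdivrMr// => h.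
    by rewrite mulrC ltr_pdivrMr ?ltr0n// mulrC.
  have [q qx] := @rvec_rat_approx n (f x) _ k0.
  exists (q, k) => //; split; last by move=> i /=; rewrite distrC.
  move=> y /= By; apply: eU; split => // i j; rewrite ord1.
  rewrite /ball/=.
  rewrite (le_lt_trans (ler_distD (ratr (q 0 j)) _ _))//.
  by rewrite (le_lt_trans _ ke)// mulr2n mulrDr mulr1; rewrite lerD// ltW.
apply: countable_bigcupT_measurable => // -[q k].
have [BU|BU] := pselect (B (q, k) `<=` U); last first.
  by rewrite (_ : mkset _ = set0)//; apply/seteqP; split => // x [].
rewrite (_ : mkset _ = \bigcap_(i in [set: 'I_n])
    [set x | `|ratr (q 0 i) - (f x : 'rV[R]_n) 0 i| < k.+1%:R^-1]); last first.
  by apply/seteqP; split => x/= h; [move=> i _; case: h => _; exact|split => // i; exact: h].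
apply: fin_bigcap_measurable => // i _.
rewrite (_ : mkset _ = (fun x => (f x : 'rV[R]_n) 0 i) @^-1` (ball (ratr (q 0 i) : R) k.+1%:R^-1))//.
by rewrite -[X in measurable X]setTI; apply: mf => //; exact: measurable_ball.
Qed.

Lemma measurable_comp_rvec d d' (T : measurableType d) (U : measurableType d') n
    (f : rvec R n -> U) (g : T -> 'rV[R]_n) :
  measurable_fun setT f ->
  (forall i, measurable_fun setT (fun x => g x 0 i)) ->
  measurable_fun setT (fun x => f (g x)).
Proof.
move=> mf mg; apply: (@measurableT_comp _ _ _ T (rvec R n) U f setT g mf).
exact: measurable_rvecP.
Qed.

Definition cons_rv {n} (ty : R * 'rV[R]_n) : 'rV[R]_(n.+1) :=
  row_mx (const_mx ty.1 : 'rV[R]_1) ty.2.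

Lemma cons_rv_0 n (ty : R * 'rV[R]_n) : cons_rv ty 0 ord0 = ty.1.
Proof.
transitivity (row_mx (const_mx ty.1 : 'rV[R]_1) ty.2 0 (lshift n (ord0 : 'I_1))).
  by congr (fun_of_matrix _ _ _); exact/val_inj.
by rewrite row_mxEl mxE.
Qed.

Lemma cons_rv_S n (ty : R * 'rV[R]_n) (i : 'I_n) :
  cons_rv ty 0 (lift ord0 i) = ty.2 0 i.
Proof.
transitivity (row_mx (const_mx ty.1 : 'rV[R]_1) ty.2 0 (rshift 1 i)).
  by congr (fun_of_matrix _ _ _); exact/val_inj.
by rewrite row_mxEr.
Qed.

Lemma measurable_cons_rv_coord n (i : 'I_n.+1) :
  measurable_fun setT (fun ty : R * rvec R n => cons_rv (ty : R * 'rV[R]_n) 0 i).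
Proof.
have [->|[j ->]] : i = ord0 \/ exists j, i = lift ord0 j.
  by case: (unliftP ord0 i) => [j ->|->]; [right; exists j|left].
  rewrite (_ : (fun _ => _) = fst); last by apply/funext => x; rewrite cons_rv_0.
  exact: measurable_fst.
rewrite (_ : (fun _ => _) = (fun x : rvec R n => (x : 'rV[R]_n) 0 j) \o snd).
  by apply: measurableT_comp => //; exact: measurable_coord.
by apply/funext => x; rewrite cons_rv_S.
Qed.

Lemma measurable_cons_rv n :
  measurable_fun setT (@cons_rv n : R * rvec R n -> rvec R n.+1).
Proof. by apply: measurable_rvecP => i; exact: measurable_cons_rv_coord. Qed.

End borel.

Section consmeasure.
Context {R : realType} {n : nat} (m : {sigma_finite_measure set (rvec R n) -> \bar R}).
Local Open Scope ereal_scope.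

(** The recursion step of [iint] as an image measure. *)
Definition consm : set (rvec R n.+1) -> \bar R :=
  pushforward (@lebesgue_measure R \x m)
    (@cons_rv R n : measurableTypeR R * rvec R n -> rvec R n.+1).

Let mpre (A : set (rvec R n.+1)) : measurable A ->
  measurable ((@cons_rv R n : measurableTypeR R * rvec R n -> rvec R n.+1) @^-1` A).
Proof. by move=> mA; rewrite -[X in measurable X]setTI; exact: measurable_cons_rv. Qed.

Let consm0 : consm set0 = 0.
Proof. by rewrite /consm /pushforward preimage_set0 measure0. Qed.

Let consm_ge0 A : 0 <= consm A.
Proof. rewrite /consm /pushforward; exact: measure_ge0. Qed.

Let consm_sigma_additive : semi_sigma_additive consm.
Proof.
move=> F mF tF mUF; rewrite /consm /pushforward preimage_bigcup.
apply: measure_semi_sigma_additive.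
- by move=> k; exact: mpre.
- apply/trivIsetP => /= i j _ _ ij; rewrite -preimage_setI.
  by move/trivIsetP : tF => /(_ _ _ _ _ ij) ->//; rewrite preimage_set0.
- by rewrite -preimage_bigcup; exact: mpre.
Qed.

HB.instance Definition _ := isMeasure.Build _ _ _ consm
  consm0 consm_ge0 consm_sigma_additive.

(** Carried through the recursion because Tonelli asks for it in the next dimension. The exhausting
    sets of both factors are taken increasing, so a single index can serve both. *)
Let consm_sigma_finite : sigma_finite setT consm.
Proof.
have /sigma_finiteP[F [TF ndF Foo]] := sigma_finiteT (@lebesgue_measure R).
have /sigma_finiteP[G [TG ndG Goo]] := sigma_finiteT m.
pose lead (x : rvec R n.+1) : R := (x : 'rV[R]_n.+1) 0%R ord0.
pose tl (x : rvec R n.+1) : rvec R n := \row_i (x : 'rV[R]_n.+1) 0%R (lift ord0 i).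
have mlead : measurable_fun setT lead by exact: measurable_coord.
have mtl : measurable_fun setT tl.
  apply: measurable_rvecP => i.
  rewrite [X in measurable_fun _ X](_ : _ = fun x : rvec R n.+1 => (x : 'rV[R]_n.+1) 0%R (lift ord0 i)).
    exact: measurable_coord.
  by apply/funext => x; rewrite /tl mxE.
exists (fun k => lead @^-1` F k `&` tl @^-1` G k).
  apply/seteqP; split => // x _.
  have [i _ Fi] : (\bigcup_i F i) (lead x) by rewrite -TF.
  have [j _ Gj] : (\bigcup_i G i) (tl x) by rewrite -TG.
  exists (maxn i j) => //; split => /=.
    by move: Fi; apply/subsetPset/ndF/leq_maxl.
  by move: Gj; apply/subsetPset/ndG/leq_maxr.
move=> k; have [mF Fk] := Foo k; have [mG Gk] := Goo k.
split.
  by apply: measurableI; rewrite -[X in measurable X]setTI; [exact: mlead|exact: mtl].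
rewrite /consm /pushforward (_ : _ @^-1` _ = F k `*` G k).
  by rewrite product_measure1E// lte_mul_pinfty// ge0_fin_numE.
apply/seteqP; split => -[t y] /=; rewrite /lead /tl cons_rv_0/=.
  move=> [Ft]; rewrite (_ : (\row_i _) = y)//.
  by apply/rowP => i; rewrite mxE cons_rv_S.
move=> [Ft Gy]; split=> //; rewrite (_ : (\row_i _) = y)//.
by apply/rowP => i; rewrite mxE cons_rv_S.
Qed.

HB.instance Definition _ := Measure_isSigmaFinite.Build _ _ _ consm consm_sigma_finite.

End consmeasure.

(** Lebesgue measure on the Borel sets of R^n. The Dirac mass in dimension 0 matches the base case
    of [iint], evaluation at 0. *)
Fixpoint muN {R : realType} (n : nat) : {sigma_finite_measure set (rvec R n) -> \bar R} :=
  match n with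
  | 0 => [the {sigma_finite_measure set (rvec R 0) -> \bar R} of \d_((0%R : 'rV[R]_0) : rvec R 0)]
  | n'.+1 => [the {sigma_finite_measure set (rvec R n'.+1) -> \bar R} of consm (muN n')]
  end.

Section iint_measure.
Context {R : realType}.
Local Open Scope ereal_scope.
Implicit Types n : nat.

(** One use of Tonelli per dimension. All later facts on [iint] that need linearity, monotonicity or
    null sets go through this identity. *)
Lemma iintE n (f : rvec R n -> \bar R) : measurable_fun setT f ->
  (forall x, 0 <= f x) -> iint n f = \int[muN n]_x f x.
Proof.
elim: n f => [|n IH] f mf f0.
  by rewrite /= integral_dirac// diracT mul1e.
rewrite /= ge0_integral_pushforward//; last exact: measurable_cons_rv.
rewrite preimage_setT fubini_tonelli1//=; last first.
  by apply: measurable_comp_rvec => // i; exact: measurable_cons_rv_coord.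
apply: eq_integral => t _; rewrite /fubini_F/= IH//.
apply: (@measurable_comp_rvec _ _ _ (rvec R n) _ _ f (fun y => cons_rv (t, y)) mf) => i.
exact: (measurableT_comp (measurable_cons_rv_coord _ i) (measurable_pair1 t)).
Qed.

End iint_measure.

(** * Affine changes of variables *)

Section affine1.
Context {R : realType}.
Local Notation mu := (@lebesgue_measure R).

Lemma measurable_affine (a b : R) :
  measurable_fun setT (fun x : R => a * x + b).
Proof.
by apply: measurable_funD => //; apply: measurable_funM.
Qed.

(** Uniqueness of Lebesgue measure reduces the claim to intervals []c, d]]. A negative [a] moves the
    open end to the other side, which does not change the length. *)
Lemma lebesgue_measure_affine (a b : R) (A : set R) : a != 0 -> measurable A ->
  mu A = (`|a|%:E * mu ((fun x : R => a * x + b)%R @^-1` A))%E.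
Proof.
move=> a0 mA; pose na : {nonneg R} := NngNum (normr_ge0 a).
pose phi : measurableTypeR R -> measurableTypeR R := fun x : R => a * x + b.
have mphi : measurable_fun setT phi by exact: measurable_affine.
have -> : (`|a|%:E * mu ((fun x : R => a * x + b)%R @^-1` A))%E =
  mscale na (pushforward mu phi) A by [].
apply: (@lebesgue_measure_unique R) => //= _ [[c d]] _ <-.
rewrite /mscale/= /pushforward.
have [a_gt0|a_le0] := ltP 0 a.
  have -> : phi @^-1` `]c, d] = `](c - b) / a, (d - b) / a]%classic.
    apply/seteqP; split => x/=; rewrite !in_itv/= /phi;
      by rewrite ltr_pdivrMr// ler_pdivlMr// ltrBlDr lerBrDr mulrC.
  rewrite !lebesgue_measure_itv/= !lte_fin ltr_pM2r ?invr_gt0// ltrD2r.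
  case: ifPn => cd; last by rewrite mule0.
  by rewrite -!EFinB -EFinM gtr0_norm//; congr EFin; field.
have a_lt0 : a < 0 by rewrite lt_neqAle a0.
have -> : phi @^-1` `]c, d] = `[(d - b) / a, (c - b) / a[%classic.
  apply/seteqP; split => x/=; rewrite !in_itv/= /phi;
    by rewrite ltr_ndivlMr// ler_ndivrMr// ltrBlDr lerBrDr mulrC andbC.
rewrite !lebesgue_measure_itv/= !lte_fin ltr_nM2r ?invr_lt0// ltrD2r.
case: ifPn => cd; last by rewrite mule0.
by rewrite -!EFinB -EFinM ltr0_norm//; congr EFin; field.
Qed.

Lemma integral_affine (a b : R) (f : R -> \bar R) : a != 0 ->
  measurable_fun setT f -> (forall x, 0 <= f x)%E ->
  (\int[mu]_x f (a * x + b)%R = `|a|^-1%:E * \int[mu]_x f x)%E.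
Proof.
move=> a0 mf f0; have k0 : 0 <= `|a|^-1 by rewrite invr_ge0.
pose phi : measurableTypeR R -> measurableTypeR R := fun x : R => a * x + b.
have mphi : measurable_fun setT phi by exact: measurable_affine.
transitivity (\int[mscale (NngNum k0) mu]_x f x)%E; last first.
  by rewrite ge0_integral_mscale.
transitivity (\int[mu]_(x in phi @^-1` setT) (f \o phi) x)%E.
  by rewrite preimage_setT.
rewrite -ge0_integral_pushforward//.
apply: eq_measure_integral => //= A mA _.
rewrite /mscale/= /pushforward [in RHS](lebesgue_measure_affine a b A)// muleA -EFinM.
by rewrite mulVf ?normr_eq0// mul1e.
Qed.

End affine1.

Section iintN.
Context {R : realType}.
Local Notation mu := (@lebesgue_measure R).

Lemma iint_ge0 n (f : 'rV[R]_n -> \bar R) : (forall x, 0 <= f x)%E -> (0 <= iint n f)%E.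
Proof.
by elim: n f => [|n IH] f f0 //=; apply: integral_ge0 => t _; exact: IH.
Qed.

Lemma eq_iint n (f g : 'rV[R]_n -> \bar R) : f =1 g -> iint n f = iint n g.
Proof. by move=> fg; congr (iint n _); exact/funext. Qed.

Lemma iintS n (f : 'rV[R]_n.+1 -> \bar R) :
  (iint n.+1 f = \int[mu]_t iint n (fun y => f (cons_rv (t, y))))%E.
Proof. by []. Qed.

Lemma measurable_pair2r d (T : measurableType d) n (f : T * rvec R n -> \bar R) x :
  measurable_fun setT f -> measurable_fun setT (fun y : rvec R n => f (x, y)).
Proof. by move=> mf; apply: (measurableT_comp mf); exact: measurable_pair1. Qed.

Lemma measurable_iint d (T : measurableType d) n (f : T * rvec R n -> \bar R) :
  measurable_fun setT f -> (forall x, 0 <= f x)%E ->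
  measurable_fun setT (fun x => iint n (fun y => f (x, y))).
Proof.
move=> mf f0; rewrite (_ : (fun x => _) = fubini_F (muN n) f).
  exact: measurable_fun_fubini_tonelli_F.
by apply/funext => x; rewrite iintE//; exact: measurable_pair2r.
Qed.

Lemma tonelli_iint n (f : R * rvec R n -> \bar R) :
  measurable_fun setT f -> (forall x, 0 <= f x)%E ->
  (\int[mu]_t iint n (fun y => f (t, y)) = iint n (fun y => \int[mu]_t f (t, y)))%E.
Proof.
move=> mf f0; transitivity (\int[mu]_t \int[muN n]_y f (t, y))%E.
  by apply: eq_integral => t _; rewrite iintE//; exact: measurable_pair2r.
rewrite (fubini_tonelli (m1 := mu) (m2 := muN n) f)// iintE//.
  exact: (measurable_fun_fubini_tonelli_G (m1 := mu) f).
by move=> y; exact: integral_ge0.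
Qed.

Lemma iintZl n (k : R) (f : rvec R n -> \bar R) : 0 <= k ->
  measurable_fun setT f -> (forall x, 0 <= f x)%E ->
  (iint n (fun x => k%:E * f x) = k%:E * iint n f)%E.
Proof.
move=> k0 mf f0; rewrite !iintE//.
- exact: ge0_integralZl_EFin.
- exact: measurable_funeM.
- by move=> x; rewrite mule_ge0.
Qed.

Lemma measurable_cons_rv_comp n (f : rvec R n.+1 -> \bar R) :
  measurable_fun setT f ->
  measurable_fun setT (fun ty : R * rvec R n => f (cons_rv (ty : R * 'rV[R]_n))).
Proof.
move=> mf; apply: (@measurable_comp_rvec _ _ _ _ _ _ f _ mf) => i.
exact: measurable_cons_rv_coord.
Qed.

Definition hd_rv n (x : 'rV[R]_n.+1) : R := x 0 ord0.
Definition tl_rv n (x : 'rV[R]_n.+1) : 'rV[R]_n := \row_i x 0 (lift ord0 i).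

Lemma cons_rv_affine n a (b : 'rV[R]_n.+1) t (y : 'rV[R]_n) :
  a *: cons_rv (t, y) + b = cons_rv (a * t + hd_rv n b, a *: y + tl_rv n b).
Proof.
apply/rowP => i; case: (unliftP ord0 i) => [j ->|->].
  rewrite cons_rv_S/= [LHS]mxE [X in X + _ = _]mxE cons_rv_S [RHS]mxE.
  by rewrite [X in _ = X + _]mxE [X in _ = _ + X]mxE.
by rewrite cons_rv_0 [LHS]mxE [X in X + _ = _]mxE cons_rv_0.
Qed.

Lemma cons_rvZ n a t (y : 'rV[R]_n) : a *: cons_rv (t, y) = cons_rv (a * t, a *: y).
Proof.
apply/rowP => i; case: (unliftP ord0 i) => [j ->|->].
  by rewrite cons_rv_S/= [LHS]mxE cons_rv_S [RHS]mxE.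
by rewrite cons_rv_0 [LHS]mxE cons_rv_0.
Qed.

Lemma measurable_affine_rv n (a : R) (b : 'rV[R]_n) (i : 'I_n) :
  measurable_fun setT (fun x : rvec R n => (a *: (x : 'rV[R]_n) + b) 0 i).
Proof.
rewrite (_ : (fun x => _) = fun x : rvec R n => a * (x : 'rV[R]_n) 0 i + b 0 i).
  by apply: measurable_funD => //; apply: measurable_funM => //; exact: measurable_coord.
by apply/funext => x; rewrite !mxE.
Qed.

Lemma measurable_comp_affine_rv d (U : measurableType d) n (a : R) (b : 'rV[R]_n)
    (f : rvec R n -> U) :
  measurable_fun setT f ->
  measurable_fun setT (fun x : rvec R n => f (a *: (x : 'rV[R]_n) + b)).
Proof.
move=> mf; apply: (@measurable_comp_rvec _ _ _ (rvec R n) _ _ f _ mf) => i.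
exact: measurable_affine_rv.
Qed.

(** [cons_rv_affine] separates the first coordinate from the others, and each coordinate contributes
    one factor [|a|^-1]. *)
Lemma iint_affine n (a : R) (b : 'rV[R]_n) (f : rvec R n -> \bar R) : a != 0 ->
  measurable_fun setT f -> (forall x, 0 <= f x)%E ->
  (iint n (fun x => f (a *: x + b)%R) = (`|a| ^- n)%:E * iint n f)%E.
Proof.
move=> a0; elim: n b f => [|n IH] b f mf f0.
  rewrite /= expr0 invr1 mul1e; congr f; apply/rowP => -[]//.
rewrite !iintS.
have mfr : measurable_fun setT (fun ty : R * rvec R n => f (cons_rv (ty : R * 'rV[R]_n))).
  exact: measurable_cons_rv_comp.
have mF : measurable_fun setT (fun t : R => iint n (fun y => f (cons_rv (t, y)))).
  exact: (@measurable_iint _ _ _ (fun ty : R * rvec R n => f (cons_rv (ty : R * 'rV[R]_n)))).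
transitivity (\int[mu]_t ((`|a| ^- n)%:E *
    iint n (fun y => f (cons_rv ((a * t + hd_rv n b)%R, y)))))%E.
  apply: eq_integral => t _.
  rewrite -(IH (tl_rv n b)) //; first by apply: eq_iint => y; rewrite cons_rv_affine.
  exact: (@measurable_pair2r _ R n (fun ty : R * rvec R n => f (cons_rv (ty : R * 'rV[R]_n)))).
rewrite ge0_integralZl_EFin//.
- rewrite (integral_affine a (hd_rv n b) (fun t => iint n (fun y => f (cons_rv (t, y)))))//.
    by rewrite muleA -EFinM exprSr invfM mulrC.
  by move=> x; exact: iint_ge0.
- by move=> x _; exact: iint_ge0.
- exact: (measurableT_comp mF (measurable_affine a (hd_rv n b))).
Qed.

End iintN.

(** * Polar coordinates *)

Section cone.
Context {R : realType}.
Local Notation mu := (@lebesgue_measure R).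

Lemma measurable_cone_coord n (i : 'I_n.+1) :
  measurable_fun setT (fun tz : R * rvec R n =>
    cons_rv (tz.1, tz.1 *: (tz.2 : 'rV[R]_n)) 0 i).
Proof.
case: (unliftP ord0 i) => [j ->|->].
  rewrite (_ : (fun _ => _) = fun tz : R * rvec R n => tz.1 * (tz.2 : 'rV[R]_n) 0 j).
    apply: measurable_funM => //.
    exact: (measurableT_comp (measurable_coord _ j) measurable_snd).
  by apply/funext => x; rewrite cons_rv_S/= mxE.
rewrite (_ : (fun _ => _) = fst); first exact: measurable_fst.
by apply/funext => x; rewrite cons_rv_0.
Qed.

Lemma measurable_cone d (U : measurableType d) n (F : rvec R n.+1 -> U) :
  measurable_fun setT F ->
  measurable_fun setT (fun tz : R * rvec R n =>
    F (cons_rv (tz.1, tz.1 *: (tz.2 : 'rV[R]_n)))).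
Proof.
move=> mF; apply: (@measurable_comp_rvec _ _ _ _ _ _ F _ mF) => i.
exact: measurable_cone_coord.
Qed.

(* The substitution [y = t z] on the fibre over the first coordinate [t]; it replaces spherical
   coordinates, the lines through the origin being parametrised by their slope [z]. *)
Lemma iint_cone n (F : rvec R n.+1 -> \bar R) :
  measurable_fun setT F -> (forall x, 0 <= F x)%E ->
  (iint n.+1 F =
   iint n (fun z => \int[mu]_t ((`|t| ^+ n)%:E * F (cons_rv (t, t *: z)))))%E.
Proof.
move=> mF F0; rewrite iintS.
pose H (tz : R * rvec R n) :=
  ((`|tz.1| ^+ n)%:E * F (cons_rv (tz.1, tz.1 *: (tz.2 : 'rV[R]_n))))%E.
have H0 x : (0 <= H x)%E by rewrite mule_ge0// lee_fin exprn_ge0.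
have mH : measurable_fun setT H.
  apply: emeasurable_funM; last exact: measurable_cone.
  apply/measurable_EFinP; apply: measurable_funX.
  by apply: measurableT_comp => //; exact: measurable_fst.
rewrite -(tonelli_iint n H)//.
apply: ge0_ae_eq_integral => //.
- apply: (@measurable_iint _ _ _ n (fun ty : R * rvec R n => F (cons_rv (ty : R * 'rV[R]_n)))) => //.
  exact: measurable_cons_rv_comp.
- exact: measurable_iint.
- by move=> t _; exact: iint_ge0.
- by move=> t _; exact: iint_ge0.
(* The substitution degenerates on the fibre [t = 0], which is negligible. *)
exists [set 0]; split; [exact: measurable_set1|exact: lebesgue_measure_set1|].
move=> t /= ht; apply: contrapT => /= /eqP t0; apply: ht => _.
have mFt : measurable_fun setT (fun y : rvec R n => F (cons_rv (t, y : 'rV[R]_n))).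
  apply: (@measurable_pair2r _ _ _ n (fun ty : R * rvec R n => F (cons_rv (ty : R * 'rV[R]_n)))).
  exact: measurable_cons_rv_comp.
rewrite /H/= iintZl//; last first.
  apply: (@measurable_pair2r _ _ _ n (fun tz : R * rvec R n => F (cons_rv (tz.1, tz.1 *: (tz.2 : 'rV[R]_n))))).
  exact: measurable_cone.
transitivity ((`|t| ^+ n)%:E * iint n (fun y => F (cons_rv (t, (t *: y + 0)%R))))%E.
  rewrite (iint_affine n t 0 (fun y => F (cons_rv (t, y))))//.
  rewrite muleA -EFinM mulfV ?mul1e//.
  by rewrite expf_eq0 normr_eq0 (negbTE t0) andbF.
by congr (_ * _)%E; apply: eq_iint => y; rewrite addr0.
Qed.

Lemma measurable_oppr_comp d (U : measurableType d) (f : R -> U) :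
  measurable_fun setT f -> measurable_fun setT (fun t : R => f (- t)).
Proof. by move=> mf; apply: (measurableT_comp mf); exact: oppr_measurable. Qed.

(** Splits the integral along a line through the origin into those along its two opposite rays. *)
Lemma integral_halfline (f : R -> \bar R) :
  measurable_fun setT f -> (forall x, 0 <= f x)%E ->
  (\int[mu]_t f t = \int[mu]_(t in `]0%R, +oo[) (f t + f (- t)%R))%E.
Proof.
move=> mf f0.
have mfN : measurable_fun setT (fun t : R => f (- t)) by exact: measurable_oppr_comp.
rewrite ge0_integralD//; [|exact: measurable_funTS|exact: measurable_funTS].
have -> : (\int[mu]_(t in `]0%R, +oo[) f (- t)%R = \int[mu]_(t in `]-oo, 0%R]) f t)%E.
  rewrite integral_itv_obnd_cbnd; last exact: measurable_funTS.
  rewrite (@ge0_integration_by_substitution0 R (fun t : R => f (- t)%R))//.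
  by apply: eq_integral => t _; rewrite opprK.
rewrite -(setUv (`]0%R, +oo[%classic : set R)) ge0_integral_setU//; last 3 first.
- exact: measurableC.
- exact: measurable_funTS.
- exact/disj_setPCl.
by rewrite setCitvr.
Qed.

End cone.

Section enorm.
Context {R : realType}.

Lemma sum_sqr_ge0 n (F : 'I_n -> R) : 0 <= \sum_i F i ^+ 2.
Proof. by apply: sumr_ge0 => i _; rewrite sqr_ge0. Qed.

Lemma enorm_ge0 n (x : 'rV[R]_n) : 0 <= enorm x.
Proof. exact: sqrtr_ge0. Qed.

Lemma sqr_enorm n (x : 'rV[R]_n) : enorm x ^+ 2 = \sum_(i < n) x 0 i ^+ 2.
Proof. by rewrite sqr_sqrtr// sum_sqr_ge0. Qed.

Lemma enormZ n (a : R) (x : 'rV[R]_n) : enorm (a *: x) = `|a| * enorm x.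
Proof.
rewrite /enorm -sqrtr_sqr -sqrtrM ?sqr_ge0// mulr_sumr.
by congr Num.sqrt; apply: eq_bigr => i _; rewrite mxE exprMn.
Qed.

Lemma enorm_cons_rv_sqr n t (y : 'rV[R]_n) :
  enorm (cons_rv (t, y)) ^+ 2 = t ^+ 2 + enorm y ^+ 2.
Proof.
rewrite !sqr_enorm big_ord_recl cons_rv_0/=; congr (_ + _).
by apply: eq_bigr => i _; rewrite cons_rv_S.
Qed.

Lemma continuous_sumsq n : continuous (fun x : 'rV[R]_n => \sum_(i < n) x 0 i ^+ 2).
Proof.
apply: continuous_big => [|i _ x]; first exact: add_continuous.
rewrite (_ : (fun y : 'rV[R]_n => y 0 i ^+ 2) = (fun y => y 0 i * y 0 i)).
  by apply: continuousM; exact: coord_continuous.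
by apply/funext => y; rewrite expr2.
Qed.

Lemma continuous_enorm n : continuous (@enorm R n).
Proof.
move=> x; apply: (continuous_comp (@continuous_sumsq n x)).
exact: sqrt_continuous.
Qed.

Lemma measurable_enorm n : measurable_fun setT (@enorm R n : rvec R n -> R).
Proof. exact: continuous_rvec_measurable (@continuous_enorm n). Qed.

Lemma measurable_comp_enorm d (U : measurableType d) n (G : R -> U) :
  measurable_fun setT G ->
  measurable_fun setT (fun x : rvec R n => G (enorm (x : 'rV[R]_n))).
Proof. by move=> mG; apply: (measurableT_comp mG); exact: measurable_enorm. Qed.

(** On the line spanned by [(1, z)], the ratio of the distance to the origin to the absolute value
    of the first coordinate ([enorm_cone]). *)
Definition slope n (z : 'rV[R]_n) : R := enorm (cons_rv (1, z)).

Lemma slope_ge1 n (z : 'rV[R]_n) : 1 <= slope n z.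
Proof.
rewrite /slope -[leRHS]ger0_norm ?enorm_ge0// -sqrtr_sqr enorm_cons_rv_sqr expr1n.
by rewrite -[leLHS]sqrtr1 ler_wsqrtr// lerDl sqr_ge0.
Qed.

Lemma slope_gt0 n (z : 'rV[R]_n) : 0 < slope n z.
Proof. by rewrite (lt_le_trans ltr01)// slope_ge1. Qed.

Lemma cons_rv_ray n t (z : 'rV[R]_n) : cons_rv (t, t *: z) = t *: cons_rv (1, z).
Proof. by rewrite cons_rvZ mulr1. Qed.

Lemma enorm_cone n t (z : 'rV[R]_n) : enorm (cons_rv (t, t *: z)) = `|t| * slope n z.
Proof. by rewrite cons_rv_ray enormZ. Qed.

Lemma measurable_slope n : measurable_fun setT (@slope n : rvec R n -> R).
Proof.
apply: (@measurable_comp_rvec _ _ _ (rvec R n) _ _ (@enorm R n.+1) (fun z => cons_rv (1, z))).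
  exact: measurable_enorm.
move=> i; apply: (measurableT_comp (measurable_cons_rv_coord n i)).
exact: measurable_pair1.
Qed.

End enorm.

Section polar.
Context {R : realType}.
Local Notation mu := (@lebesgue_measure R).

(* Central projection of a hemisphere onto the hyperplane [x_0 = 1], with a factor 2 for the two
   hemispheres. *)
Definition sphere_meas n : \bar R :=
  iint n (fun z : 'rV[R]_n => (2 * slope n z ^- n.+1)%:E).

Lemma sphere_meas_meas n :
  measurable_fun setT (fun z : rvec R n => (2 * slope n (z : 'rV[R]_n) ^- n.+1)%:E).
Proof.
apply/measurable_EFinP; apply: measurable_funM => //.
rewrite (_ : (fun z => _) = (fun z : rvec R n => (slope n (z : 'rV[R]_n))^-1 ^+ n.+1)).
  apply: measurable_funX.
  rewrite (_ : (fun z => _) = (fun z : rvec R n => slope n (z : 'rV[R]_n) `^ (-1))).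
    by apply: (measurableT_comp (measurable_powR (-1))); exact: measurable_slope.
  by apply/funext => z; rewrite powR_inv1// ltW// slope_gt0.
by apply/funext => z; rewrite exprVn.
Qed.

(** On the line of parameter [z] the radius is [r = |t| slope z], so [|t|^n dt] becomes
    [slope^-(n+1) r^n dr]; the two rays of the line give the factor 2 in [sphere_meas]. *)
Lemma iint_polar n (G : R -> \bar R) :
  measurable_fun setT G -> (forall x, 0 <= G x)%E ->
  (iint n.+1 (fun x => G (enorm x)) =
   sphere_meas n * \int[mu]_(r in `]0%R, +oo[) ((r ^+ n)%:E * G r))%E.
Proof.
move=> mG G0.
rewrite (iint_cone n (fun x => G (enorm x)))//; last exact: measurable_comp_enorm.
pose H (t : R) : \bar R := ((`|t| ^+ n)%:E * G `|t|%R)%E.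
have H0 t : (0 <= H t)%E by rewrite mule_ge0// lee_fin exprn_ge0.
have mH : measurable_fun setT H.
  apply: emeasurable_funM.
    by apply/measurable_EFinP; apply: measurable_funX.
  exact: measurableT_comp.
set I := (\int[mu]_(r in _) _)%E.
have HI : (\int[mu]_t H t = 2%:E * I)%E.
  rewrite integral_halfline// /I -ge0_integralZl//; last 2 first.
  - apply: emeasurable_funM; last exact: measurable_funTS.
    by apply/measurable_EFinP; apply: measurable_funX.
  - by move=> x; rewrite /= in_itv/= andbT => x0; rewrite mule_ge0// lee_fin exprn_ge0// ltW.
  apply: eq_integral => t; rewrite inE/= in_itv/= andbT => t0.
  by rewrite /H normrN gtr0_norm// mule_natl mule2n.
transitivity (iint n (fun z => (2 * slope n z ^- n.+1)%:E * I)%E).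
  apply: eq_iint => z; have l0 := slope_gt0 n z.
  have ln0 : slope n z != 0 by rewrite gt_eqF.
  transitivity (\int[mu]_t ((slope n z ^- n)%:E * H (slope n z * t + 0)%R))%E.
    apply: eq_integral => t _; rewrite enorm_cone /H addr0 normrM (gtr0_norm l0).
    rewrite muleA -EFinM exprMn mulrA mulVf ?mul1r ?expf_neq0//.
    by rewrite [(slope n z * _)%R]mulrC.
  rewrite ge0_integralZl_EFin//; last 2 first.
  - exact: (measurableT_comp mH (measurable_affine _ _)).
  - by rewrite invr_ge0 exprn_ge0// ltW.
  rewrite integral_affine// HI (gtr0_norm l0) !muleA -!EFinM; congr (_%:E * _)%E.
  by rewrite exprSr invfM mulrC mulrA.
rewrite iintE; last 2 first.
- apply: emeasurable_funM => //; exact: sphere_meas_meas.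
- move=> z; rewrite mule_ge0//.
    by rewrite lee_fin mulr_ge0// invr_ge0 exprn_ge0// ltW// slope_gt0.
  apply: integral_ge0 => r /=; rewrite in_itv/= andbT => r0.
  by rewrite mule_ge0// lee_fin exprn_ge0// ltW.
rewrite ge0_integralZr//.
- rewrite -iintE//; first exact: sphere_meas_meas.
  by move=> z; rewrite lee_fin mulr_ge0// invr_ge0 exprn_ge0// ltW// slope_gt0.
- exact: sphere_meas_meas.
- by move=> z _; rewrite lee_fin mulr_ge0// invr_ge0 exprn_ge0// ltW// slope_gt0.
- apply: integral_ge0 => r /=; rewrite in_itv/= andbT => r0.
  by rewrite mule_ge0// lee_fin exprn_ge0// ltW.
Qed.

(** The integrand factorises over the coordinates. The value calibrates [sphere_meas], and its
    positivity shows that the whole space is not null. *)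
Lemma iint_gauss n : iint n (fun x : 'rV[R]_n => (expR (- enorm x ^+ 2))%:E) =
  (Num.sqrt pi ^+ n)%:E :> \bar R.
Proof.
elim: n => [|n IH].
  by rewrite /= expr0 -[RHS]/(1%:E) -expR0 sqr_enorm big_ord0 oppr0.
have mg k : measurable_fun setT (fun y : rvec R k => (expR (- enorm (y : 'rV[R]_k) ^+ 2))%:E).
  apply: (@measurable_comp_enorm R _ _ k (fun r => (expR (- r ^+ 2))%:E)).
  apply/measurable_EFinP; apply: measurableT_comp => //.
  apply: measurableT_comp => //; exact: measurable_funX.
rewrite iintS.
transitivity (\int[mu]_t ((gauss_fun t)%:E * (Num.sqrt pi ^+ n)%:E))%E.
  apply: eq_integral => t _; rewrite -IH -iintZl//; last exact: gauss_fun_ge0.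
  by apply: eq_iint => y; rewrite enorm_cons_rv_sqr opprD expRD EFinM.
rewrite ge0_integralZr//.
- by rewrite integralT_gauss -EFinM exprS.
- by apply/measurable_EFinP; exact: measurable_gauss_fun.
- by move=> t _; rewrite lee_fin gauss_fun_ge0.
Qed.

End polar.

(** * The Gamma function and the area of the sphere *)

Section gamma.
Context {R : realType}.
Local Notation mu := (@lebesgue_measure R).

(** Kept in the extended reals so that convergence can be stated and proved; [Gamma] would read 0 on
    a divergent integral. *)
Definition gammaE (s : R) : \bar R :=
  (\int[mu]_(t in `]0%R, +oo[) (t `^ (s - 1) * expR (- t))%:E)%E.

Lemma GammaE (s : R) : Gamma s = fine (gammaE s).
Proof.
rewrite /Gamma /gammaE (_ : [set t : R | 0 < t] = `]0%R, +oo[%classic)//.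
by apply/seteqP; split => x /=; rewrite in_itv/= andbT.
Qed.

Lemma continuous_powR_gt0 (a x : R) : 0 < x -> {for x, continuous (fun y : R => y `^ a)}.
Proof.
move=> x0; apply/differentiable_continuous/derivable1_diffP.
by apply: derivable_powR; rewrite in_itv/= andbT.
Qed.

Lemma bigcup_itv0y (f : nat -> R) : (forall k, 0 < f k) ->
  (forall e, 0 < e -> exists2 k, f k <= e & e <= (f k)^-1) ->
  \bigcup_k `[f k, (f k)^-1]%classic = `]0%R, +oo[%classic.
Proof.
move=> f0 fe; apply/seteqP; split => x /=.
  move=> [k _] /=; rewrite !in_itv/= andbT => /andP[h _].
  exact: lt_le_trans h.
rewrite in_itv/= andbT => x0; have [k h1 h2] := fe _ x0.
by exists k => //=; rewrite in_itv/= h1.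
Qed.

Lemma invS_exhaust (e : R) : 0 < e -> exists2 k : nat, k.+1%:R^-1 <= e & e <= k.+1%:R.
Proof.
move=> e0; pose k := Num.truncn (e + e^-1); exists k.
  rewrite invf_ple ?posrE// ?ltr0n//.
  apply: le_trans (ltW (Num.Theory.truncnS_gt (e + e^-1))).
  by rewrite lerDr ltW.
apply: le_trans (ltW (Num.Theory.truncnS_gt (e + e^-1))).
by rewrite lerDl invr_ge0 ltW.
Qed.

(** The substitution [t = r^2], which turns Gamma(N/2) into a radial Gaussian integral. The powers
    may be singular at 0, so it is done on compact intervals [[e, 1/e]] and passed to the limit by
    monotone convergence. *)
Lemma gamma_subst (s : R) :
  gammaE s = (\int[mu]_(r in `]0%R, +oo[) (r `^ (2 * s - 1) * 2 * expR (- r ^+ 2))%:E)%E.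
Proof.
pose f (k : nat) : R := k.+1%:R^-1.
have f0 k : 0 < f k by rewrite invr_gt0.
have f1 k : f k <= 1 by rewrite invf_le1// ler1n.
pose G (t : R) : R := t `^ (s - 1) * expR (- t).
pose H (r : R) : R := r `^ (2 * s - 1) * 2 * expR (- r ^+ 2).
have mG : measurable_fun setT G by apply: measurable_funM => //; apply: measurableT_comp.
have mH : measurable_fun setT H.
  apply: measurable_funM; first exact: measurable_funM.
  apply: measurableT_comp => //; apply: measurableT_comp => //; exact: measurable_funX.
have itv0y : \bigcup_k `[f k, (f k)^-1]%classic = `]0%R, +oo[%classic.
  apply: bigcup_itv0y => // e e0; have [k h1 h2] := invS_exhaust e e0.
  by exists k => //; rewrite invrK.
have itv0y2 : \bigcup_k `[f k ^+ 2, (f k ^+ 2)^-1]%classic = `]0%R, +oo[%classic.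
  apply: (@bigcup_itv0y (fun k => f k ^+ 2)) => [k|e e0]; first by rewrite exprn_gt0.
  have [k h1 h2] := invS_exhaust e e0; exists k.
    rewrite (le_trans _ h1)// expr2 -[leRHS]mulr1 ler_wpM2l//; exact: ltW.
  rewrite /f -exprVn invrK (le_trans h2)// expr2 -[leLHS]mulr1 ler_wpM2l// ler1n//.
have cvgA (g : nat -> R) (h : R -> R) : nonincreasing_seq g -> (forall k, 0 < g k) ->
    \bigcup_k `[g k, (g k)^-1]%classic = `]0%R, +oo[%classic ->
    measurable_fun setT h -> (forall x, 0 <= h x) ->
    (\int[mu]_(x in `[g k, ((g k)^-1)%R]) (h x)%:E @[k --> \oo] -->
     \int[mu]_(x in `]0%R, +oo[) (h x)%:E)%E.
  move=> gd g0 <- mh h0.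
  apply: ge0_nondecreasing_set_cvg_integral => //.
  - apply/nondecreasing_seqP => k; rewrite subsetEset => x/=; rewrite !in_itv/=.
    move/andP => [h1 h2]; apply/andP; split.
      by rewrite (le_trans _ h1)// gd.
    by rewrite (le_trans h2)// lef_pV2 ?posrE// gd.
  - by move=> k; apply/measurable_EFinP; exact: measurable_funTS.
  - by move=> k x _; rewrite lee_fin.
have fd : nonincreasing_seq f.
  by move=> a b ab; rewrite /f lef_pV2 ?posrE ?ltr0n// ler_nat.
have C1 := cvgA (fun k => f k ^+ 2) G.
have C2 := cvgA f H fd f0 itv0y mH.
have {}C2 : (\int[mu]_(x in `[f k, ((f k)^-1)%R]) (H x)%:E @[k --> \oo] -->
     \int[mu]_(x in `]0%R, +oo[) (H x)%:E)%E.
  by apply: C2 => x; rewrite /H mulr_ge0 ?expR_ge0// mulr_ge0// powR_ge0.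
have {}C1 : (\int[mu]_(x in `[(f k ^+ 2)%R, ((f k ^+ 2)^-1)%R]) (G x)%:E @[k --> \oo] -->
     \int[mu]_(x in `]0%R, +oo[) (G x)%:E)%E.
  apply: C1 => //.
  - by move=> a b ab; rewrite ler_sqr ?nnegrE ?(ltW (f0 _))// fd.
  - by move=> k; rewrite exprn_gt0.
  - by move=> x; rewrite /G mulr_ge0 ?expR_ge0// powR_ge0.
have E : (fun k => \int[mu]_(x in `[(f k ^+ 2)%R, ((f k ^+ 2)^-1)%R]) (G x)%:E)%E =
    (fun k => \int[mu]_(x in `[f k, ((f k)^-1)%R]) (H x)%:E)%E; last first.
  by rewrite E in C1; exact: (cvg_unique _ C1 C2).
apply/funext => k.
pose F (x : R) : R := x ^+ 2.
have dF (x : R) : is_derive x (1 : R) F (2 * x).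
  rewrite /F; apply: is_derive_eq; rewrite /GRing.scale/= mulr1.
  by rewrite mulr_natl mulr2n.
have F'E : derive1 F = fun x : R => 2 * x.
  by apply/funext => x; rewrite derive1E; exact: derive_val.
have cF x : {for x, continuous F}.
  by apply/differentiable_continuous/derivable1_diffP; exact: (@ex_derive _ _ _ _ _ _ _ (dF x)).
have cF' x : {for x, continuous (fun x : R => 2 * x)} by exact: mulrl_continuous.
rewrite -exprVn -[f k ^+ 2]/(F (f k)) -[(f k)^-1 ^+ 2]/(F (f k)^-1).
rewrite (@integration_by_substitution_increasing _ F G (f k) (f k)^-1); last 7 first.
- by rewrite (le_trans (f1 k))// invf_ge1.
- move=> x y; rewrite !in_itv/= => /andP[x0 _] /andP[y0 _] xy.
  by rewrite /F ltr_sqr// nnegrE; apply: le_trans (ltW (f0 k)) _.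
- by rewrite F'E => x _; exact: cF'.
- rewrite F'E; apply/cvg_ex; exists (2 * f k); apply: cvg_at_right_filter; exact: cF'.
- rewrite F'E; apply/cvg_ex; exists (2 * (f k)^-1); apply: cvg_at_left_filter; exact: cF'.
- split.
  + by move=> x _; exact: (@ex_derive _ _ _ _ _ _ _ (dF x)).
  + by apply: cvg_at_right_filter; exact: cF.
  + by apply: cvg_at_left_filter; exact: cF.
- apply: continuous_in_subspaceT => x; rewrite inE/= in_itv/= => /andP[h1 _].
  have x0 : 0 < x by apply: lt_le_trans h1; rewrite /F exprn_gt0.
  apply: cvgM.
    exact: continuous_powR_gt0.
  by apply: continuous_comp; [exact: opp_continuous|exact: continuous_expR].
apply: eq_integral => x; rewrite inE/= in_itv/= => /andP[h1 _].
have x0 : 0 < x by exact: lt_le_trans h1.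
congr EFin; rewrite F'E /H /G /F -[(_ * (fun x => _)) _]/((_ * _) * (2 * x))/=.
rewrite -powR_mulrn ?(ltW x0)// -powRrM.
have -> : x `^ (2 * s - 1) = x `^ (2%:R * (s - 1)) * x.
  rewrite (_ : 2 * s - 1 = 2%:R * (s - 1) + 1); last by ring.
  by rewrite powRD ?powRr1 ?(ltW x0)//; apply/implyP => _; rewrite gt_eqF.
ring.
Qed.

End gamma.

Section gamma2.
Context {R : realType}.
Local Notation mu := (@lebesgue_measure R).

Lemma derivable_continuous_at (f : R -> R) (x : R) : derivable f x 1 -> {for x, continuous f}.
Proof. by move=> /derivable1_diffP/differentiable_continuous. Qed.

Lemma integral_powR_seg (s a : R) : 0 < s -> 0 < a -> a < 1 ->
  (\int[mu]_(t in `[a, 1%R]) (t `^ (s - 1))%:E <= s^-1%:E)%E.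
Proof.
move=> s0 a0 a1.
have dF (x : R) : 0 < x -> is_derive x (1 : R) (fun t : R => s^-1 * t `^ s) (x `^ (s - 1)).
  move=> x0; have h := @is_derive1_powR R s x x0.
  apply: is_derive_eq; rewrite /GRing.scale/= mulrA mulVf ?gt_eqF// mul1r.
  by [].
have cF (x : R) : 0 < x -> {for x, continuous (fun t : R => s^-1 * t `^ s)}.
  by move=> x0; apply: derivable_continuous_at; exact: (@ex_derive _ _ _ _ _ _ _ (dF x x0)).
rewrite (@continuous_FTC2 _ (fun t => t `^ (s - 1)) (fun t => s^-1 * t `^ s))//.
- rewrite powR1 mulr1 -EFinB lee_fin gerBl mulr_ge0 ?powR_ge0// invr_ge0 ltW//.
- apply: continuous_in_subspaceT => x; rewrite inE/= in_itv/= => /andP[h1 _].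
  by apply: continuous_powR_gt0; exact: lt_le_trans h1.
- split.
  + move=> x; rewrite in_itv/= => /andP[h1 _].
    exact: (@ex_derive _ _ _ _ _ _ _ (dF x (lt_trans a0 h1))).
  + by apply: cvg_at_right_filter; exact: cF.
  + by apply: cvg_at_left_filter; exact: cF.
- move=> x; rewrite in_itv/= => /andP[h1 _].
  rewrite derive1E; have := dF x (lt_trans a0 h1) => h.
  exact: derive_val.
Qed.

Lemma integral_powR_01 (s : R) : 0 < s ->
  (\int[mu]_(t in `]0%R, 1%R]) (t `^ (s - 1))%:E <= s^-1%:E)%E.
Proof.
move=> s0; pose F (k : nat) : set R := `[k.+2%:R^-1, 1%R]%classic.
have FE : \bigcup_k F k = `]0%R, 1%R]%classic.
  apply/seteqP; split => x /=.
    move=> [k _]; rewrite /F/= !in_itv/= => /andP[h1 ->]; rewrite andbT.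
    by apply: lt_le_trans h1; rewrite invr_gt0.
  rewrite in_itv/= => /andP[x0 x1]; have [k h1 h2] := invS_exhaust x x0.
  exists k => //; rewrite /F/= in_itv/= x1 andbT (le_trans _ h1)//.
  by rewrite lef_pV2 ?posrE// ler_nat.
have mf : measurable_fun setT (fun t : R => (t `^ (s - 1))%:E).
  by apply/measurable_EFinP; exact: measurable_powR.
have C : (\int[mu]_(t in F k) (t `^ (s - 1))%:E @[k --> \oo] -->
    \int[mu]_(t in `]0%R, 1%R]) (t `^ (s - 1))%:E)%E.
  rewrite -FE; apply: ge0_nondecreasing_set_cvg_integral => //.
  - apply/nondecreasing_seqP => k; rewrite subsetEset => x/=; rewrite /F/= !in_itv/=.
    move/andP => [h1 ->]; rewrite andbT (le_trans _ h1)// lef_pV2 ?posrE//.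
    by rewrite ler_nat.
  - by move=> k; exact: measurable_itv.
  - by move=> k; exact: measurable_funTS.
  - by move=> k x _; rewrite lee_fin powR_ge0.
rewrite -(cvg_lim _ C)//; apply: lime_le; first by apply/cvg_ex; eexists; exact: C.
near=> k; apply: integral_powR_seg => //.
by rewrite invf_lt1// ltr1n.
Unshelve. all: by end_near. Qed.

Lemma integral_expRN2 : (\int[mu]_(t in `[0%R, +oo[) (expR (- (t / 2)))%:E = 2%:E)%E.
Proof.
have dF (x : R) : is_derive x (1 : R) (fun t : R => - 2 * expR (- (t / 2))) (expR (- (x / 2))).
  apply: is_derive_eq; rewrite /GRing.scale/=.
  by field.
have cF (x : R) : {for x, continuous (fun t : R => - 2 * expR (- (t / 2)))}.
  by apply: derivable_continuous_at; exact: (@ex_derive _ _ _ _ _ _ _ (dF x)).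
rewrite (@ge0_continuous_FTC2y _ _ (fun t => - 2 * expR (- (t / 2))) 0 0).
- by rewrite mul0r oppr0 expR0 mulr1 sub0e -EFinN opprK.
- by move=> x _; exact: expR_ge0.
- apply: continuous_subspaceT => x.
  apply: continuous_comp; last exact: continuous_expR.
  by apply: continuousN; exact: mulrr_continuous.
- rewrite -[X in _ --> X](mulr0 (- 2)); apply: cvgM; first exact: cvg_cst.
  have := @cvgr_expR R => h.
  apply: (cvg_comp (fun t => t / 2) (fun x => expR (- x)) _ h).
  by apply: gt0_cvgMly => //; rewrite invr_gt0.
- by move=> x _; exact: (@ex_derive _ _ _ _ _ _ _ (dF x)).
- by apply: cvg_at_right_filter; exact: cF.
- by move=> x _; rewrite derive1E; have h := dF x; exact: derive_val.
Qed.

(** Near 0 the integrand is below [t^(s-1)]; beyond 1 it is below a multiple of [e^(-t/2)]. *)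
Lemma gamma_fin (s : R) : 0 < s -> (gammaE s < +oo)%E.
Proof.
move=> s0; rewrite /gammaE.
have mG : measurable_fun setT (fun t : R => (t `^ (s - 1) * expR (- t))%:E).
  by apply/measurable_EFinP; apply: measurable_funM => //; apply: measurableT_comp.
have G0 (t : R) : (0 <= (t `^ (s - 1) * expR (- t))%:E)%E.
  by rewrite lee_fin mulr_ge0 ?expR_ge0// powR_ge0.
have -> : `]0%R, +oo[%classic = `]0%R, 1%R] `|` `]1%R, +oo[ :> set R.
  by rewrite -itv_bndbnd_setU// bnd_simp.
rewrite ge0_integral_setU//=; last 2 first.
- exact: measurable_funTS.
- apply/disj_setPS => x [] /=; rewrite !in_itv/= andbT => /andP[_ h1] h2.
  by have := le_lt_trans h1 h2; rewrite ltxx.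
apply: lte_add_pinfty.
  apply: (@le_lt_trans _ _ (s^-1%:E)); last exact: ltry.
  apply: le_trans (integral_powR_01 s s0).
  apply: ge0_le_integral => //; try exact: measurable_funTS.
  - by apply/measurable_EFinP; exact: measurable_funTS.
  - move=> t /=; rewrite in_itv/= => /andP[t0 _]; rewrite lee_fin ler_piMr ?powR_ge0//.
    by rewrite expR_le1 oppr_le0 ltW.
(* From [t/(2s) <= e^(t/(2s))], raised to the power [s]: [t^s <= (2s)^s e^(t/2)]. *)
pose C := (2 * s) `^ s.
apply: (@le_lt_trans _ _ (\int[mu]_(t in `[0%R, +oo[) (C%:E * (expR (- (t / 2)))%:E))%E).
  apply: (@le_trans _ _ (\int[mu]_(t in `]1%R, +oo[) (C%:E * (expR (- (t / 2)))%:E))%E).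
    apply: ge0_le_integral => //; try exact: measurable_funTS.
    - apply: measurable_funeM; apply/measurable_EFinP; apply: measurableT_comp => //.
      by apply: measurableT_comp => //; apply: measurable_funM.
    - move=> t /=; rewrite in_itv/= andbT => t1; rewrite -EFinM lee_fin.
      have t0 : 0 < t by rewrite (lt_trans ltr01).
      have -> : expR (- t) = expR (- (t / 2)) * expR (- (t / 2)).
        by rewrite -expRD; congr expR; field.
      rewrite mulrA ler_wpM2r ?expR_ge0// expRN ler_pdivrMr ?expR_gt0//.
      apply: (@le_trans _ _ (t `^ s)).
        by apply: ler_powR; [exact: ltW|rewrite gerBl].
      have s20 : 0 < 2 * s by rewrite mulr_gt0.
      rewrite -{1}[t](@mulfVK _ (2 * s)) ?gt_eqF// mulrC powRM; last 2 first.
      - exact: ltW.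
      - by rewrite divr_ge0 ?ltW.
      rewrite ler_wpM2l ?powR_ge0//.
      have -> : t / 2 = t / (2 * s) * s by field; rewrite gt_eqF.
      rewrite expRM ge0_ler_powR ?nnegrE ?expR_ge0 ?(ltW s0) ?divr_ge0 ?(ltW t0) ?(ltW s20)//.
      apply: le_trans (expR_ge1Dx _); by rewrite lerDr.
  apply: ge0_subset_integral => //.
  - apply: measurable_funeM; apply/measurable_EFinP; apply: measurableT_comp => //.
    by apply: measurableT_comp => //; apply: measurable_funM.
  - by move=> x _; rewrite -EFinM lee_fin mulr_ge0 ?expR_ge0 ?powR_ge0.
  - by move=> x/=; rewrite !in_itv/= !andbT => h; rewrite ltW// (lt_trans ltr01).
rewrite ge0_integralZl_EFin ?powR_ge0//.
- by rewrite integral_expRN2 -EFinM ltry.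
- apply/measurable_EFinP; apply: measurableT_comp => //.
  by apply: measurableT_comp => //; apply: measurable_funM.
Qed.

Lemma gamma_scale (s a : R) : 0 < a ->
  (\int[mu]_(r in `]0%R, +oo[) (r `^ (s - 1) * expR (- (a * r)))%:E =
   (a `^ (- s))%:E * gammaE s)%E.
Proof.
move=> a0; rewrite /gammaE.
pose f (t : R) : \bar R := (((fun t => (t `^ (s - 1) * expR (- t))%:E) \_ `]0%R, +oo[) t)%E.
have mf : measurable_fun setT f.
  apply/(measurable_restrictT (fun t : R => (t `^ (s - 1) * expR (- t))%:E)).
    exact: measurable_itv.
  apply/measurable_EFinP; apply: measurable_funTS.
  by apply: measurable_funM => //; apply: measurableT_comp.
have f0 t : (0 <= f t)%E.
  rewrite /f patchE; case: ifPn => // _.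
  by rewrite lee_fin mulr_ge0 ?expR_ge0 ?powR_ge0.
rewrite [X in (_ * X)%E]integral_mkcond -/f.
have := integral_affine a 0 f (lt0r_neq0 a0) mf f0 => h.
have -> : (\int[mu]_x f x = a%:E * \int[mu]_x f (a * x + 0)%R)%E.
  by rewrite h gtr0_norm// muleA -EFinM mulfV ?gt_eqF// mul1e.
rewrite muleA -EFinM -ge0_integralZl_EFin ?mulr_ge0 ?powR_ge0 ?ltW//; last first.
  exact: (measurableT_comp mf (measurable_affine _ _)).
rewrite [LHS]integral_mkcond; apply: eq_integral => r _.
have E (x : R) : (x \in (`]0%R, +oo[%classic : set R)) = (0 < x).
  by apply/idP/idP; rewrite inE/= in_itv/= andbT.
rewrite /f !patchE addr0 !E pmulr_rgt0//.
case: ifPn => r0; last by rewrite mule0.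
rewrite -EFinM; congr EFin.
have hD x y : a `^ (x + y) = a `^ x * a `^ y.
  by rewrite powRD//; apply/implyP => _; rewrite gt_eqF.
have ka : a `^ (- s) * a * a `^ (s - 1) = 1.
  have -> : a `^ (- s) * a = a `^ (- s + 1) by rewrite hD powRr1// ltW.
  by rewrite -hD (_ : _ + _ = 0) ?powRr0//; ring.
by rewrite powRM ?ltW// [RHS]mulrA [X in _ = X * _]mulrA ka mul1r.
Qed.

(* Both sides are computed from the Gaussian integral. *)
Lemma sphere_measE n : (sphere_meas n = (sphere_area n.+1 : R)%:E)%E /\
  0 < sphere_area n.+1 :> R.
Proof.
have P0 : 0 < Num.sqrt pi ^+ n.+1 :> R by rewrite exprn_gt0// sqrtr_gt0 pi_gt0.
have mG : measurable_fun setT (fun r : R => (expR (- r ^+ 2))%:E).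
  apply/measurable_EFinP; apply: measurableT_comp => //.
  apply: measurableT_comp => //; exact: measurable_funX.
have := @iint_polar R n (fun r => (expR (- r ^+ 2))%:E) mG.
rewrite iint_gauss => /(_ (fun x => expR_ge0 _)).
set X := (\int[mu]_(r in _) _)%E => XE.
have gE : (gammaE (n.+1%:R / 2) = 2%:E * X)%E.
  rewrite gamma_subst /X -ge0_integralZl//.
  - apply: eq_integral => r; rewrite inE/= in_itv/= andbT => r0.
    rewrite -!EFinM; congr EFin.
    have -> : 2 * (n.+1%:R / 2) - 1 = n%:R :> R by rewrite -natr1; field.
    by rewrite powR_mulrn ?ltW//; ring.
  - apply: emeasurable_funM; last exact: measurable_funTS.
    by apply/measurable_EFinP; apply: measurable_funTS; exact: measurable_funX.
  - move=> r/=; rewrite in_itv/= andbT => r0.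
    by rewrite -EFinM lee_fin mulr_ge0 ?expR_ge0// exprn_ge0 ?ltW.
have X0 : (0 <= X)%E.
  apply: integral_ge0 => r/=; rewrite in_itv/= andbT => r0.
  by rewrite -EFinM lee_fin mulr_ge0 ?expR_ge0// exprn_ge0 ?ltW.
have gfin : (gammaE (n.+1%:R / 2 : R) < +oo)%E by apply: gamma_fin; rewrite divr_gt0.
have A0 : (0 <= sphere_meas n :> \bar R)%E.
  apply: iint_ge0 => z.
  by rewrite lee_fin mulr_ge0// invr_ge0 exprn_ge0// ltW// slope_gt0.
have Xfin : X \is a fin_num.
  rewrite ge0_fin_numE//; move: gfin; rewrite gE; move: X0.
  by case: (X) => [x| |]// _; rewrite ?ltry// mulry gtr0_sg// mul1e.
move: gE XE X0; rewrite -(fineK Xfin); set x := fine X => gE XE.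
(* If the radial Gaussian integral were 0, so would be the full Gaussian integral. *)
rewrite lee_fin le_eqVlt => /orP[/eqP x0|x0].
  by move: XE; rewrite -x0 mule0 => -[] e; move: P0; rewrite e ltxx.
have gR : Gamma (n.+1%:R / 2) = 2 * x by rewrite GammaE gE.
have AE : (sphere_meas n = (Num.sqrt pi ^+ n.+1 / x)%:E :> \bar R)%E.
  move: XE A0; case: (sphere_meas n) => [r| |]//= [].
    by move=> -> _; rewrite mulfK ?gt_eqF.
  by rewrite mulyr gtr0_sg// mul1e.
have pE : pi `^ (n.+1%:R / 2) = Num.sqrt pi ^+ n.+1 :> R.
  rewrite -powR12_sqrt ?pi_ge0// -powR_mulrn ?powR_ge0// -powRrM; congr (_ `^ _).
  by rewrite mulrC.
have sE : sphere_area n.+1 = Num.sqrt pi ^+ n.+1 / x :> R.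
  by rewrite /sphere_area gR pE; field; rewrite gt_eqF.
by rewrite AE sE; split => //; rewrite divr_gt0.
Qed.

End gamma2.

(** * A Hardy inequality with arbitrary radial weight *)

Section ray.
Context {R : realType}.
Local Notation mu := (@lebesgue_measure R).

Lemma is_derive_invX k (x : R) : 0 < x ->
  is_derive x (1 : R) (fun s : R => - (k.+1%:R^-1 * s `^ (- k.+1%:R))) (x ^- k.+2).
Proof.
move=> x0; have h := @is_derive1_powR R (- k.+1%:R) x x0.
apply: is_derive_eq; rewrite /GRing.scale/=.
rewrite (_ : - k.+1%:R - 1 = - k.+2%:R :> R); last by rewrite -[in RHS]natr1; ring.
rewrite powR_invn ?(ltW x0)// mulNr mulrN opprK mulrA mulVf ?mul1r//.
Qed.

(** In dimension N = k+3, the factor is the integral of [s^-(N-1)] over [[t, T]], the Cauchy-Schwarz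
    companion of the energy density [s^(N-1) f'^2]. *)
Lemma ray_bound k (f f' : R -> R) (T t : R) :
  (forall s : R, is_derive s (1 : R) f (f' s)) -> continuous f' ->
  f T = 0 -> 0 < t -> t < T ->
  ((f t ^+ 2)%:E <= ((t ^- k.+1 - T ^- k.+1) / k.+1%:R)%:E *
     \int[mu]_(s in `]0%R, +oo[) (s ^+ k.+2 * f' s ^+ 2)%:E)%E.
Proof.
move=> df cf' fT t0 tT; set E := (\int[mu]_(s in _) _)%E.
have T0 : 0 < T by exact: lt_trans tT.
set D := (_ / _).
have D0 : 0 < D.
  rewrite divr_gt0// subr_gt0 ltf_pV2 ?posrE ?exprn_gt0//.
  by rewrite ltrXn2r// ltW.
pose H (s : R) := - (k.+1%:R^-1 * s `^ (- k.+1%:R)).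
have HD : H T - H t = D.
  by rewrite /H /D !powR_invn ?(ltW t0) ?(ltW T0)//; rewrite opprK addrC -mulrBr mulrC.
pose a := f t / D.
(* Cauchy-Schwarz in the form [s^(k+2) f'^2 >= - 2 a f' - a^2 s^-(k+2)], optimised in [a]. *)
pose K (s : R) := - (2 * a) * f s - a ^+ 2 * H s.
pose K' (s : R) := - (2 * a) * f' s - a ^+ 2 * s ^- k.+2.
have dK (s : R) : 0 < s -> is_derive s (1 : R) K (K' s).
  move=> s0; have h1 := df s; have h2 := is_derive_invX k s s0.
  by rewrite /K /H; apply: is_derive_eq; rewrite /K' /GRing.scale.
have cK (s : R) : 0 < s -> {for s, continuous K}.
  by move=> s0; apply: derivable_continuous_at; exact: (@ex_derive _ _ _ _ _ _ _ (dK s s0)).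
have cK' (s : R) : 0 < s -> {for s, continuous K'}.
  move=> s0; apply: continuousB.
    by apply: continuousM; [exact: cst_continuous|exact: cf'].
  apply: continuousM; first exact: cst_continuous.
  apply: continuousV; first by rewrite expf_neq0// gt_eqF.
  exact: exprn_continuous.
have cg : continuous (fun s : R => s ^+ k.+2 * f' s ^+ 2).
  move=> s; rewrite (_ : (fun _ => _) = fun s : R => s ^+ k.+2 * (f' s * f' s)).
    by apply: cvgM; [exact: exprn_continuous|apply: cvgM; exact: cf'].
  by apply/funext => x; rewrite expr2.
have FTC := @continuous_FTC2 R K' K t T tT.
have KE : (\int[mu]_(s in `[t, T]) (K' s)%:E = (K T)%:E - (K t)%:E)%E.
  apply: FTC.
  - apply: continuous_in_subspaceT => x; rewrite inE/= in_itv/= => /andP[h1 _].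
    by apply: cK'; exact: lt_le_trans h1.
  - split.
    + move=> x; rewrite in_itv/= => /andP[h1 _].
      exact: (@ex_derive _ _ _ _ _ _ _ (dK x (lt_trans t0 h1))).
    + by apply: cvg_at_right_filter; exact: cK.
    + by apply: cvg_at_left_filter; exact: cK.
  - move=> x; rewrite in_itv/= => /andP[h1 _].
    by rewrite derive1E; have h := dK x (lt_trans t0 h1); exact: derive_val.
have le1 : (\int[mu]_(s in `[t, T]) (K' s)%:E <=
            \int[mu]_(s in `[t, T]) (s ^+ k.+2 * f' s ^+ 2)%:E)%E.
  apply: le_integral => //.
  - apply: continuous_compact_integrable; first exact: segment_compact.
    apply: continuous_in_subspaceT => x; rewrite inE/= in_itv/= => /andP[h1 _].
    by apply: cK'; exact: lt_le_trans h1.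
  - apply: continuous_compact_integrable; first exact: segment_compact.
    exact: continuous_subspaceT.
  - move=> s; rewrite inE/= in_itv/= => /andP[h1 _].
    have s0 : 0 < s by exact: lt_le_trans h1.
    rewrite lee_fin /K' -subr_ge0; set P := s ^+ k.+2.
    have P0 : 0 < P by rewrite exprn_gt0.
    rewrite (_ : _ - _ = (f' s * P + a) ^+ 2 / P); last by field; rewrite gt_eqF.
    by rewrite divr_ge0 ?sqr_ge0// ltW.
have le2 : (\int[mu]_(s in `[t, T]) (s ^+ k.+2 * f' s ^+ 2)%:E <= E)%E.
  apply: ge0_subset_integral => //.
  - by apply/measurable_EFinP; apply: measurable_funTS; exact: continuous_measurable_fun.
  - move=> s/=; rewrite in_itv/= andbT => s0; rewrite lee_fin mulr_ge0 ?sqr_ge0//.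
    by rewrite exprn_ge0 ?ltW.
  - move=> s/=; rewrite !in_itv/= andbT => /andP[h _]; exact: lt_le_trans h.
(* Since [f T = 0], [K T - K t = 2 a f(t) - a^2 D], which is [f(t)^2 / D] for this [a]. *)
have : ((f t ^+ 2 / D)%:E <= E)%E.
  apply: le_trans le2; apply: le_trans le1; rewrite KE -EFinB lee_fin.
  rewrite /K fT (_ : H T = H t + D); last by rewrite -HD; ring.
  by rewrite /a le_eqVlt; apply/orP; left; apply/eqP; field; rewrite gt_eqF.
move=> h.
apply: le_trans (lee_wpmul2l _ h); last by rewrite lee_fin ltW.
by rewrite -EFinM lee_fin mulrCA mulfV ?mulr1// gt_eqF.
Qed.

(** This is [rho(r) r^(N-1) G(r)] for N = k+3, with the negative powers of [r] cancelled. *)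
Definition hardy_weight k (rho : R -> R) (r : R) : R :=
  if (0 < r) && (r < 1) then rho r * (r * (1 - r ^+ k.+1) / k.+1%:R) else 0.

Lemma hardy_weight_ge0 k rho r : (forall r, 0 <= rho r) -> 0 <= hardy_weight k rho r.
Proof.
move=> rho0; rewrite /hardy_weight; case: ifPn => // /andP[r0 r1].
apply: mulr_ge0 => //; apply: divr_ge0 => //; apply: mulr_ge0; first exact: ltW.
by rewrite subr_ge0 exprn_ile1// ltW.
Qed.

Lemma measurable_hardy_weight k rho : measurable_fun setT rho -> measurable_fun setT (hardy_weight k rho).
Proof.
move=> mrho; apply: measurable_fun_ifT => //.
  by apply: measurable_and => //; apply: measurable_fun_ltr.
apply: measurable_funM => //; apply: measurable_funM => //.
apply: measurable_funM => //; apply: measurable_funB => //.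
Qed.

(** [ray_bound] multiplied by [t^(N-1) rho] and integrated. The parameter [t] is a first coordinate,
    so the radius is [l t] and the ray leaves the unit ball at [t = 1/l]. The factor [l^-2] is
    absorbed later by the derivative along a vector of length [l]. *)
Lemma ray_weighted k (f f' rho : R -> R) (l : R) : 0 < l ->
  (forall s : R, is_derive s (1 : R) f (f' s)) -> continuous f' ->
  (forall s, 1 <= l * s -> f s = 0) ->
  measurable_fun setT rho -> (forall r, 0 <= rho r) ->
  (\int[mu]_(t in `]0%R, +oo[) (t ^+ k.+2 * (rho (t * l) * f t ^+ 2))%:E <=
   (l ^- 2)%:E * \int[mu]_r (hardy_weight k rho r)%:E *
     \int[mu]_(s in `]0%R, +oo[) (s ^+ k.+2 * f' s ^+ 2)%:E)%E.
Proof.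
move=> l0 df cf' f0 mrho rho0; set E := (X in (_ <= _ * X)%E).
have cf : continuous f.
  by move=> s; apply: derivable_continuous_at; exact: (@ex_derive _ _ _ _ _ _ _ (df s)).
have E0 : (0 <= E)%E.
  apply: integral_ge0 => s/=; rewrite in_itv/= andbT => s0.
  by rewrite lee_fin mulr_ge0 ?sqr_ge0 ?exprn_ge0 ?ltW//.
have mw := measurable_hardy_weight k rho mrho.
have mwl : measurable_fun setT (fun t : R => (hardy_weight k rho (l * t + 0))%:E).
  by apply/measurable_EFinP; exact: (measurableT_comp mw (measurable_affine _ _)).
have pt t : 0 < t -> ((t ^+ k.+2 * (rho (t * l) * f t ^+ 2))%:E <=
    (l^-1%:E * (hardy_weight k rho (l * t + 0))%:E) * E)%E.
  move=> t0; have tl0 : 0 < l * t by rewrite mulr_gt0.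
  rewrite addr0; have [lt1|lt1] := ltP (l * t) 1; last first.
    by rewrite f0// expr0n/= !mulr0 mule_ge0// -EFinM lee_fin mulr_ge0 ?hardy_weight_ge0// invr_ge0 ltW.
  have tT : t < l^-1 by rewrite -[X in _ < X]mul1r ltr_pdivlMr// mulrC.
  have fT : f l^-1 = 0 by rewrite f0// mulfV// gt_eqF.
  have := ray_bound k f f' l^-1 t df cf' fT t0 tT; rewrite -/E => h.
  rewrite mulrA EFinM.
  have c0 : 0 <= t ^+ k.+2 * rho (t * l) by rewrite mulr_ge0// exprn_ge0 ?ltW.
  apply: (le_trans (lee_wpmul2l _ h)); first by rewrite lee_fin.
  rewrite muleA -!EFinM; apply: lee_wpmul2r => //; rewrite lee_fin.
  rewrite /hardy_weight tl0 lt1/= le_eqVlt; apply/orP; left; apply/eqP.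
  have P0 : t ^+ k.+1 != 0 by rewrite expf_neq0// gt_eqF.
  have Q0 : l ^+ k.+1 != 0 by rewrite expf_neq0// gt_eqF.
  have c1 : k.+1%:R != 0 :> R by rewrite pnatr_eq0.
  rewrite [l * t]mulrC exprVn exprMn [t ^+ k.+2]exprSr invrK.
  move: (t ^+ k.+1) (l ^+ k.+1) (k.+1%:R : R) (rho _) P0 Q0 c1 => P Q c r P0 Q0 c1.
  by field; rewrite P0 c1 gt_eqF.
apply: (@le_trans _ _ (\int[mu]_(t in `]0%R, +oo[) ((l^-1%:E * (hardy_weight k rho (l * t + 0))%:E) * E))%E).
  apply: ge0_le_integral => //.
  - move=> t/=; rewrite in_itv/= andbT => t0; rewrite lee_fin.
    by apply: mulr_ge0; [rewrite exprn_ge0 ?ltW|rewrite mulr_ge0// sqr_ge0].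
  - apply/measurable_EFinP; apply: measurable_funTS.
    apply: measurable_funM; first exact: measurable_funX.
    apply: measurable_funM.
      apply: (measurableT_comp mrho); exact: measurable_funM.
    by apply: measurable_funX; exact: continuous_measurable_fun.
  - apply: emeasurable_funM => //; apply: measurable_funTS.
    by apply: emeasurable_funM.
  - by move=> t/=; rewrite in_itv/= andbT => t0; exact: pt.
rewrite ge0_integralZr//; last 2 first.
  - by apply: measurable_funTS; apply: emeasurable_funM.
  - by move=> t _; rewrite -EFinM lee_fin mulr_ge0 ?hardy_weight_ge0// invr_ge0 ltW.
apply: lee_wpmul2r => //.
apply: (@le_trans _ _ (\int[mu]_t (l^-1%:E * (hardy_weight k rho (l * t + 0))%:E))%E).
  apply: ge0_subset_integral => //.
    by apply: emeasurable_funM.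
  by move=> t _; rewrite -EFinM lee_fin mulr_ge0 ?hardy_weight_ge0// invr_ge0 ltW.
rewrite ge0_integralZl_EFin//; last 2 first.
  - by move=> t _; rewrite lee_fin hardy_weight_ge0.
  - by rewrite invr_ge0 ltW.
rewrite (integral_affine l 0 (fun r => (hardy_weight k rho r)%:E))//.
- by rewrite gtr0_norm// muleA -EFinM -invfM -expr2.
- by rewrite gt_eqF.
- exact/measurable_EFinP.
- by move=> r; rewrite lee_fin hardy_weight_ge0.
Qed.

End ray.

Section hardy.
Context {R : realType}.
Local Notation mu := (@lebesgue_measure R).

(** The sum of the squares of [a_i B - b_i C] equals [B (A B - C^2)]; the case [B = 0], where every
    [b_i] vanishes, is separate. *)
Lemma sum_cauchy_schwarz n (a b : 'I_n -> R) :
  (\sum_i a i * b i) ^+ 2 <= (\sum_i a i ^+ 2) * (\sum_i b i ^+ 2).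
Proof.
set A := \sum_i a i ^+ 2; set B := \sum_i b i ^+ 2; set C := \sum_i a i * b i.
have B0 : 0 <= B by apply: sumr_ge0 => i _; rewrite sqr_ge0.
have : 0 <= \sum_i (a i * B - b i * C) ^+ 2 by apply: sumr_ge0 => i _; rewrite sqr_ge0.
have -> : \sum_i (a i * B - b i * C) ^+ 2 = B * (A * B - C ^+ 2).
  rewrite (eq_bigr (fun i => a i ^+ 2 * B ^+ 2 + (a i * b i) * (- 2 * B * C) + b i ^+ 2 * C ^+ 2)); last first.
    by move=> i _; ring.
  rewrite !big_split/= -!mulr_suml -/A -/B -/C; ring.
move: B0; rewrite le_eqVlt => /orP[/eqP B0 _|B0]; last first.
  by rewrite pmulr_rge0// subr_ge0.
have b0 i : b i = 0.
  apply/eqP; rewrite -sqrf_eq0; move/eqP: B0; rewrite eq_sym psumr_eq0; last first.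
    by move=> j _; rewrite sqr_ge0.
  by move=> /allP/(_ i); rewrite mem_index_enum => /(_ isT).
by rewrite /C big1 ?expr0n/= -?B0 ?mulr0// => i _; rewrite b0 mulr0.
Qed.

Lemma derive_partial n (phi : 'rV[R]_n -> R^o) (x v : 'rV[R]_n) :
  differentiable phi x -> 'D_v phi x = \sum_i v 0 i * partial i phi x.
Proof.
move=> dphi; rewrite deriveE// {1}(row_sum_delta v) linear_sum.
by apply: eq_bigr => i _; rewrite linearZ/= /partial deriveE.
Qed.

Lemma is_derive_ray n (phi : 'rV[R]_n -> R^o) (v : 'rV[R]_n) (s : R) :
  differentiable phi (s *: v) ->
  is_derive s (1 : R) (fun t : R => phi (t *: v) : R) ('D_v phi (s *: v)).
Proof.
move=> dphi.
have E : (fun h : R => h^-1 *: ((phi ((h *: (1 : R) + s) *: v) : R^o) - phi (s *: v))) =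
         (fun h : R => h^-1 *: (phi (h *: v + s *: v) - phi (s *: v))).
  by apply/funext => h; rewrite (_ : h *: (1 : R) = h) ?scalerDl//; exact: mulr1.
have dv : derivable phi (s *: v) v by exact: diff_derivable.
apply: DeriveDef.
  by move: dv; rewrite /derivable -E.
by rewrite /derive/= -[in RHS]E.
Qed.

Lemma le_iint n (f g : rvec R n -> \bar R) :
  measurable_fun setT f -> measurable_fun setT g ->
  (forall x, 0 <= f x)%E -> (forall x, f x <= g x)%E -> (iint n f <= iint n g)%E.
Proof.
move=> mf mg f0 fg; rewrite !iintE//; first exact: ge0_le_integral.
by move=> x; exact: le_trans (fg x).
Qed.

Lemma iintZe n (c : \bar R) (f : rvec R n -> \bar R) : (0 <= c)%E ->
  measurable_fun setT f -> (forall x, 0 <= f x)%E ->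
  (iint n (fun x => c * f x) = c * iint n f)%E.
Proof.
move=> c0 mf f0; rewrite !iintE//.
- exact: ge0_integralZl.
- exact: emeasurable_funM.
- by move=> x; rewrite mule_ge0.
Qed.

Lemma measurable_int_cone n (F : rvec R n.+1 -> \bar R) :
  measurable_fun setT F -> (forall x, 0 <= F x)%E ->
  measurable_fun setT (fun z : rvec R n =>
    (\int[mu]_t ((`|t| ^+ n)%:E * F (cons_rv (t, t *: (z : 'rV[R]_n)))))%E).
Proof.
move=> mF F0.
apply: (@measurable_fun_fubini_tonelli_G _ _ _ _ _ mu
  (fun tz : R * rvec R n => ((`|tz.1| ^+ n)%:E * F (cons_rv (tz.1, tz.1 *: (tz.2 : 'rV[R]_n))))%E)).
  apply: emeasurable_funM; last exact: measurable_cone.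
  apply/measurable_EFinP; apply: measurable_funX.
  by apply: measurableT_comp => //; exact: measurable_fst.
by move=> x; rewrite mule_ge0// lee_fin exprn_ge0.
Qed.

(** [ray_weighted] is applied on both rays of each line through the origin, then integrated over the
    lines. Radial symmetry of [phi] is not assumed, as the approximants of a radial function may
    lack it. *)
Lemma hardy k (phi : 'rV[R]_k.+3 -> R^o) (rho : R -> R) :
  smooth_k 1 phi -> (forall x, 1 <= enorm x -> phi x = 0) ->
  measurable_fun setT rho -> (forall r, 0 <= rho r) ->
  (iint k.+3 (fun x => (rho (enorm x) * phi x ^+ 2)%:E) <=
   (\int[mu]_r (hardy_weight k rho r)%:E) *
     iint k.+3 (fun x => (\sum_i partial i phi x ^+ 2)%:E))%E.
Proof.
move=> [dphi cD] phi0 mrho rho0; set W := (\int[mu]_r _)%E.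
have W0 : (0 <= W)%E by apply: integral_ge0 => r _; rewrite lee_fin hardy_weight_ge0.
have cphi : continuous phi by move=> x; exact: differentiable_continuous.
have cpart i : continuous (partial i phi) by exact: cD.
have mF : measurable_fun setT (fun x : rvec R k.+3 =>
    (rho (enorm (x : 'rV[R]_k.+3)) * phi x ^+ 2)%:E).
  apply/measurable_EFinP; apply: measurable_funM; first exact: measurable_comp_enorm.
  by apply: measurable_funX; exact: continuous_rvec_measurable.
have mG : measurable_fun setT (fun x : rvec R k.+3 =>
    (\sum_i partial i phi (x : 'rV[R]_k.+3) ^+ 2)%:E).
  apply/measurable_EFinP; apply: measurable_sum => i.
  by apply: measurable_funX; exact: continuous_rvec_measurable.
have F0 (x : rvec R k.+3) : (0 <= (rho (enorm (x : 'rV[R]_k.+3)) * phi x ^+ 2)%:E)%E.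
  by rewrite lee_fin mulr_ge0// sqr_ge0.
have G0 (x : rvec R k.+3) : (0 <= (\sum_i partial i phi (x : 'rV[R]_k.+3) ^+ 2)%:E)%E.
  by rewrite lee_fin sumr_ge0// => i _; rewrite sqr_ge0.
rewrite (iint_cone k.+2 (fun x => (rho (enorm x) * phi x ^+ 2)%:E))//.
rewrite (iint_cone k.+2 (fun x => (\sum_i partial i phi x ^+ 2)%:E))//.
rewrite -iintZe//; last 2 first.
- exact: (measurable_int_cone _ (fun x => (\sum_i partial i phi x ^+ 2)%:E)).
- by move=> z; apply: integral_ge0 => t _; rewrite mule_ge0// lee_fin exprn_ge0.
apply: le_iint.
- exact: (measurable_int_cone _ (fun x => (rho (enorm x) * phi x ^+ 2)%:E)).
- apply: emeasurable_funM => //.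
  exact: (measurable_int_cone _ (fun x => (\sum_i partial i phi x ^+ 2)%:E)).
- by move=> z; apply: integral_ge0 => t _; rewrite mule_ge0// lee_fin exprn_ge0.
move=> z; pose th : 'rV[R]_k.+3 := cons_rv (1, z : 'rV[R]_k.+2).
pose l := slope k.+2 z; have l0 : 0 < l by exact: slope_gt0.
have ce (e : R) : continuous (fun t : R => (e * t) *: th).
  rewrite (_ : (fun t : R => _) = fun t : R => t *: (e *: th)).
    by move=> t; exact: scalel_continuous.
  by apply/funext => t; rewrite scalerA mulrC.
(* The sign [e] selects one of the two rays of the line. *)
have half (e : R) : `|e| = 1 ->
    (\int[mu]_(t in `]0%R, +oo[) ((t ^+ k.+2 * (rho (t * l) * phi ((e * t) *: th) ^+ 2))%:E) <=
     W * \int[mu]_(t in `]0%R, +oo[) ((t ^+ k.+2 * \sum_i partial i phi ((e * t) *: th) ^+ 2)%:E))%E.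
  move=> e1.
  have eqs t : (e * t) *: th = t *: (e *: th) by rewrite scalerA mulrC.
  have ne : enorm (e *: th) = l by rewrite enormZ e1 mul1r.
  pose f t : R := phi (t *: (e *: th)); pose f' t : R := 'D_(e *: th) phi (t *: (e *: th)).
  have df (s : R) : is_derive s (1 : R) f (f' s) by exact: is_derive_ray.
  have cf' : continuous f'.
    move=> t; apply: (@continuous_comp _ _ _ (fun t : R => t *: (e *: th)) ('D_(e *: th) phi)).
      exact: scalel_continuous.
    exact: cD.
  have f0 s : 1 <= l * s -> f s = 0.
    move=> ls; apply: phi0; rewrite enormZ ne mulrC (le_trans ls)// ler_wpM2l ?ler_norm// ltW//.
  have := ray_weighted k f f' rho l l0 df cf' f0 mrho rho0; rewrite -/W => h.
  under eq_integral do rewrite eqs.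
  apply: (le_trans h).
  rewrite [X in (X * _ <= _)%E]muleC -muleA; apply: lee_wpmul2l => //.
  have mf' : measurable_fun setT (fun t : R => (t ^+ k.+2 * f' t ^+ 2)%:E).
    apply/measurable_EFinP; apply: measurable_funM; first exact: measurable_funX.
    by apply: measurable_funX; exact: continuous_measurable_fun.
  rewrite -ge0_integralZl_EFin//; last 3 first.
  - move=> t/=; rewrite in_itv/= andbT => t0; rewrite lee_fin mulr_ge0 ?sqr_ge0//.
    by rewrite exprn_ge0 ?ltW.
  - exact: measurable_funTS.
  - by rewrite invr_ge0 sqr_ge0.
  apply: ge0_le_integral => //.
  - move=> t/=; rewrite in_itv/= andbT => t0; rewrite -EFinM lee_fin mulr_ge0//.
      by rewrite invr_ge0 sqr_ge0.
    by apply: mulr_ge0; [rewrite exprn_ge0 ?ltW|rewrite sqr_ge0].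
  - by apply: measurable_funTS; apply: emeasurable_funM.
  - apply/measurable_EFinP; apply: measurable_funTS.
    apply: measurable_funM; first exact: measurable_funX.
    apply: measurable_sum => i; apply: measurable_funX.
    apply: continuous_measurable_fun => t.
    apply: (@continuous_comp _ _ _ (fun t : R => (e * t) *: th) (partial i phi)).
      exact: ce.
    exact: cpart.
  - move=> t/=; rewrite in_itv/= andbT => t0; rewrite -EFinM lee_fin mulrCA.
    apply: ler_wpM2l; first by rewrite exprn_ge0 ?ltW.
    (* Cauchy-Schwarz bounds the square of the directional derivative by [l^2] times that of the
       gradient, which cancels [l^-2]. *)
    rewrite /f' derive_partial// eqs ler_pdivrMl ?exprn_gt0//.
    by rewrite -ne sqr_enorm; exact: sum_cauchy_schwarz.
have msec (F : rvec R k.+3 -> \bar R) : measurable_fun setT F ->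
    measurable_fun setT (fun t : R => ((`|t| ^+ k.+2)%:E * F (cons_rv (t, t *: (z : 'rV[R]_k.+2))))%E).
  move=> mF'; apply: emeasurable_funM.
    by apply/measurable_EFinP; apply: measurable_funX.
  apply: (@measurableT_comp _ _ _ R (R * rvec R k.+2)%type _
    (fun tz : R * rvec R k.+2 => F (cons_rv (tz.1, tz.1 *: (tz.2 : 'rV[R]_k.+2)))) setT
    (fun t : R => (t, z))); first exact: measurable_cone.
  exact: measurable_pair2.
have split_half (F : rvec R k.+3 -> \bar R) : measurable_fun setT F -> (forall x, 0 <= F x)%E ->
    (\int[mu]_t ((`|t| ^+ k.+2)%:E * F (cons_rv (t, t *: (z : 'rV[R]_k.+2)))) =
     \int[mu]_(t in `]0%R, +oo[) ((t ^+ k.+2)%:E * F ((1 * t) *: th)%R) +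
     \int[mu]_(t in `]0%R, +oo[) ((t ^+ k.+2)%:E * F ((-1 * t) *: th)%R))%E.
  move=> mF' F'0; rewrite integral_halfline; last 2 first.
  - exact: msec.
  - by move=> t; rewrite mule_ge0// lee_fin exprn_ge0.
  have me (e : R) : measurable_fun (`]0%R, +oo[%classic : set R)
      (fun t : R => ((t ^+ k.+2)%:E * F ((e * t) *: th)%R)%E).
    apply: measurable_funTS; apply: emeasurable_funM.
      by apply/measurable_EFinP; exact: measurable_funX.
    apply: (@measurable_comp_rvec _ _ _ _ _ _ F _ mF') => i.
    apply: continuous_measurable_fun => t.
    apply: (@continuous_comp _ _ _ (fun t : R => (e * t) *: th) (fun x => x 0 i)).
      exact: ce.
    exact: coord_continuous.
  rewrite -ge0_integralD//.
  - apply: eq_integral => t; rewrite inE/= in_itv/= andbT => t0.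
    by rewrite !cons_rv_ray mul1r mulN1r normrN gtr0_norm.
  - by move=> t/=; rewrite in_itv/= andbT => t0; rewrite mule_ge0// lee_fin exprn_ge0 ?ltW.
  - exact: me.
  - by move=> t/=; rewrite in_itv/= andbT => t0; rewrite mule_ge0// lee_fin exprn_ge0 ?ltW.
  - exact: me.
rewrite (split_half (fun x => (rho (enorm x) * phi x ^+ 2)%:E))//.
rewrite (split_half (fun x => (\sum_i partial i phi x ^+ 2)%:E))//.
have int0 (e : R) : (0 <= \int[mu]_(t in `]0%R, +oo[)
    ((t ^+ k.+2)%:E * (\sum_i partial i phi ((e * t) *: th)%R ^+ 2)%:E))%E.
  apply: integral_ge0 => t/=; rewrite in_itv/= andbT => t0.
  by rewrite mule_ge0// lee_fin ?exprn_ge0 ?ltW// sumr_ge0// => i _; rewrite sqr_ge0.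
rewrite ge0_muleDr//.
have half' (e : R) : `|e| = 1 ->
    (\int[mu]_(t in `]0%R, +oo[) ((t ^+ k.+2)%:E * (rho (enorm ((e * t) *: th)%R) * phi ((e * t) *: th)%R ^+ 2)%:E) <=
     W * \int[mu]_(t in `]0%R, +oo[) ((t ^+ k.+2)%:E * (\sum_i partial i phi ((e * t) *: th)%R ^+ 2)%:E))%E.
  move=> e1; have := half e e1.
  under [X in (X <= _)%E -> _]eq_integral => t.
    rewrite inE/= in_itv/= andbT => t0.
    rewrite EFinM (_ : (t * l = enorm ((e * t) *: th))%R); last first.
      by rewrite enormZ normrM e1 mul1r gtr0_norm.
    over.
  by under [X in (_ <= _ * X)%E -> _]eq_integral do rewrite EFinM.
by apply: leeD; apply: half'; rewrite ?normrN normr1.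
Qed.

End hardy.

(** * The space H^1_0 *)

(* Otherwise conversion unfolds the iterated integral as soon as the dimension is a successor. *)
Opaque iint.

Section H10facts.
Context {R : realType}.
Local Notation mu := (@lebesgue_measure R).

Lemma borel_funP n (f : 'rV[R]_n -> R) :
  borel_fun f <-> measurable_fun setT (f : rvec R n -> R).
Proof.
split=> [bf _ A mA|mf A mA]; first by rewrite setTI; exact: bf.
by have := mf measurableT A mA; rewrite setTI.
Qed.

Lemma iintD n (f g : rvec R n -> \bar R) :
  measurable_fun setT f -> measurable_fun setT g ->
  (forall x, 0 <= f x)%E -> (forall x, 0 <= g x)%E ->
  (iint n (fun x => f x + g x) = iint n f + iint n g)%E.
Proof.
move=> mf mg f0 g0; rewrite !iintE//.
- exact: ge0_integralD.
- exact: emeasurable_funD.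
- by move=> x; rewrite adde_ge0.
Qed.

Lemma ind_ballE n (x : 'rV[R]_n) : \1_(ball1 n) x = (enorm x < 1)%R%:R :> R.
Proof.
rewrite indicE (_ : (x \in ball1 n) = (enorm x < 1))//.
by apply/idP/idP; rewrite inE.
Qed.

Lemma ball_open n : open (ball1 n : set 'rV[R]_n).
Proof.
rewrite (_ : ball1 n = (@enorm R n) @^-1` [set r | r < 1])//.
by apply: open_comp => [x _|]; [exact: continuous_enorm|exact: open_lt].
Qed.

Lemma measurable_ind_ball n :
  measurable_fun setT (\1_(ball1 n) : rvec R n -> R).
Proof. by apply: measurable_indic; apply: measurable_rvec_open; exact: ball_open. Qed.

Lemma Ccinf_out n (phi : 'rV[R]_n -> R^o) x :
  Ccinf_ball n phi -> 1 <= enorm x -> phi x = 0.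
Proof.
move=> [_ [_ sub]] x1; apply/eqP/negP => /negP phix.
have : ball1 n x by apply: sub; exact: subset_closure.
by rewrite /ball1/= ltNge x1.
Qed.

Lemma Ccinf_closure_out n (phi : 'rV[R]_n -> R^o) x i :
  ~ closure [set x | phi x != 0] x -> partial i phi x = 0.
Proof.
move=> ncl.
have : nbhs x (~` (closure [set x | phi x != 0])).
  by apply: open_nbhs_nbhs; split => //; apply: closed_openC; exact: closed_closure.
move=> nb; rewrite /partial.
have -> : 'D_(delta_mx 0 i) phi x = 'D_(delta_mx 0 i) (cst (0 : R^o)) x.
  apply: near_eq_derive.
  near=> y; apply/eqP/negP => /negP phiy.
  have : ~ closure [set x | phi x != 0] y by near: y.
  by apply; exact: subset_closure.
exact: derive_cst.
Unshelve. all: by end_near. Qed.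

Lemma Ccinf_partial_out n (phi : 'rV[R]_n -> R^o) x i :
  Ccinf_ball n phi -> 1 <= enorm x -> partial i phi x = 0.
Proof.
move=> [_ [_ sub]] x1; apply: Ccinf_closure_out => /sub.
by rewrite /ball1/= ltNge x1.
Qed.

Lemma Ccinf_partial_continuous n (phi : 'rV[R]_n -> R^o) i :
  Ccinf_ball n phi -> continuous (partial i phi).
Proof. by move=> [/(_ 1%N) [_ +] _]; exact. Qed.

Lemma Ccinf_continuous n (phi : 'rV[R]_n -> R^o) : Ccinf_ball n phi -> continuous phi.
Proof. by move=> [/(_ 0%N) + _]; exact. Qed.

Lemma continuous_sum_partial_sqr n (phi : 'rV[R]_n -> R^o) : Ccinf_ball n phi ->
  continuous (fun x => \sum_i partial i phi x ^+ 2 : R).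
Proof.
move=> hphi; apply: continuous_big => [|i _ x]; first exact: add_continuous.
rewrite (_ : (fun y : 'rV[R]_n => partial i phi y ^+ 2) = (fun y => partial i phi y * partial i phi y)).
  by apply: continuousM; exact: Ccinf_partial_continuous.
by apply/funext => y; rewrite expr2.
Qed.

Lemma Ccinf_grad_bounded n (phi : 'rV[R]_n -> R^o) : Ccinf_ball n phi ->
  exists M : R, forall x, \sum_i partial i phi x ^+ 2 <= M.
Proof.
move=> hphi; have [_ [cK _]] := hphi.
pose F (x : 'rV[R]_n) : R^o := \sum_i partial i phi x ^+ 2.
have : compact (F @` closure [set x | phi x != 0]).
  apply: continuous_compact => //; apply: continuous_subspaceT.
  exact: continuous_sum_partial_sqr.
move=> /compact_bounded[M [_ MF]].
exists `|M + 1| => x; have [xK|xK] := pselect (closure [set x | phi x != 0] x).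
  apply: le_trans (ler_norm _) _.
  apply: MF; first by rewrite (lt_le_trans _ (ler_norm _))// ltrDl.
  by exists x.
by rewrite big1// => i _; rewrite Ccinf_closure_out// expr0n.
Qed.

Lemma iint_ball_fin n : (iint n.+1 (fun x : 'rV[R]_n.+1 => (\1_(ball1 n.+1) x)%:E) < +oo)%E.
Proof.
pose G (r : R) : \bar R := ((r < 1)%R%:R)%:E.
have mG : measurable_fun setT G.
  apply/measurable_EFinP.
  rewrite (_ : (fun r : R => _) = \1_(`]-oo, 1%R[%classic)).
    by apply: measurable_indic; exact: measurable_itv.
  by apply/funext => r; rewrite indicE mem_setE in_itv/=.
rewrite (_ : iint _ _ = iint n.+1 (fun x => G (enorm x))); last first.
  by apply: eq_iint => x; rewrite ind_ballE.
rewrite iint_polar//; last by move=> r; rewrite lee_fin.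
rewrite (proj1 (sphere_measE n)).
apply: (@le_lt_trans _ _ ((sphere_area n.+1)%:E * (1 : R)%:E)%E); last by rewrite -EFinM ltry.
apply: lee_wpmul2l; first by rewrite lee_fin ltW// (proj2 (sphere_measE n)).
apply: (@le_trans _ _ (\int[mu]_(r in `]0%R, +oo[) (\1_(`]0%R, 1%R[%classic) r)%:E)%E).
  apply: ge0_le_integral => //.
  - move=> r/=; rewrite in_itv/= andbT => r0; rewrite mule_ge0 ?lee_fin//.
    by rewrite exprn_ge0 ?ltW.
  - apply: emeasurable_funM; last exact: measurable_funTS.
    by apply/measurable_EFinP; apply: measurable_funTS; exact: measurable_funX.
  - by apply/measurable_EFinP; apply: measurable_funTS; apply: measurable_indic; exact: measurable_itv.
  - move=> r/=; rewrite in_itv/= andbT => r0; rewrite /G -EFinM lee_fin indicE.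
    rewrite mem_setE in_itv/= r0/=; case: ltP => r1; rewrite ?mulr0// mulr1.
    by rewrite exprn_ile1// ltW.
rewrite integral_indic//.
apply: (@le_trans _ _ (mu `]0%R, 1%R[)); last first.
  by rewrite lebesgue_measure_itv/= lte_fin ltr01 sube0.
by apply: le_measure; rewrite ?inE//; exact: measurableI.
Qed.

Lemma ge0_cvge0_lt (a : nat -> \bar R) (e : R) : 0 < e -> a @ \oo --> 0%E ->
  \forall k \near \oo, (a k < e%:E)%E.
Proof.
move=> e0 a0; apply: (a0 [set x | (x < e%:E)%E]).
by apply: open_nbhs_nbhs; split; [exact: open_ereal_lt_ereal|rewrite /= lte_fin].
Qed.

(** Young's inequality with leading constant as close to 1 as desired, so that limits along
    approximations lose nothing in the constants. *)
Lemma sqr_split (e x y : R) : 0 < e -> x ^+ 2 <= (1 + e) * y ^+ 2 + (1 + e^-1) * (y - x) ^+ 2.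
Proof.
move=> e0; rewrite -subr_ge0.
rewrite (_ : _ - _ = (e * y + (y - x)) ^+ 2 / e); last by field; rewrite gt_eqF.
by rewrite divr_ge0 ?sqr_ge0// ltW.
Qed.

Section fixed.
Context (k : nat) (u : 'rV[R]_k.+3 -> R) (g : 'rV[R]_k.+3 -> 'rV[R]_k.+3).
Let N := k.+3.
Hypothesis H : H10 N u g.

Definition energy : \bar R :=
  iint N (fun x => (\1_(ball1 N) x * \sum_(i < N) g x 0 i ^+ 2)%:E).

Lemma H10_meas_u : measurable_fun setT (u : rvec R N -> R).
Proof. by case: H => /borel_funP. Qed.

Lemma H10_meas_g i : measurable_fun setT (fun x : rvec R N => g x 0 i).
Proof. by case: H => _ [+ _] => /(_ i)/borel_funP. Qed.

Lemma measurable_sum_sqr (F : 'I_N -> rvec R N -> R) :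
  (forall i, measurable_fun setT (F i)) ->
  measurable_fun setT (fun x => (\sum_i F i x ^+ 2)).
Proof. by move=> mF; apply: measurable_sum => i; exact: measurable_funX. Qed.

Lemma H10_approx (e : R) : 0 < e -> exists phi : 'rV[R]_N -> R^o,
  [/\ Ccinf_ball N phi,
    (iint N (fun x => ((phi x - u x) ^+ 2)%:E) < e%:E)%E &
    (iint N (fun x => (\sum_(i < N) (partial i phi x - g x 0 i) ^+ 2)%:E) < e%:E)%E].
Proof.
move=> e0; have [_ [_ [phi [hphi [c1 c2]]]]] := H.
have n1 := ge0_cvge0_lt _ _ e0 c1; have n2 := ge0_cvge0_lt _ _ e0 c2.
have [j _ /(_ j (leqnn j)) [a b]] := filterI n1 n2.
by exists (phi j); split; [exact: hphi|exact: a|exact: b].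
Qed.

Lemma grad_norm_ball (phi : 'rV[R]_N -> R^o) : Ccinf_ball N phi ->
  iint N (fun x => (\sum_i partial i phi x ^+ 2)%:E) =
  iint N (fun x => (\1_(ball1 N) x * \sum_i partial i phi x ^+ 2)%:E).
Proof.
move=> hphi; apply: eq_iint => x; rewrite ind_ballE; case: ltP => x1; first by rewrite mul1r.
by rewrite mul0r big1// => i _; rewrite (Ccinf_partial_out _ _ _ _ hphi)// expr0n.
Qed.

(** [g] is at finite L^2 distance from the gradient of a test function, and that gradient is bounded
    on a ball of finite volume. *)
Lemma energy_fin : (energy < +oo)%E.
Proof.
have [phi [hphi _ h2]] := H10_approx 1 ltr01.
have mg := H10_meas_g.
have mp i : measurable_fun setT (partial i phi : rvec R N -> R).
  by apply: continuous_rvec_measurable; exact: Ccinf_partial_continuous.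
have [M hM] := Ccinf_grad_bounded _ _ hphi.
have M0 : 0 <= M by apply: le_trans (hM 0); exact: sum_sqr_ge0.
pose A (x : rvec R N) : \bar R := ((2 * M) * \1_(ball1 N) (x : 'rV[R]_N))%:E.
pose B (x : rvec R N) : \bar R := (2%:E * (\sum_(i < N) (partial i phi x - g x 0 i) ^+ 2)%:E)%E.
have mdiff : measurable_fun setT (fun x : rvec R N => (\sum_(i < N) (partial i phi x - g x 0 i) ^+ 2)%:E).
  by apply/measurable_EFinP; apply: measurable_sum_sqr => i; exact: measurable_funB.
have mA : measurable_fun setT A.
  by apply/measurable_EFinP; apply: measurable_funM => //; exact: measurable_ind_ball.
have mB : measurable_fun setT B by exact: measurable_funeM.
apply: (@le_lt_trans _ _ (iint N (fun x => A x + B x)%E)).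
  apply: le_iint.
  - apply/measurable_EFinP; apply: measurable_funM; first exact: measurable_ind_ball.
    exact: measurable_sum_sqr.
  - exact: emeasurable_funD.
  - by move=> x; rewrite lee_fin mulr_ge0 ?sum_sqr_ge0// ind_ballE.
  - move=> x; rewrite /A /B -EFinM -EFinD lee_fin ind_ballE; case: ltP => _; last first.
      by rewrite mul0r mulr0 add0r mulr_ge0// sum_sqr_ge0.
    rewrite mul1r mulr1; apply: (@le_trans _ _ (2 * \sum_i partial i phi x ^+ 2 +
        2 * \sum_(i < N) (partial i phi x - g x 0 i) ^+ 2)); last first.
      by rewrite lerD2r ler_wpM2l.
    rewrite !mulr_sumr -big_split/=; apply: ler_sum => i _.
    by have := sqr_split 1 (g x 0 i) (partial i phi x) ltr01; rewrite invr1.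
rewrite iintD//.
- apply: lte_add_pinfty.
    rewrite /A; under eq_iint do rewrite EFinM.
    rewrite iintZl ?mulr_ge0//.
    + have := iint_ball_fin k.+2; rewrite -/N; set J := iint _ _ => Jfin.
      have J0 : (0 <= J)%E by apply: iint_ge0 => x; rewrite ind_ballE lee_fin.
      by rewrite lte_mul_pinfty// lee_fin mulr_ge0.
    + apply/measurable_EFinP; exact: measurable_ind_ball.
  rewrite /B iintZl//; last by move=> x; rewrite lee_fin sum_sqr_ge0.
  rewrite lte_mul_pinfty//.
  by apply: (lt_trans h2); rewrite ltry.
- by move=> x; rewrite lee_fin mulr_ge0 ?mulr_ge0// ind_ballE.
- by move=> x; rewrite mule_ge0// lee_fin sum_sqr_ge0.
Qed.

End fixed.
End H10facts.

Section weighted.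
Context {R : realType}.
Local Notation mu := (@lebesgue_measure R).

(** The factor [r (1 - r^(k+1)) / (k+1)] is at most 1 on []0, 1[]. This keeps the Hardy constant
    finite, so that it can be subtracted. *)
Lemma hardy_weight_int_le k (rho : R -> R) (M : R) : measurable_fun setT rho ->
  (forall r, 0 <= rho r <= M) -> (\int[mu]_r (hardy_weight k rho r)%:E <= M%:E)%E.
Proof.
move=> mrho hrho.
have M0 : 0 <= M by have /andP[h1 h2] := hrho 0; exact: le_trans h2.
apply: (@le_trans _ _ (\int[mu]_r (M%:E * (\1_(`]0%R, 1%R[%classic) r)%:E))%E).
  apply: ge0_le_integral => //.
  - by move=> r _; rewrite lee_fin hardy_weight_ge0// => s; have /andP[] := hrho s.
  - by apply/measurable_EFinP; exact: measurable_hardy_weight.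
  - by apply: measurable_funeM; apply/measurable_EFinP; apply: measurable_indic; exact: measurable_itv.
  - move=> r _; rewrite -EFinM lee_fin indicE mem_setE in_itv/= /hardy_weight.
    case: ifPn => [/andP[r0 r1]|]; last by rewrite mulr0.
    have /andP[h1 h2] := hrho r.
    rewrite mulr1 -[leRHS]mulr1; apply: ler_pM => //.
      apply: divr_ge0 => //; apply: mulr_ge0; first exact: ltW.
      by rewrite subr_ge0 exprn_ile1// ltW.
    rewrite ler_pdivrMr ?ltr0n// mul1r.
    apply: (@le_trans _ _ 1); last by rewrite ler1n.
    rewrite -[leRHS]mulr1; apply: ler_pM => //; rewrite ?(ltW r0) ?(ltW r1)//.
      by rewrite subr_ge0 exprn_ile1// ltW.
    by rewrite gerBl exprn_ge0// ltW.
rewrite ge0_integralZl_EFin//.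
  rewrite integral_indic// setIT.
  have h : mu `]0%R, 1%R[ = 1%E by rewrite lebesgue_measure_itv/= lte_fin ltr01 sube0.
  rewrite -[leRHS]mule1; apply: lee_wpmul2l; first by rewrite lee_fin.
  by rewrite le_eqVlt; apply/orP; left; apply/eqP; exact: h.
by apply/measurable_EFinP; apply: measurable_indic; exact: measurable_itv.
Qed.

Section fixed.
Context (k : nat) (u : 'rV[R]_k.+3 -> R) (g : 'rV[R]_k.+3 -> 'rV[R]_k.+3).
Let N := k.+3.
Hypothesis H : H10 N u g.

Let mu_ := H10_meas_u k u g H.
Let mg := H10_meas_g k u g H.

Lemma iint_sqr_split (w : rvec R N -> R) n (F G : 'I_n -> rvec R N -> R) (e : R) :
  0 < e -> measurable_fun setT w -> (forall x, 0 <= w x) ->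
  (forall i, measurable_fun setT (F i)) -> (forall i, measurable_fun setT (G i)) ->
  (iint N (fun x => (w x * \sum_i F i x ^+ 2)%:E) <=
   (1 + e)%:E * iint N (fun x => (w x * \sum_i G i x ^+ 2)%:E) +
   (1 + e^-1)%:E * iint N (fun x => (w x * \sum_i (G i x - F i x) ^+ 2)%:E))%E.
Proof.
move=> e0 mw w0 mF mG.
have msum (K : 'I_n -> rvec R N -> R) : (forall i, measurable_fun setT (K i)) ->
    measurable_fun setT (fun x : rvec R N => (w x * \sum_i K i x ^+ 2)%:E).
  move=> mK; apply/measurable_EFinP; apply: measurable_funM => //.
  by apply: measurable_sum => i; exact: measurable_funX.
have pos (K : 'I_n -> rvec R N -> R) (x : rvec R N) : (0 <= (w x * \sum_i K i x ^+ 2)%:E)%E.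
  by rewrite lee_fin mulr_ge0// sumr_ge0// => i _; rewrite sqr_ge0.
have mD : measurable_fun setT (fun x : rvec R N => (w x * \sum_i (G i x - F i x) ^+ 2)%:E).
  by apply: (msum (fun i x => G i x - F i x)) => i; exact: measurable_funB.
have e1 : 0 <= 1 + e by rewrite addr_ge0// ltW.
have e2 : 0 <= 1 + e^-1 by rewrite addr_ge0// invr_ge0 ltW.
pose A (x : rvec R N) : \bar R := ((1 + e)%:E * (w x * \sum_i G i x ^+ 2)%:E)%E.
pose B (x : rvec R N) : \bar R := ((1 + e^-1)%:E * (w x * \sum_i (G i x - F i x) ^+ 2)%:E)%E.
have mA : measurable_fun setT A by apply: measurable_funeM; exact: msum.
have mB : measurable_fun setT B by exact: measurable_funeM.
have A0 x : (0 <= A x)%E by rewrite /A mule_ge0// ?lee_fin// -lee_fin; exact: pos.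
have B0 x : (0 <= B x)%E.
  by rewrite /B mule_ge0// ?lee_fin// -lee_fin; exact: (pos (fun i x => G i x - F i x)).
have AE : iint N A = ((1 + e)%:E * iint N (fun x => (w x * \sum_i G i x ^+ 2)%:E))%E.
  exact: (iintZl N (1 + e) _ e1 (msum G mG) (pos G)).
have BE : iint N B = ((1 + e^-1)%:E * iint N (fun x => (w x * \sum_i (G i x - F i x) ^+ 2)%:E))%E.
  exact: (iintZl N (1 + e^-1) _ e2 mD (pos (fun i x => G i x - F i x))).
rewrite -AE -BE -(iintD N A B mA mB A0 B0).
apply: le_iint.
- exact: msum.
- exact: emeasurable_funD.
- exact: pos.
move=> x; rewrite /A /B -!EFinM -EFinD lee_fin mulrCA [X in _ + X]mulrCA -mulrDr.
apply: ler_wpM2l => //; rewrite !mulr_sumr -big_split/=.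
by apply: ler_sum => i _; exact: sqr_split.
Qed.

(** Density of test functions. Boundedness of [rho] lets plain L^2 convergence control the weighted
    error. *)
Lemma H10_weighted (rho : R -> R) (M : R) : measurable_fun setT rho ->
  (forall r, 0 <= rho r <= M) ->
  (iint N (fun x => (rho (enorm x) * u x ^+ 2)%:E) <=
   (\int[mu]_r (hardy_weight k rho r)%:E) * energy k g)%E.
Proof.
move=> mrho hrho; set X := iint _ _; set W := (\int[mu]_r _)%E; set D := energy k g.
have rho0 r : 0 <= rho r by have /andP[] := hrho r.
have M0 : 0 <= M by have /andP[h1 h2] := hrho 0; exact: le_trans h2.
have Wle : (W <= M%:E)%E by exact: hardy_weight_int_le.
have W0 : (0 <= W)%E by apply: integral_ge0 => r _; rewrite lee_fin hardy_weight_ge0.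
have Wfin : W \is a fin_num by rewrite ge0_fin_numE// (le_lt_trans Wle)// ltry.
have D0 : (0 <= D)%E.
  by apply: iint_ge0 => x; rewrite lee_fin mulr_ge0 ?ind_ballE// sum_sqr_ge0.
have Dfin : D \is a fin_num by rewrite ge0_fin_numE//; exact: (energy_fin k u g H).
have mrN : measurable_fun setT (fun x : rvec R N => rho (enorm (x : 'rV[R]_N))).
  exact: measurable_comp_enorm.
have [w WE] : exists w, W = w%:E by exists (fine W); rewrite fineK.
have [d DE] : exists d, D = d%:E by exists (fine D); rewrite fineK.
have w0 : 0 <= w by rewrite -lee_fin -WE.
have d0 : 0 <= d by rewrite -lee_fin -DE.
(* Approximating within [e^2] makes the errors [(1 + 1/e) e^2] of order [e]. For [e <= 1], expanding
   leaves at most [3 w d e] from [(1+e)^2 w d], [4 w e] from the gradient error and [2 M e] from the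
   function error. *)
have key (e : R) : 0 < e -> e <= 1 ->
    (X <= W * D + (e * (3 * w * d + 4 * w + 2 * M))%:E)%E.
  move=> e0 e1; have ee0 : 0 < e ^+ 2 by rewrite exprn_gt0.
  have [phi [hphi h1 h2]] := H10_approx k u g H _ ee0.
  have mphi : measurable_fun setT (phi : rvec R N -> R).
    by apply: continuous_rvec_measurable; exact: Ccinf_continuous.
  have mp i : measurable_fun setT (partial i phi : rvec R N -> R).
    by apply: continuous_rvec_measurable; exact: Ccinf_partial_continuous.
  have s1 := iint_sqr_split (fun x => rho (enorm x)) 1 (fun _ => u) (fun _ => phi) e e0 mrN
    (fun x => rho0 _) (fun _ => mu_) (fun _ => mphi).
  have s2 := iint_sqr_split \1_(ball1 N) N (fun i => partial i phi) (fun i x => g x 0 i) e e0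
    (measurable_ind_ball N).
  have {}s2 := s2 _ mp mg.
  have {}s2 : (iint N (fun x => (\sum_i partial i phi x ^+ 2)%:E) <=
      (1 + e)%:E * D + (1 + e^-1)%:E * (e ^+ 2)%:E)%E.
    rewrite grad_norm_ball//; apply: le_trans (s2 _) _; first by move=> x; rewrite ind_ballE.
    apply: leeD => //; apply: lee_wpmul2l.
      by rewrite lee_fin addr_ge0// invr_ge0 ltW.
    apply: le_trans (ltW h2); apply: le_iint.
    - apply/measurable_EFinP; apply: measurable_funM; first exact: measurable_ind_ball.
      by apply: (measurable_sum_sqr k (fun i x => g x 0 i - partial i phi x)) => i; exact: measurable_funB.
    - apply/measurable_EFinP.
      by apply: (measurable_sum_sqr k (fun i x => partial i phi x - g x 0 i)) => i; exact: measurable_funB.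
    - by move=> x; rewrite lee_fin mulr_ge0 ?ind_ballE// sumr_ge0// => i _; rewrite sqr_ge0.
    - move=> x; rewrite lee_fin; apply: (@le_trans _ _ (\sum_i (g x 0 i - partial i phi x) ^+ 2)).
        rewrite ler_piMl ?ind_ballE//; last by case: (_ < _).
        by rewrite sumr_ge0// => i _; rewrite sqr_ge0.
      by apply: ler_sum => i _; rewrite -sqrrN opprB.
  have {}s1 : (X <= (1 + e)%:E * (W * ((1 + e)%:E * D + (1 + e^-1)%:E * (e ^+ 2)%:E)) +
      (1 + e^-1)%:E * (M%:E * (e ^+ 2)%:E))%E.
    apply: (@le_trans _ _ (iint N (fun x => (rho (enorm x) * \sum_(i < 1) u x ^+ 2)%:E))).
      by rewrite le_eqVlt; apply/orP; left; apply/eqP; apply: eq_iint => x; rewrite big_ord1.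
    apply: le_trans s1 _; apply: leeD; apply: lee_wpmul2l.
    - by rewrite lee_fin addr_ge0// ltW.
    - apply: (@le_trans _ _ (W * iint N (fun x => (\sum_i partial i phi x ^+ 2)%:E))%E).
        apply: (@le_trans _ _ (iint N (fun x => (rho (enorm x) * phi x ^+ 2)%:E))).
          by rewrite le_eqVlt; apply/orP; left; apply/eqP; apply: eq_iint => x; rewrite big_ord1.
        apply: hardy => //; first by case: hphi.
        by move=> x x1; exact: (Ccinf_out _ _ _ hphi).
      exact: lee_wpmul2l.
    - by rewrite lee_fin addr_ge0// invr_ge0 ltW.
    apply: (@le_trans _ _ (M%:E * iint N (fun x => ((phi x - u x) ^+ 2)%:E))%E); last first.
      by apply: lee_wpmul2l; [rewrite lee_fin|exact: (ltW h1)].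
    have md : measurable_fun setT (fun x : rvec R N => ((phi x - u x) ^+ 2)%:E).
      by apply/measurable_EFinP; apply: measurable_funX; exact: measurable_funB.
    have dd0 (x : rvec R N) : (0 <= ((phi x - u x) ^+ 2)%:E)%E by rewrite lee_fin sqr_ge0.
    rewrite -(iintZl N M _ M0 md dd0).
    apply: le_iint.
    - apply/measurable_EFinP; apply: measurable_funM => //.
      apply: measurable_sum => i; apply: measurable_funX; exact: measurable_funB.
    - exact: measurable_funeM.
    - by move=> x; rewrite lee_fin mulr_ge0// sumr_ge0// => i _; rewrite sqr_ge0.
    - move=> x; rewrite -EFinM lee_fin big_ord1 ler_wpM2r ?sqr_ge0//.
      by have /andP[] := hrho (enorm x).
  apply: (le_trans s1).
  rewrite WE DE -!EFinM -!EFinD lee_fin.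
  have -> : (1 + e^-1) * (M * e ^+ 2) = M * (e ^+ 2 + e) by field; rewrite gt_eqF.
  have -> : (1 + e^-1) * e ^+ 2 = e ^+ 2 + e by field; rewrite gt_eqF.
  have e2 : e ^+ 2 <= e by rewrite expr2 ger_pMl.
  have e3 : e ^+ 3 <= e ^+ 2 by rewrite exprSr ger_pMr.
  have wd0 : 0 <= w * d by rewrite mulr_ge0.
  have h3 : w * d * e ^+ 2 <= w * d * e by rewrite ler_wpM2l.
  have h4 : w * e ^+ 2 <= w * e by rewrite ler_wpM2l.
  have h5 : w * e ^+ 3 <= w * e ^+ 2 by rewrite ler_wpM2l.
  have h6 : M * e ^+ 2 <= M * e by rewrite ler_wpM2l.
  have we0 : 0 <= w * e by rewrite mulr_ge0// ltW.
  rewrite -subr_ge0.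
  rewrite (_ : _ - _ = (w * d * e - w * d * e ^+ 2) + (w * e - w * e ^+ 2) * 3 +
    (w * e ^+ 2 - w * e ^+ 3) + (M * e - M * e ^+ 2)); last by ring.
  lra.
set C := 3 * w * d + 4 * w + 2 * M in key.
have C0 : 0 <= C by rewrite /C !addr_ge0// mulr_ge0// mulr_ge0.
apply/lee_addgt0Pr => b b0.
(* The denominator [C + 1] avoids dividing by a vanishing [C]. *)
pose e := Num.min 1 (b / (C + 1)).
have C1 : 0 < C + 1 by rewrite ltr_wpDl.
have e0 : 0 < e by rewrite lt_min ltr01/= divr_gt0.
have e1 : e <= 1 by rewrite ge_min lexx.
apply: (le_trans (key e e0 e1)); apply: leeD => //; rewrite lee_fin.
apply: (@le_trans _ _ (b / (C + 1) * (C + 1))); last by rewrite divfK// gt_eqF.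
by apply: ler_pM; rewrite ?(ltW e0)// ?ge_min ?lexx ?orbT// lerDl.
Qed.

End fixed.
End weighted.

(** * Radial functions *)

Section nullsets.
Context {R : realType}.
Local Notation mu := (@lebesgue_measure R).

Lemma lebNE n (A : set 'rV[R]_n) : borelRN n A -> lebN n A = muN n (A : set (rvec R n)).
Proof.
move=> mA; rewrite /lebN iintE.
- by rewrite integral_indic// setIT.
- by apply/measurable_EFinP; exact: measurable_indic.
- by move=> x; rewrite lee_fin indicE.
Qed.

Lemma ge0_integral_eq0_null d (T : measurableType d) (m : {measure set T -> \bar R})
    (f : T -> \bar R) :
  measurable_fun setT f -> (forall x, 0 <= f x)%E -> (\int[m]_x f x = 0)%E ->
  m [set x | f x != 0%E] = 0%E.
Proof.
move=> mf f0 intf.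
have /(ae_eq_integral_abs m measurableT mf)[A [mA A0 sA]] : (\int[m]_x `|f x| = 0)%E.
  by rewrite -intf; apply: eq_integral => x _; rewrite gee0_abs.
apply: (subset_measure0 _ _ _ A0) => //.
  by have := emeasurable_neq measurableT mf 0%E; rewrite setTI.
by move=> x /= fx; apply: sA => /= /(_ I) /eqP; apply/negP.
Qed.

Lemma iint_eq0_null n (f : rvec R n -> \bar R) : measurable_fun setT f ->
  (forall x, 0 <= f x)%E -> iint n f = 0%E -> muN n [set x | f x != 0%E] = 0%E.
Proof. by move=> mf f0; rewrite iintE// => ?; exact: ge0_integral_eq0_null. Qed.

(** The Gaussian has a positive integral. Hence a property that holds for almost every slope holds
    for at least one. *)
Lemma muN_setT n : muN n (setT : set (rvec R n)) != 0%E.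
Proof.
apply/eqP => h0.
have : iint n (fun x : 'rV[R]_n => (expR (- enorm x ^+ 2))%:E) = 0%E.
  rewrite iintE.
  - rewrite (_ : (\int[muN n]_x _ = \int[muN n]_x `|(expR (- enorm (x : 'rV[R]_n) ^+ 2))%:E|)%E).
      apply: integral_abs_eq0 => //.
      apply: (@measurable_comp_enorm R _ _ n (fun r => (expR (- r ^+ 2))%:E)).
      apply/measurable_EFinP; apply: measurableT_comp => //.
      by apply: measurableT_comp => //; exact: measurable_funX.
    by apply: eq_integral => x _; rewrite gee0_abs// lee_fin expR_ge0.
  - apply: (@measurable_comp_enorm R _ _ n (fun r => (expR (- r ^+ 2))%:E)).
    apply/measurable_EFinP; apply: measurableT_comp => //.
    by apply: measurableT_comp => //; exact: measurable_funX.
  - by move=> x; rewrite lee_fin expR_ge0.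
rewrite iint_gauss => -[] /eqP; apply/negP.
by rewrite gt_eqF// exprn_gt0// sqrtr_gt0 pi_gt0.
Qed.

(* The profile in [radial] need not be measurable; the restriction of [u] to almost any ray is. *)
Lemma radial_version n (u : 'rV[R]_n.+1 -> R) :
  measurable_fun setT (u : rvec R n.+1 -> R) -> radial n.+1 u ->
  exists H : R -> R, measurable_fun setT H /\
    muN n.+1 [set x : rvec R n.+1 | u x != H (enorm (x : 'rV[R]_n.+1))] = 0%E.
Proof.
move=> mu_ [h [A [bA [lA sA]]]].
have mA : measurable (A : set (rvec R n.+1)) by exact: bA.
pose f (x : rvec R n.+1) : \bar R := (\1_A x)%:E.
have mf : measurable_fun setT f by apply/measurable_EFinP; exact: measurable_indic.
have f0 x : (0 <= f x)%E by rewrite lee_fin indicE.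
pose inner (z : rvec R n) := (\int[mu]_t ((`|t| ^+ n)%:E * f (cons_rv (t, t *: (z : 'rV[R]_n)))))%E.
have inner0 : muN n [set z | inner z != 0%E] = 0%E.
  apply: iint_eq0_null.
  - exact: measurable_int_cone.
  - by move=> z; apply: integral_ge0 => t _; rewrite mule_ge0// lee_fin exprn_ge0.
  - by rewrite /inner -(iint_cone n f mf f0).
have [z iz0] : exists z, inner z = 0%E.
  apply: contrapT => nz; move: inner0.
  rewrite (_ : [set z | inner z != 0%E] = setT); last first.
    by apply/seteqP; split => // z _ /=; apply/eqP => iz; apply: nz; exists z.
  by apply/eqP; exact: muN_setT.
pose th : 'rV[R]_n.+1 := cons_rv (1, z : 'rV[R]_n).
pose l := slope n z; have l0 : 0 < l by exact: slope_gt0.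
(* The point at distance [r] from the origin on the chosen ray. *)
pose y (r : R) : 'rV[R]_n.+1 := (l^-1 * r) *: th.
have my i : measurable_fun setT (fun r : R => y r 0 i).
  rewrite (_ : (fun r => _) = fun r : R => l^-1 * r * th 0 i); last first.
    by apply/funext => r; rewrite mxE.
  by apply: measurable_funM => //; exact: measurable_funM.
exists (fun r => u (y r)).
have mH : measurable_fun setT (fun r : R => u (y r)).
  exact: (@measurable_comp_rvec _ _ _ _ _ _ u _ mu_).
split => //.
pose P : set R := [set 0] `|` y @^-1` A.
have mP : measurable P.
  apply: measurableU; first exact: measurable_set1.
  have myy : measurable_fun setT (y : R -> rvec R n.+1) by exact: measurable_rvecP.
  by rewrite -[X in measurable X]setTI; exact: myy.
(* By the choice of [z], the ray meets [A] only at a null set of radii; polar coordinates turn null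
   sets of radii into null sets of points. *)
have P0 : muN n.+1 ((fun x : rvec R n.+1 => enorm (x : 'rV[R]_n.+1)) @^-1` P) = 0%E.
  pose F (r : R) : \bar R := (\1_P r)%:E.
  have mF : measurable_fun setT F by apply/measurable_EFinP; exact: measurable_indic.
  have F0 r : (0 <= F r)%E by rewrite lee_fin indicE.
  rewrite -lebNE; last first.
    have me := @measurable_enorm R n.+1.
    by have := me measurableT P mP; rewrite setTI.
  rewrite /lebN (_ : iint _ _ = iint n.+1 (fun x => F (enorm x))); last first.
    by apply: eq_iint => x; rewrite /F !indicE.
  rewrite iint_polar//.
  rewrite (_ : (\int[mu]_(r in _) _)%E = 0%E) ?mule0//.
  pose G (t : R) : \bar R := ((`|t| ^+ n)%:E * f (t *: th))%E.
  have mG : measurable_fun setT G.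
    apply: emeasurable_funM.
      by apply/measurable_EFinP; exact: measurable_funX.
    apply: (@measurable_comp_rvec R _ _ R _ _ f (fun t : R => t *: th) mf) => i.
    rewrite (_ : (fun r => _) = fun r : R => r * th 0 i); last first.
      by apply/funext => r; rewrite mxE.
    exact: measurable_funM.
  have G0 t : (0 <= G t)%E by rewrite mule_ge0// lee_fin exprn_ge0.
  have GE : (\int[mu]_t G t = 0)%E.
    by rewrite -iz0; apply: eq_integral => t _; rewrite cons_rv_ray.
  have GlE : (\int[mu]_t G (l^-1 * t + 0)%R = 0)%E.
    by rewrite integral_affine ?GE ?mule0// invr_neq0// gt_eqF.
  have mGl : measurable_fun setT (fun t => ((l ^+ n)%:E * G (l^-1 * t + 0)%R)%E).
    by apply: emeasurable_funM => //; exact: (measurableT_comp mG (measurable_affine _ _)).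
  apply/eqP; rewrite eq_le; apply/andP; split; last first.
    by apply: integral_ge0 => r/=; rewrite in_itv/= andbT => r0; rewrite mule_ge0// lee_fin exprn_ge0 ?ltW.
  apply: (@le_trans _ _ (\int[mu]_t ((l ^+ n)%:E * G (l^-1 * t + 0)%R))%E); last first.
    rewrite ge0_integralZl_EFin ?GlE ?mule0//.
    - exact: (measurableT_comp mG (measurable_affine _ _)).
    - by rewrite exprn_ge0 ?ltW.
  apply: (@le_trans _ _ (\int[mu]_(t in `]0%R, +oo[) ((l ^+ n)%:E * G (l^-1 * t + 0)%R))%E).
    apply: ge0_le_integral => //.
    - by move=> r/=; rewrite in_itv/= andbT => r0; rewrite mule_ge0// lee_fin exprn_ge0 ?ltW.
    - apply: emeasurable_funM; last exact: measurable_funTS.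
      by apply/measurable_EFinP; apply: measurable_funTS; exact: measurable_funX.
    - exact: measurable_funTS.
    - move=> r/=; rewrite in_itv/= andbT => r0.
      rewrite /G addr0 muleA -[in leRHS]EFinM normrM exprMn (gtr0_norm r0).
      rewrite gtr0_norm ?invr_gt0// mulrA exprVn mulfV ?mul1r; last first.
        by rewrite expf_neq0// gt_eqF.
      rewrite /F -EFinM lee_fin; apply: ler_wpM2l; first by rewrite exprn_ge0 ?ltW.
      rewrite !indicE ler_nat.
      case: (boolP (r \in P)) => //=; rewrite inE => -[r00|Ay].
        by move: r0; rewrite r00 ltxx.
      by rewrite mem_set.
  apply: ge0_subset_integral => //.
  by move=> t _; rewrite mule_ge0// lee_fin exprn_ge0 ?ltW.
(* Off [A] and off the bad radii, both [x] and the point of the ray at the same distance satisfy the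
   radial identity, so [u] has the value [h (enorm x)] at both. *)
apply: (@subset_measure0 _ _ _ (muN n.+1) _ (A `|` (fun x : rvec R n.+1 => enorm (x : 'rV[R]_n.+1)) @^-1` P)).
- have mHe := @measurable_comp_enorm R _ _ n.+1 _ mH.
  have := measurable_neqe measurableT (measurableT_comp (@EFin_measurable R _) mu_)
    (measurableT_comp (@EFin_measurable R _) mHe).
  by rewrite setTI.
- apply: measurableU => //.
  have me := @measurable_enorm R n.+1.
  by have := me measurableT P mP; rewrite setTI.
- move=> x /= ux; apply: contrapT => /not_orP[nA nP]; move/negP: ux; apply; apply/eqP.
  have r0 : enorm x != 0 by apply/eqP => e0; apply: nP; left.
  have nAy : ~ A (y (enorm x)) by move=> Ay; apply: nP; right.
  have ux : u x = h (enorm x) by apply: contrapT => ?; apply: nA; exact: sA.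
  have uy : u (y (enorm x)) = h (enorm (y (enorm x))).
    by apply: contrapT => ?; apply: nAy; exact: sA.
  rewrite ux uy /y enormZ -/(slope n z) -/l; congr h.
  rewrite ger0_norm; last by rewrite mulr_ge0 ?enorm_ge0// invr_ge0 ltW.
  by rewrite mulrAC mulVf ?mul1r// gt_eqF.
- transitivity (muN n.+1 (A : set (rvec R n.+1))); last by rewrite -lebNE.
  apply: measureU0 => //.
  have me := @measurable_enorm R n.+1.
  by have := me measurableT P mP; rewrite setTI.
Qed.

End nullsets.

(** * The pointwise bound for radial functions *)

Section radial_bound.
Context {R : realType}.
Local Notation mu := (@lebesgue_measure R).

Lemma muN_enorm_null n (P : set R) : measurable P -> mu P = 0%E ->
  muN n.+1 [set x : rvec R n.+1 | P (enorm (x : 'rV[R]_n.+1))] = 0%E.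
Proof.
move=> mP P0.
pose F (r : R) : \bar R := (\1_P r)%:E.
have mF : measurable_fun setT F by apply/measurable_EFinP; exact: measurable_indic.
have F0 r : (0 <= F r)%E by rewrite lee_fin indicE.
rewrite -lebNE; last first.
  have me := @measurable_enorm R n.+1.
  by have := me measurableT P mP; rewrite setTI.
rewrite /lebN (_ : iint _ _ = iint n.+1 (fun x => F (enorm x))); last first.
  by apply: eq_iint => x; rewrite /F !indicE.
rewrite iint_polar// (_ : (\int[mu]_(r in _) _)%E = 0%E) ?mule0//.
rewrite (_ : (\int[mu]_(r in _) _ = \int[mu]_(r in `]0%R, +oo[) `|(r ^+ n)%:E * F r|)%E); last first.
  apply: eq_integral => r; rewrite inE => hr.
  have r0 : 0 < r by move: hr; rewrite /= in_itv/= andbT.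
  by rewrite gee0_abs// mule_ge0// lee_fin exprn_ge0 ?ltW.
apply/ae_eq_integral_abs => //.
  apply: emeasurable_funM; last exact: measurable_funTS.
  by apply/measurable_EFinP; apply: measurable_funTS; exact: measurable_funX.
exists P; split => // r /= h; apply: contrapT => Pr; apply: h => _.
by rewrite /F indicE memNset// mule0.
Qed.

Lemma eq_iint_ae n (f g : rvec R n -> \bar R) (A : set (rvec R n)) :
  measurable_fun setT f -> measurable_fun setT g ->
  (forall x, 0 <= f x)%E -> (forall x, 0 <= g x)%E ->
  measurable A -> muN n A = 0%E -> (forall x, ~ A x -> f x = g x) ->
  iint n f = iint n g.
Proof.
move=> mf mg f0 g0 mA A0 fg; rewrite !iintE//.
apply: ge0_ae_eq_integral => //.
exists A; split => // x /= h; apply: contrapT => nA; apply: h => _; exact: fg.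
Qed.

(* Radii at which the pointwise bound fails; it is null by [H10_weighted] applied to its own
   indicator. *)
Definition excess k (d : R) (h : R -> R) : set R :=
  [set r | [&& 0 < r, r < 1 & d * (r * (1 - r ^+ k.+1) / k.+1%:R) <
                              sphere_area k.+3 * (r ^+ k.+2 * h r ^+ 2)]].

Section fixed.
Context (k : nat) (u : 'rV[R]_k.+3 -> R) (g : 'rV[R]_k.+3 -> 'rV[R]_k.+3).
Let N := k.+3.
Hypothesis H : H10 N u g.
Let mu_ := H10_meas_u k u g H.
Let S : R := sphere_area N.
Let S0 : 0 < S. Proof. exact: (proj2 (sphere_measE k.+2)). Qed.

(** [u] is an L^2 limit of functions vanishing there. This reconciles [nonzero], a condition on the
    whole space, with integrals taken over the ball only. *)
Lemma H10_out : muN N [set x : rvec R N | 1 <= enorm (x : 'rV[R]_N) /\ u x != 0] = 0%E.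
Proof.
pose f (x : rvec R N) : \bar R := ((1 - \1_(ball1 N) (x : 'rV[R]_N)) * u x ^+ 2)%:E.
have mf : measurable_fun setT f.
  apply/measurable_EFinP; apply: measurable_funM; last exact: measurable_funX.
  by apply: measurable_funB => //; exact: measurable_ind_ball.
have f0 x : (0 <= f x)%E.
  by rewrite lee_fin mulr_ge0 ?sqr_ge0// ind_ballE; case: (_ < _); rewrite ?subrr ?subr0.
have intf : iint N f = 0%E.
  apply/eqP; rewrite eq_le; apply/andP; split; last exact: iint_ge0.
  apply/lee_addgt0Pr => e e0; rewrite add0e.
  have [phi [hphi h1 _]] := H10_approx k u g H e e0.
  apply: le_trans (ltW h1); apply: le_iint => //.
    apply/measurable_EFinP; apply: measurable_funX; apply: measurable_funB => //.
    by apply: continuous_rvec_measurable; exact: Ccinf_continuous.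
  move=> x; rewrite lee_fin ind_ballE; case: ltP => x1.
    by rewrite subrr mul0r sqr_ge0.
  by rewrite (Ccinf_out _ _ _ hphi x1) sub0r sqrrN subr0 mul1r.
rewrite (_ : [set x : rvec R N | _] = [set x | f x != 0%E]); first exact: iint_eq0_null.
apply/seteqP; split => x /=.
  by move=> [x1 ux]; rewrite /f ind_ballE ltNge x1/= subr0 mul1r eqe sqrf_eq0.
rewrite /f ind_ballE eqe; case: ltP => x1; first by rewrite subrr mul0r eqxx.
by rewrite subr0 mul1r sqrf_eq0.
Qed.

(** With the indicator of the excess set as weight, the Hardy inequality says that the integral of
    [F1] is at most that of [F2], whereas [F1 > F2] on that set and both vanish off it. *)
Lemma radial_ae_bound (h : R -> R) : measurable_fun setT h ->
  muN N [set x : rvec R N | u x != h (enorm (x : 'rV[R]_N))] = 0%E ->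
  measurable (excess k (fine (energy k g)) h) /\ mu (excess k (fine (energy k g)) h) = 0%E.
Proof.
move=> mh uh; set d := fine (energy k g); set P := excess k d h.
have D0 : (0 <= energy k g)%E.
  by apply: iint_ge0 => x; rewrite lee_fin mulr_ge0 ?ind_ballE// sum_sqr_ge0.
have DE : energy k g = d%:E by rewrite fineK// ge0_fin_numE//; exact: (energy_fin k u g H).
have d0 : 0 <= d by rewrite -lee_fin -DE.
have mb : measurable_fun setT (fun r : R => [&& 0 < r, r < 1 &
    d * (r * (1 - r ^+ k.+1) / k.+1%:R) < S * (r ^+ k.+2 * h r ^+ 2)]).
  apply: measurable_and; first exact: measurable_fun_ltr.
  apply: measurable_and; first exact: measurable_fun_ltr.
  apply: measurable_fun_ltr.
    apply: measurable_funM => //; apply: measurable_funM => //; apply: measurable_funM => //.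
    apply: measurable_funB => //.
  apply: measurable_funM => //; apply: measurable_funM => //; exact: measurable_funX.
have mP : measurable P.
  have := mb measurableT [set true] I; rewrite setTI.
  by rewrite (_ : _ @^-1` _ = P)//; apply/seteqP; split => r.
split; first exact: mP.
pose rho : R -> R := \1_P.
have mrho : measurable_fun setT rho by exact: measurable_indic.
have rho01 r : 0 <= rho r <= 1 by rewrite /rho indicE; case: (_ \in _); rewrite /= ?lexx ?ler01.
have rho0 r : 0 <= rho r by have /andP[] := rho01 r.
have key := H10_weighted k u g H rho 1 mrho rho01.
pose F1 (r : R) : \bar R := (S * (r ^+ k.+2 * (rho r * h r ^+ 2)))%:E.
pose F2 (r : R) : \bar R := (hardy_weight k rho r * d)%:E.
have rhoN r : ~ P r -> rho r = 0 by move=> Pr; rewrite /rho indicE memNset.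
have rho1 r : P r -> rho r = 1 by move=> Pr; rewrite /rho indicE mem_set.
have mhe : measurable_fun setT (fun x : rvec R N => h (enorm (x : 'rV[R]_N))).
  exact: measurable_comp_enorm.
have mrhoe : measurable_fun setT (fun x : rvec R N => rho (enorm (x : 'rV[R]_N))).
  exact: measurable_comp_enorm.
have mF1 : measurable_fun setT F1.
  apply/measurable_EFinP; apply: measurable_funM => //; apply: measurable_funM => //.
  by apply: measurable_funM => //; exact: measurable_funX.
have F10 r : (0 <= F1 r)%E.
  rewrite lee_fin; have [Pr|Pr] := pselect (P r); last by rewrite rhoN// mul0r !mulr0.
  have r0 : 0 < r by case/and3P: Pr.
  rewrite mulr_ge0 ?(ltW S0)//; apply: mulr_ge0; first by rewrite exprn_ge0 ?ltW.
  by rewrite mulr_ge0// sqr_ge0.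
have mw : measurable_fun setT (hardy_weight k rho) by exact: measurable_hardy_weight.
have mF2 : measurable_fun setT F2 by apply/measurable_EFinP; exact: measurable_funM.
have F20 r : (0 <= F2 r)%E by rewrite lee_fin mulr_ge0// hardy_weight_ge0.
have I2 : (\int[mu]_r F2 r = (\int[mu]_r (hardy_weight k rho r)%:E) * d%:E)%E.
  rewrite -ge0_integralZr//; first exact/measurable_EFinP.
  by move=> r _; rewrite lee_fin hardy_weight_ge0.
have I1 : (\int[mu]_r F1 r = iint N (fun x => (rho (enorm x) * u x ^+ 2)%:E))%E.
  transitivity (iint N (fun x => (rho (enorm x) * h (enorm x) ^+ 2)%:E)); last first.
    apply: (eq_iint_ae N _ _ [set x : rvec R N | u x != h (enorm (x : 'rV[R]_N))]).
    - by apply/measurable_EFinP; apply: measurable_funM => //; exact: measurable_funX.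
    - by apply/measurable_EFinP; apply: measurable_funM => //; exact: measurable_funX.
    - by move=> x; rewrite lee_fin mulr_ge0// sqr_ge0.
    - by move=> x; rewrite lee_fin mulr_ge0// sqr_ge0.
    - have := measurable_neqe measurableT (measurableT_comp (@EFin_measurable R _) mu_)
        (measurableT_comp (@EFin_measurable R _) mhe).
      by rewrite setTI.
    - exact: uh.
    - by move=> x /= /negP; rewrite negbK => /eqP ->.
  rewrite (iint_polar k.+2 (fun r => (rho r * h r ^+ 2)%:E)); last 2 first.
  - by apply/measurable_EFinP; apply: measurable_funM => //; exact: measurable_funX.
  - by move=> r; rewrite lee_fin mulr_ge0// sqr_ge0.
  rewrite (proj1 (sphere_measE k.+2)) -/S.
  rewrite -ge0_integralZl_EFin//; last 3 first.
  - move=> r/=; rewrite in_itv/= andbT => r0; rewrite -EFinM lee_fin.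
    by apply: mulr_ge0; [rewrite exprn_ge0 ?ltW|rewrite mulr_ge0// sqr_ge0].
  - apply: measurable_funTS; apply: emeasurable_funM; apply/measurable_EFinP.
      exact: measurable_funX.
    by apply: measurable_funM => //; exact: measurable_funX.
  - exact: ltW.
  rewrite [RHS]integral_mkcond; apply: eq_integral => r _; rewrite patchE.
  case: ifPn => [_|]; first by rewrite -!EFinM.
  rewrite notin_setE/= in_itv/= andbT => r0; rewrite /F1 rhoN ?mul0r ?mulr0//.
  by move=> /and3P[r1 _ _]; apply: r0.
have I12 : (\int[mu]_r F1 r <= \int[mu]_r F2 r)%E by rewrite I1 I2 -DE.
(* Finiteness allows cancelling this integral from both sides, leaving that of [E = F1 - F2] equal
   to 0. *)
have I2fin : (\int[mu]_r F2 r)%E \is a fin_num.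
  rewrite I2 fin_numM// ge0_fin_numE; last by apply: integral_ge0 => r _; rewrite lee_fin hardy_weight_ge0.
  exact: (le_lt_trans (hardy_weight_int_le k rho 1 mrho rho01) (ltry 1)).
pose E (r : R) : \bar R := (fine (F1 r) - fine (F2 r))%:E.
have wE r : P r -> hardy_weight k rho r = r * (1 - r ^+ k.+1) / k.+1%:R.
  by move=> Pr; case/and3P: (Pr) => r0 r1 _; rewrite /hardy_weight r0 r1/= rho1// mul1r.
have wN r : ~ P r -> hardy_weight k rho r = 0.
  by move=> Pr; rewrite /hardy_weight rhoN// mul0r if_same.
have E0 r : (0 <= E r)%E.
  rewrite lee_fin subr_ge0/=; have [Pr|Pr] := pselect (P r); last first.
    by rewrite rhoN// wN// !mul0r !mulr0.
  by rewrite wE// rho1// mul1r [leLHS]mulrC ltW//; case/and3P: Pr.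
have mE : measurable_fun setT E.
  apply/measurable_EFinP; apply: measurable_funB; first by move/measurable_EFinP: mF1.
  by move/measurable_EFinP: mF2.
have FE r : F1 r = (F2 r + E r)%E by rewrite /E -EFinD addrC subrK.
have IE : (\int[mu]_r E r = 0)%E.
  have : (\int[mu]_r F1 r = \int[mu]_r F2 r + \int[mu]_r E r)%E.
    by rewrite -ge0_integralD//; apply: eq_integral => r _; rewrite FE.
  move=> h1; move: I12; rewrite h1 -[X in (_ <= X)%E]adde0 leeD2lE// => h2.
  by apply/eqP; rewrite eq_le; apply/andP; split; [exact: h2|exact: integral_ge0].
rewrite (_ : P = [set r | E r != 0%E]); first exact: ge0_integral_eq0_null.
apply/seteqP; split => r /= Pr.
  rewrite /E eqe subr_eq0/= wE// rho1// mul1r gt_eqF//.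
  by rewrite [ltLHS]mulrC; case/and3P: Pr.
apply: contrapT => nP; move: Pr.
by rewrite /E eqe/= rhoN// wN// !mul0r !mulr0 subrr eqxx.
Qed.

End fixed.
End radial_bound.

Opaque muN.

Section radial_int.
Context {R : realType}.
Local Notation mu := (@lebesgue_measure R).

Lemma pow_sqr_half (x p : R) : `|x| `^ (p + 1) = (x ^+ 2) `^ ((p + 1) / 2).
Proof.
have {1}-> : p + 1 = 2%:R * ((p + 1) / 2) by field.
by rewrite powRrM powR_mulrn// real_normK ?num_real.
Qed.

(* The radial Green function of the ball in dimension [k + 3], up to a constant. *)
Definition green_rad k (r : R) : R := (r ^- k.+1 - 1) / k.+1%:R.

Lemma green_rad_ge0 k r : 0 < r -> r < 1 -> 0 <= green_rad k r.
Proof.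
move=> r0 r1; rewrite /green_rad divr_ge0// subr_ge0 -[leLHS]invr1 lef_pV2 ?posrE ?exprn_gt0//.
by rewrite exprn_ile1// ltW.
Qed.

Section fixed.
Context (k : nat) (u : 'rV[R]_k.+3 -> R) (g : 'rV[R]_k.+3 -> 'rV[R]_k.+3).
Let N := k.+3.
Hypothesis H : H10 N u g.
Let mu_ := H10_meas_u k u g H.
Let S : R := sphere_area N.
Let S0 : 0 < S. Proof. exact: (proj2 (sphere_measE k.+2)). Qed.
Context (p : R) (V : R -> R).
Hypothesis p1 : 1 < p.
Hypothesis mV : measurable_fun setT V.
Hypothesis V0 : forall r, 0 <= V r.
Let q := (p + 1) / 2.
Let q0 : 0 < q. Proof. by rewrite divr_gt0// addr_gt0// (lt_trans ltr01). Qed.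
Let d := fine (energy k g).
Let d0 : 0 <= d.
Proof.
by rewrite /d fine_ge0// iint_ge0// => x; rewrite lee_fin mulr_ge0 ?ind_ballE// sum_sqr_ge0.
Qed.

Let W (x : 'rV[R]_N) : \bar R := (\1_(ball1 N) x * (V (enorm x) * `|u x| `^ (p + 1)))%:E.

Let mW : measurable_fun setT (W : rvec R N -> \bar R).
Proof.
apply/measurable_EFinP; apply: measurable_funM; first exact: measurable_ind_ball.
apply: measurable_funM; first exact: measurable_comp_enorm.
by apply: (measurableT_comp (measurable_powR (p + 1))); exact: measurableT_comp.
Qed.

Let W0 x : (0 <= W x)%E.
Proof. by rewrite lee_fin mulr_ge0 ?ind_ballE// mulr_ge0// powR_ge0. Qed.

(** [r0] stands for the radius at which the weight may vanish. A point with [u x != 0] lies where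
    the integrand is nonzero, outside the ball, at the origin or on the sphere of radius [r0]; the
    last three contribute null sets. *)
Lemma H10_pos (r0 : R) : (forall r, 0 < r -> r < 1 -> r != r0 -> 0 < V r) ->
  nonzero N u -> (0 < iint N W)%E.
Proof.
move=> Vpos nz; rewrite lt_neqAle iint_ge0// andbT; apply/eqP => IW; apply: nz.
have nW := iint_eq0_null N W mW W0 (esym IW).
have mneq : measurable [set x : rvec R N | u x != 0].
  have := emeasurable_neq measurableT (measurableT_comp (@EFin_measurable R _) mu_) 0%E.
  by rewrite setTI.
exists [set x | u x != 0]; split; [exact: mneq|split; last by move=> x /= /eqP].
rewrite lebNE; last exact: mneq.
pose A1 := [set x : rvec R N | W x != 0%E].
pose A2 := [set x : rvec R N | 1 <= enorm (x : 'rV[R]_N) /\ u x != 0].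
pose A3 := [set x : rvec R N | [set 0; r0] (enorm (x : 'rV[R]_N))].
have m2 : measurable ([set 0; r0] : set R) by apply: measurableU; exact: measurable_set1.
have mA1 : measurable A1 by have := emeasurable_neq measurableT mW 0%E; rewrite setTI.
have mA3 : measurable A3.
  by have := @measurable_enorm R N measurableT _ m2; rewrite setTI.
have mA2 : measurable A2.
  apply: measurableI => //.
  have : measurable (`[1%R, +oo[%classic : set R) by exact: measurable_itv.
  move/(@measurable_enorm R N measurableT); rewrite setTI.
  by congr measurable; apply/seteqP; split => x /=; rewrite in_itv/= andbT.
apply: (@subset_measure0 _ _ _ (muN N) _ (A1 `|` A2 `|` A3)).
- exact: mneq.
- by apply: measurableU => //; exact: measurableU.
- move=> x /= ux; have [x1|x1] := leP 1 (enorm x); first by left; right.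
  have [x00|x00] := eqVneq (enorm x) 0; first by right; left.
  have [xr0|xr0] := eqVneq (enorm x) r0; first by right; right.
  left; left; rewrite /A1/= /W eqe ind_ballE x1 mul1r mulf_neq0//.
    by rewrite gt_eqF// Vpos// lt_neqAle eq_sym x00 enorm_ge0.
  by rewrite gt_eqF// powR_gt0// normr_gt0.
- transitivity (muN N (A1 `|` A2)).
    apply: measureU0; [by apply: measurableU; [exact: mA1|exact: mA2]|exact: mA3|].
    apply: muN_enorm_null; first exact: m2.
    transitivity (mu [set 0 : R]); last exact: lebesgue_measure_set1.
    apply: measureU0; [exact: measurable_set1|exact: measurable_set1|].
    exact: lebesgue_measure_set1.
  transitivity (muN N A1); last exact: nW.
  by apply: measureU0; [exact: mA1|exact: mA2|exact: (H10_out k u g H)].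
Qed.

(** Polar coordinates, and the pointwise bound [h^2 <= (d/S) G] raised to the power
    [q = (p+1)/2]. *)
Lemma radial_int : radial N u ->
  (iint N W <= (S * (d / S) `^ q)%:E *
    \int[mu]_(r in `]0%R, 1%R[) (V r * (r ^+ k.+2 * green_rad k r `^ q))%:E)%E.
Proof.
move=> ru; have [h [mh uh]] := radial_version k.+2 u mu_ ru.
have [mbd bd] := radial_ae_bound k u g H h mh uh; rewrite -/d in mbd bd.
pose F (r : R) : \bar R := ((r < 1)%R%:R * (V r * `|h r| `^ (p + 1)))%:E.
have mh1 : measurable_fun setT (fun r : R => `|h r| `^ (p + 1)).
  by apply: (measurableT_comp (measurable_powR (p + 1))); exact: measurableT_comp.
have mF : measurable_fun setT F.
  apply/measurable_EFinP; apply: measurable_funM; last exact: measurable_funM.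
  rewrite (_ : (fun r : R => _) = \1_(`]-oo, 1%R[%classic)).
    by apply: measurable_indic; exact: measurable_itv.
  by apply/funext => r; rewrite indicE mem_setE in_itv/=.
have F0 r : (0 <= F r)%E by rewrite lee_fin mulr_ge0// mulr_ge0// powR_ge0.
have mhe : measurable_fun setT (fun x : rvec R N => h (enorm (x : 'rV[R]_N))).
  exact: measurable_comp_enorm.
have -> : iint N W = iint N (fun x => F (enorm x)).
  apply: (eq_iint_ae N _ _ [set x : rvec R N | u x != h (enorm (x : 'rV[R]_N))]) => //.
  - exact: measurable_comp_enorm.
  - have := measurable_neqe measurableT (measurableT_comp (@EFin_measurable R _) mu_)
        (measurableT_comp (@EFin_measurable R _) mhe).
    by rewrite setTI.
  - by move=> x /= /negP; rewrite negbK => /eqP ux; rewrite /W /F ux ind_ballE.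
rewrite (iint_polar k.+2 F mF F0) (proj1 (sphere_measE k.+2)) -/S [in leRHS]EFinM -muleA.
apply: lee_wpmul2l; first by rewrite lee_fin ltW.
have mG : measurable_fun (`]0%R, 1%R[%classic : set R)
    (fun r : R => (V r * (r ^+ k.+2 * green_rad k r `^ q))%:E).
  apply/measurable_EFinP; apply: measurable_funM; first exact: measurable_funTS.
  apply: measurable_funM; first by apply: measurable_funTS; exact: measurable_funX.
  apply: (measurableT_comp (measurable_powR q)).
  apply: measurable_funM => //; apply: measurable_funB => //.
  apply: open_continuous_measurable_fun; first exact: interval_open.
  move=> r; rewrite inE/= in_itv/= => /andP[r0 _].
  apply: cvgV; first by rewrite expf_neq0// gt_eqF.
  exact: exprn_continuous.
rewrite -ge0_integralZl_EFin; [|exact: measurable_itv| |exact: mG|exact: powR_ge0]; last first.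
  move=> r/=; rewrite in_itv/= => /andP[r0 r1]; rewrite lee_fin; apply: mulr_ge0 => //.
  by apply: mulr_ge0; [rewrite exprn_ge0 ?ltW|rewrite powR_ge0].
have -> : (\int[mu]_(r in `]0%R, +oo[) ((r ^+ k.+2)%:E * F r) =
    \int[mu]_(r in `]0%R, 1%R[) ((r ^+ k.+2)%:E * F r))%E.
  rewrite integral_mkcond [RHS]integral_mkcond; apply: eq_integral => r _; rewrite !patchE.
  rewrite !mem_setE !in_itv/= andbT; case: (ltP 0 r) => //= r0; case: ltP => //= r1.
  by rewrite /F ltNge r1/= mul0r mule0.
apply: ae_ge0_le_integral => //.
- move=> r/=; rewrite in_itv/= => /andP[r0 r1]; rewrite mule_ge0// lee_fin exprn_ge0// ltW//.
- apply: emeasurable_funM; last exact: measurable_funTS.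
  by apply/measurable_EFinP; apply: measurable_funTS; exact: measurable_funX.
- move=> r/=; rewrite in_itv/= => /andP[r0 r1]; rewrite mule_ge0// lee_fin ?powR_ge0//.
  by rewrite mulr_ge0//; apply: mulr_ge0; [rewrite exprn_ge0 ?ltW|rewrite powR_ge0].
- exact: measurable_funeM.
exists (excess k d h); split; [exact: mbd|exact: bd|].
move=> r /= /not_implyP[]; rewrite in_itv/= => /andP[r0 r1] hr.
rewrite /excess/= r0 r1/= ltNge -/S; apply/negP => hb; apply: hr.
rewrite /F r1 mul1r -!EFinM lee_fin pow_sqr_half -/q.
have P0 : 0 < r ^+ k.+2 by rewrite exprn_gt0.
(* The negated excess inequality divided by [S r^(N-1)], using
   [r (1 - r^(k+1)) = r^(k+2) (r^-(k+1) - 1)]. *)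
have hle : h r ^+ 2 <= d / S * green_rad k r.
  rewrite -(ler_pM2l P0) -(ler_pM2l S0) (le_trans hb)// le_eqVlt; apply/orP; left; apply/eqP.
  rewrite /green_rad [r ^+ k.+2]exprSr.
  have Q0 : r ^+ k.+1 != 0 by rewrite expf_neq0// gt_eqF.
  have c1 : k.+1%:R != 0 :> R by rewrite pnatr_eq0.
  move: (r ^+ k.+1) (k.+1%:R : R) Q0 c1 => Q c Q0 c1.
  by field; rewrite Q0 c1 gt_eqF.
have hle2 : (h r ^+ 2) `^ q <= (d / S) `^ q * green_rad k r `^ q.
  have a1 : 0 <= d / S by rewrite divr_ge0// ltW.
  have a2 : 0 <= green_rad k r by exact: green_rad_ge0.
  rewrite -powRM//; apply: ge0_ler_powR => //; first exact: ltW.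
    by rewrite nnegrE sqr_ge0.
  by rewrite nnegrE mulr_ge0.
rewrite mulrCA [leRHS]mulrCA; apply: ler_wpM2l => //.
by rewrite [leRHS]mulrCA; apply: ler_wpM2l; [exact: ltW|exact: hle2].
Qed.

(** The denominator integral is at most [d^q S^(1-q) J]; taking the power [1/q], the Dirichlet
    integral [d] cancels from the quotient. *)
Lemma radial_quot_ge (J r0 : R) : (forall r, 0 < r -> r < 1 -> r != r0 -> 0 < V r) ->
  (\int[mu]_(r in `]0%R, 1%R[) (V r * (r ^+ k.+2 * green_rad k r `^ q))%:E <= J%:E)%E ->
  0 < J -> nonzero N u -> radial N u ->
  (S `^ (1 - q) * J) `^ (- q^-1) <= quot N (fun x => V (enorm x)) p u g.
Proof.
move=> Vpos hJ J0 nz ru.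
have I0 := H10_pos r0 Vpos nz.
have Ile := radial_int ru.
have dS : 0 <= d / S by rewrite divr_ge0// ltW.
have {}Ile : (iint N W <= (S * (d / S) `^ q * J)%:E)%E.
  apply: (le_trans Ile); rewrite [leRHS]EFinM; apply: lee_wpmul2l => //.
  by rewrite lee_fin mulr_ge0 ?powR_ge0// ltW.
have -> : quot N (fun x => V (enorm x)) p u g = d / (fine (iint N W)) `^ (2 / (p + 1)) by [].
have Ifin : iint N W \is a fin_num.
  by rewrite ge0_fin_numE; [exact: le_lt_trans Ile (ltry _)|exact: ltW].
move: I0 Ile; rewrite -(fineK Ifin); move: (fine (iint N W)) => I.
rewrite lte_fin lee_fin /= => I0 Ile.
have -> : 2 / (p + 1) = q^-1 by rewrite /q invf_div.
have qq : q * q^-1 = 1 by rewrite mulfV// gt_eqF.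
have qi0 : 0 < q^-1 by rewrite invr_gt0.
rewrite ler_pdivlMr ?powR_gt0//.
have X0 : 0 < S `^ (1 - q) * J by rewrite mulr_gt0// powR_gt0.
rewrite powRN ler_pdivrMl ?powR_gt0//.
have -> : d = (d `^ q) `^ q^-1 by rewrite -powRrM qq powRr1.
rewrite -powRM ?powR_ge0 ?(ltW X0)//.
apply: ge0_ler_powR; rewrite ?nnegrE ?mulr_ge0 ?powR_ge0 ?(ltW qi0) ?(ltW I0) ?(ltW X0) ?(ltW J0)//.
apply: (le_trans Ile); rewrite le_eqVlt; apply/orP; left; apply/eqP.
rewrite powRM ?invr_ge0 ?(ltW S0)// powRB ?S0; last by rewrite (gt_eqF S0) implybT.
rewrite powRr1 ?(ltW S0)// -[S^-1]powR_inv1 ?(ltW S0)// -powRrM mulN1r powRN.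
by field; rewrite gt_eqF// powR_gt0.
Qed.

End fixed.
End radial_int.

(** * A smooth radial bump *)

Section smooth.
Context {R : realType} {n : nat}.
Implicit Types f g : 'rV[R]_n -> R^o.

Lemma smooth_kS k f : smooth_k k.+1 f -> smooth_k k f.
Proof.
elim: k f => [|k IH] f [df sf].
  by move=> x; exact: differentiable_continuous.
by split => // v; apply: IH; exact: sf.
Qed.

Lemma smooth_k_add k f g : smooth_k k f -> smooth_k k g ->
  smooth_k k (fun x => f x + g x : R^o).
Proof.
elim: k f g => [|k IH] f g /=.
  by move=> cf cg x; exact: (cvgD (cf x) (cg x)).
move=> [df sf] [dg sg]; split => [x|v]; first exact: differentiableD.
rewrite (_ : 'D_v _ = fun x => 'D_v f x + 'D_v g x); first exact: IH.
by apply/funext => x; apply: deriveD; exact: diff_derivable.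
Qed.

Lemma smooth_k_mul k f g : smooth_k k f -> smooth_k k g ->
  smooth_k k (fun x => f x * g x : R^o).
Proof.
elim: k f g => [|k IH] f g.
  by move=> cf cg x; exact: (cvgM (cf x) (cg x)).
move=> sf1 sg1; have [df sf] := sf1; have [dg sg] := sg1.
split => [x|v]; first exact: differentiableM.
rewrite (_ : 'D_v _ = fun x => f x * 'D_v g x + g x * 'D_v f x).
  apply: smooth_k_add; apply: IH; [exact: (smooth_kS _ _ sf1)|exact: sg|exact: (smooth_kS _ _ sg1)|exact: sf].
by apply/funext => x; apply: (@deriveM R _ f g); exact: diff_derivable.
Qed.

Lemma smooth_k_cst k (c : R) : smooth_k k (fun _ : 'rV[R]_n => c : R^o).
Proof.
elim: k c => [|k IH] c; first by move=> x; exact: cst_continuous.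
split => [x|v]; first exact: differentiable_cst.
rewrite (_ : 'D_v _ = fun _ => 0); first exact: IH.
by apply/funext => x; exact: derive_cst.
Qed.

Lemma is_derive_affine_comp f (a : R) (b x v : 'rV[R]_n) : differentiable f (a *: x + b) ->
  is_derive x v (fun y => f (a *: y + b)) (a * 'D_v f (a *: x + b)).
Proof.
move=> df.
have E : (fun h : R => h^-1 *: (f (a *: (h *: v + x) + b) - f (a *: x + b))) =
         (fun h : R => h^-1 *: (f (h *: (a *: v) + (a *: x + b)) - f (a *: x + b))).
  apply/funext => h; congr (_ *: (f _ - _)).
  by rewrite scalerDr !scalerA mulrC addrA.
have dv : derivable f (a *: x + b) (a *: v) by exact: diff_derivable.
apply: DeriveDef; first by move: dv; rewrite /derivable -E.
have -> : 'D_v (fun y => f (a *: y + b)) x = 'D_(a *: v) f (a *: x + b).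
  by rewrite /derive/= -[in RHS]E.
by rewrite !deriveE// linearZ.
Qed.

Lemma differentiable_affine (a : R) (b x : 'rV[R]_n) :
  differentiable (fun y : 'rV[R]_n => a *: y + b) x.
Proof.
apply: (@differentiableD _ _ _ (fun y : 'rV[R]_n => a *: y) (cst b)) => //.
Qed.

(** The constant [m] is there for the induction: each derivative brings out a factor [a]. *)
Lemma smooth_k_affine k f (m a : R) (b : 'rV[R]_n) : smooth_k k f ->
  smooth_k k (fun x => m * f (a *: x + b) : R^o).
Proof.
elim: k f m => [|k IH] f m.
  move=> cf x.
  have h : {for x, continuous (fun y : 'rV[R]_n => f (a *: y + b))}.
    apply: (@continuous_comp _ _ _ (fun y : 'rV[R]_n => a *: y + b) f); last exact: cf.
    exact: differentiable_continuous (differentiable_affine a b x).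
  exact: (cvgM (@cvg_cst _ m _ (nbhs x) _) h).
move=> [df sf].
have dc x : differentiable (fun y => f (a *: y + b)) x.
  exact: (@differentiable_comp _ _ _ _ (fun y : 'rV[R]_n => a *: y + b) f x
    (differentiable_affine a b x) (df _)).
split => [x|v].
  exact: (@differentiableZ _ _ _ (fun y => f (a *: y + b)) m).
rewrite (_ : 'D_v _ = fun x => (m * a) * 'D_v f (a *: x + b)).
  exact: (IH ('D_v f) (m * a) (sf v)).
apply/funext => x; have h := is_derive_affine_comp f a b x v (df _).
rewrite (@deriveZ _ _ _ (fun y => f (a *: y + b)) m).
  by rewrite derive_val -mulrA.
exact: diff_derivable.
Qed.

Lemma smooth_k_coord k (i : 'I_n) : smooth_k k (fun x : 'rV[R]_n => x 0 i : R^o).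
Proof.
have dc x : differentiable (fun x : 'rV[R]_n => x 0 i : R^o) x by exact: differentiable_coord.
case: k => [|k].
  by move=> x; exact: coord_continuous.
split => // v; rewrite (_ : 'D_v _ = fun _ => v 0 i); first exact: smooth_k_cst.
apply/funext => x; rewrite /derive; apply: cvg_lim => //.
apply: cvg_near_cst; near=> h => /=.
have h0 : h != 0 by near: h; exact: nbhs_dnbhs_neq.
by rewrite !mxE addrK /GRing.scale/= mulrA mulVf// mul1r.
Unshelve. all: by end_near. Qed.

End smooth.

Section bump1.
Context {R : realType}.

(* The span of these functions is stable under differentiation. *)
Definition flat (m : nat) (s : R) : R := if 0 < s then s ^- m * expR (- s^-1) else 0.

(** One term of the exponential series, [e^(1/s) >= (1/s)^(m+2) / (m+2)!]. A quadratic bound makes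
    the derivative at 0 vanish. *)
Lemma flat_le m s : `|flat m s| <= m.+2`!%:R * s ^+ 2.
Proof.
rewrite /flat; case: ifPn => s0; last by rewrite normr0 mulr_ge0// sqr_ge0.
have si : 0 < s^-1 by rewrite invr_gt0.
rewrite ger0_norm; last by rewrite mulr_ge0 ?expR_ge0// invr_ge0 exprn_ge0// ltW.
have := expR_ge1Dxn m.+1 (ltW si) => h.
have {}h : (s^-1) ^+ m.+2 / m.+2`!%:R <= expR s^-1 by apply: le_trans h; rewrite lerDr.
have f0 : 0 < m.+2`!%:R :> R by rewrite ltr0n fact_gt0.
move: h; rewrite ler_pdivrMr// => h.
rewrite expRN ler_pdivrMr ?expR_gt0//.
have -> : s ^- m = s ^+ 2 * s^-1 ^+ m.+2.
  rewrite -exprVn !exprS expr0 mulr1; move: (s^-1 ^+ m) => X; field.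
  by rewrite gt_eqF.
apply: (le_trans (ler_wpM2l (sqr_ge0 s) h)).
by rewrite le_eqVlt; apply/orP; left; apply/eqP; ring.
Qed.

Lemma is_derive_flat m (s : R) :
  is_derive s (1 : R) (flat m) (flat m.+2 s - m%:R * flat m.+1 s).
Proof.
have [s0|s0|s0] := ltgtP s 0.
- rewrite /flat !ltNge (ltW s0)/= mulr0 subr0.
  apply: (@near_eq_is_derive _ _ _ (cst 0)).
    by near=> y; rewrite /flat ltNge (_ : y <= 0)//; near: y; exact: lt_le_nbhsl.
- have h1 := @is_derive1_powR R (- m%:R) s s0.
  have h2 := @is_derive1_powR R (- 1) s s0.
  (* For positive argument, inverse powers are rewritten as real powers, whose derivative is
     known. *)
  apply: (@near_eq_is_derive _ _ _ (fun y : R => y `^ (- m%:R) * expR (- y `^ (- 1)))).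
    near=> y; have y0 : 0 < y by near: y; exact: lt_nbhsr.
    by rewrite /flat y0 powR_invn ?(ltW y0)// powR_inv1 ?(ltW y0).
  apply: is_derive_eq; rewrite /flat s0 /GRing.scale/=.
  rewrite (_ : - m%:R - 1 = - m.+1%:R); last by rewrite -[in RHS]natr1; ring.
  rewrite (_ : - 1 - 1 = - 2%:R); last by ring.
  rewrite powR_inv1 ?(ltW s0)// !powR_invn ?(ltW s0)// -!exprVn !exprS expr0.
  by move: (s^-1) (s^-1 ^+ m) (expR _) => Z Y X; ring.
- rewrite s0 /flat ltxx mulr0 subr0.
  have C : (fun h : R => h^-1 *: (flat m (h *: 1 + 0) - flat m 0)) @ 0^' --> (0 : R).
    apply/cvgr0Pnorm_le => e e0; near=> h.
    have h0 : h != 0 by near: h; exact: nbhs_dnbhs_neq.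
    have F0 : 0 < m.+2`!%:R :> R by rewrite ltr0n fact_gt0.
    rewrite {2}/flat ltxx subr0 addr0 /GRing.scale/= mulr1 normrM normfV.
    rewrite mulrC ler_pdivrMr ?normr_gt0//.
    apply: (le_trans (flat_le m h)).
    rewrite -(real_normK (num_real h)) expr2 mulrA ler_wpM2r//.
    rewrite mulrC -ler_pdivlMr//.
    near: h; apply: dnbhs0_le; exact: divr_gt0.
  apply: DeriveDef; first by apply/cvg_ex; exists 0; exact: C.
  by apply: cvg_lim => //; exact: C.
Unshelve. all: by end_near.
Qed.

End bump1.

Section radial_bump.
Context {R : realType}.

Lemma derive_comp1 n (f : R -> R^o) (q : 'rV[R]_n -> R^o) (x v : 'rV[R]_n) (df : R) :
  is_derive (q x : R) (1 : R) f df -> differentiable q x ->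
  differentiable (f \o q : 'rV[R]_n -> R^o) x /\ 'D_v (f \o q : 'rV[R]_n -> R^o) x = df * 'D_v q x.
Proof.
move=> hf dq.
have dff : differentiable f (q x) by apply/derivable1_diffP; exact: (@ex_derive _ _ _ _ _ _ _ hf).
have dc : differentiable (f \o q : 'rV[R]_n -> R^o) x by exact: differentiable_comp.
split => //; rewrite !deriveE// diff_comp//=.
have e1 : 'd f (q x) (1 : R) = df by rewrite -deriveE// (@derive_val _ _ _ _ _ _ _ hf).
have -> : 'd f (q x) ('d q x v) = ('d q x v : R) *: 'd f (q x) (1 : R).
  by rewrite -linearZ/=; congr ('d f (q x) _); rewrite /GRing.scale/= mulr1.
by rewrite e1 mulrC.
Qed.

(** The induction is uniform in [m], since a derivative raises this index. *)
Lemma smooth_flat n k m (q : 'rV[R]_n -> R^o) : (forall k, smooth_k k q) ->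
  smooth_k k (fun x => flat m (q x) : R^o).
Proof.
move=> sq; have [dq _] := sq 1%N.
elim: k m => [|k IH] m.
  move=> x; have [dc _] := derive_comp1 n (flat m) q x 0 _ (is_derive_flat m (q x)) (dq x).
  exact: (differentiable_continuous dc).
split => [x|v].
  by have [dc _] := derive_comp1 n (flat m) q x 0 _ (is_derive_flat m (q x)) (dq x).
rewrite (_ : 'D_v _ = fun x => (flat m.+2 (q x) + (- m%:R) * flat m.+1 (q x)) * 'D_v q x).
  apply: smooth_k_mul; last by have [_] := sq k.+1; exact.
  apply: smooth_k_add; first exact: IH.
  by apply: smooth_k_mul; [exact: smooth_k_cst|exact: IH].
apply/funext => x.
have [_ ->] := derive_comp1 n (flat m) q x v _ (is_derive_flat m (q x)) (dq x).
by rewrite mulNr.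
Qed.

(** Positive exactly on the ball of radius 1/2, so that the bump has its closed support inside the
    open unit ball. *)
Definition bumpq n (x : 'rV[R]_n) : R^o := 4^-1 - \sum_(i < n) x 0 i ^+ 2.

Lemma smooth_k_sum n k (I : Type) (r : seq I) (F : I -> 'rV[R]_n -> R^o) :
  (forall i, smooth_k k (F i)) -> smooth_k k (fun x => \sum_(i <- r) F i x : R^o).
Proof.
move=> sF; elim: r => [|i r IH].
  rewrite (_ : (fun x => _) = fun=> 0); first exact: smooth_k_cst.
  by apply/funext => x; rewrite big_nil.
rewrite (_ : (fun x => _) = fun x => F i x + \sum_(j <- r) F j x).
  exact: smooth_k_add.
by apply/funext => x; rewrite big_cons.
Qed.

Lemma smooth_bumpq n k : smooth_k k (@bumpq n).
Proof.
rewrite (_ : @bumpq n = fun x => 4^-1 + \sum_(i < n) (- 1) * (x 0 i * x 0 i)); last first.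
  apply/funext => x; rewrite /bumpq -mulr_sumr mulN1r.
  by under eq_bigr do rewrite expr2.
apply: (@smooth_k_add _ _ _ (fun=> 4^-1)); first exact: smooth_k_cst.
apply: (@smooth_k_sum n k _ _ (fun i x => (- 1) * (x 0 i * x 0 i))) => i.
apply: smooth_k_mul; first exact: smooth_k_cst.
by apply: smooth_k_mul; exact: smooth_k_coord.
Qed.

(** A witness that the sets whose infima define [S_sob] and [S_alpha_rad] are nonempty; the infimum
    of the empty set would carry no information. *)
Definition radial_bump n (x : 'rV[R]_n) : R^o := flat 0 (bumpq n x).

Lemma bump_neq0 n (x : 'rV[R]_n) : (radial_bump n x != 0) = (\sum_(i < n) x 0 i ^+ 2 < 4^-1).
Proof.
rewrite /radial_bump /flat /bumpq subr_gt0; case: ifPn => h; last by rewrite eqxx.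
by rewrite expr0 invr1 mul1r gt_eqF// expR_gt0.
Qed.

Lemma closure_bump n :
  closure [set x : 'rV[R]_n | radial_bump n x != 0] `<=` [set x | \sum_(i < n) x 0 i ^+ 2 <= 4^-1].
Proof.
have : closed [set x : 'rV[R]_n | \sum_(i < n) x 0 i ^+ 2 <= 4^-1].
  rewrite (_ : mkset _ = (fun x : 'rV[R]_n => \sum_(i < n) x 0 i ^+ 2) @^-1` [set r | r <= 4^-1])//.
  apply: closed_comp; last exact: closed_le.
  by move=> x _; exact: continuous_sumsq.
move=> cl; rewrite [X in _ `<=` X](proj1 (closure_id _) cl); apply: closure_subset => x /=.
by rewrite bump_neq0 => /ltW.
Qed.

Lemma Ccinf_bump n : Ccinf_ball n (@radial_bump n).
Proof.
split; first by move=> k; apply: smooth_flat => j; exact: smooth_bumpq.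
split; last first.
  move=> x /closure_bump /= h; rewrite /ball1/= /enorm -[ltRHS]sqrtr1.
  by rewrite ltr_sqrt// (le_lt_trans h)// invf_lt1// ltr1n.
have cK : compact [set v : 'rV[R]_n | forall i, `[-1, 1]%classic (v ord0 i)].
  apply: (@rV_compact R n (fun=> `[-1, 1]%classic)) => _.
  exact: segment_compact.
apply: (subclosed_compact _ cK); first exact: closed_closure.
move=> x /closure_bump /= h i.
rewrite in_itv/= -ler_norml -[leLHS]ger0_norm// -sqrtr_sqr -[leRHS]sqrtr1.
rewrite ler_wsqrtr// real_normK ?num_real// (@le_trans _ _ 4^-1)//; last by rewrite invf_le1// ler1n.
apply: le_trans h; rewrite (bigD1 i)//= lerDl sumr_ge0// => j _; exact: sqr_ge0.
Qed.

Lemma bump_radial n : radial n (@radial_bump n).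
Proof.
exists (fun r => flat 0 (4^-1 - r ^+ 2)); exists set0; split; [exact: sigma_algebra0|split].
  rewrite lebNE; last exact: sigma_algebra0.
  exact: measure0.
by move=> x /= []; rewrite /radial_bump /bumpq sqr_enorm.
Qed.

Lemma bump_H10 n : H10 n (@radial_bump n) (fun x => \row_i partial i (@radial_bump n) x).
Proof.
have hb := Ccinf_bump n.
split; first by apply/borel_funP; apply: continuous_rvec_measurable; exact: Ccinf_continuous.
split.
  move=> i; apply/borel_funP; rewrite (_ : (fun x => _) = partial i (@radial_bump n)).
    by apply: continuous_rvec_measurable; exact: Ccinf_partial_continuous.
  by apply/funext => x; rewrite mxE.
have iint0 (f : 'rV[R]_n -> \bar R) : (forall x, f x = 0%E) -> iint n f = 0%E.
  move=> f0; rewrite (_ : f = fun=> 0%E); last exact/funext.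
  by rewrite iintE// integral0.
exists (fun=> @radial_bump n); split => //; split.
  rewrite (_ : (fun k => _) = cst 0%E); first exact: cvg_cst.
  by apply/funext => k; apply: iint0 => x; rewrite subrr expr0n.
rewrite (_ : (fun k => _) = cst 0%E); first exact: cvg_cst.
apply/funext => k; apply: iint0 => x; rewrite big1// => i _.
by rewrite mxE subrr expr0n.
Qed.

(** The bump is nonzero on the shell [1/4 < r < 1/2], whose volume is positive by polar
    coordinates. *)
Lemma bump_nonzero n : nonzero n.+1 (@radial_bump n.+1).
Proof.
move=> [A [mA [A0 sA]]].
have S0 := proj2 (@sphere_measE R n).
pose G (r : R) : \bar R := (\1_(`]4^-1, 2^-1[%classic) r)%:E.
have mG : measurable_fun setT G.
  by apply/measurable_EFinP; apply: measurable_indic; exact: measurable_itv.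
have G0 r : (0 <= G r)%E by rewrite lee_fin indicE.
have := @iint_polar R n G mG G0; rewrite (proj1 (sphere_measE n)) => E.
have : (iint n.+1 (fun x => G (enorm x)) <= 0)%E.
  rewrite -A0 /lebN; apply: le_iint.
  - exact: measurable_comp_enorm.
  - by apply/measurable_EFinP; exact: measurable_indic.
  - by move=> x; exact: G0.
  - move=> x; rewrite /G lee_fin !indicE ler_nat.
    case: (boolP (enorm x \in _)) => //; rewrite inE/= in_itv/= => /andP[_ h].
    rewrite mem_set//; apply: sA => /=; apply/eqP; rewrite bump_neq0 -sqr_enorm.
    have -> : 4^-1 = 2^-1 ^+ 2 :> R by field.
    by rewrite ltr_sqr// nnegrE ?enorm_ge0// invr_ge0.
rewrite E pmule_rle0 ?lte_fin// leNgt => /negP; apply.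
(* The shell has width 1/4, and [r^n >= 4^-n] on it. *)
apply: (@lt_le_trans _ _ ((4^-1 ^+ n * 4^-1)%:E)).
  by rewrite lte_fin mulr_gt0 ?exprn_gt0// invr_gt0.
apply: (@le_trans _ _ (\int[@lebesgue_measure R]_(r in `]0%R, +oo[) ((4^-1 ^+ n)%:E * G r))%E).
  have c0 : 0 <= 4^-1 ^+ n :> R by rewrite exprn_ge0// invr_ge0.
  have mGT : measurable_fun (`]0%R, +oo[%classic : set R) G by exact: measurable_funTS.
  rewrite ge0_integralZl_EFin//.
  rewrite EFinM; apply: lee_wpmul2l; first by rewrite lee_fin exprn_ge0// invr_ge0.
  rewrite integral_indic//.
  rewrite (_ : `]4^-1, 2^-1[%classic `&` `]0%R, +oo[%classic = `]4^-1, 2^-1[%classic :> set R).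
    have h : @lebesgue_measure R `]4^-1, 2^-1[ = 4^-1%:E.
      rewrite lebesgue_measure_itv/= lte_fin (_ : 4^-1 < 2^-1); last by rewrite ltf_pV2 ?posrE// ltr_nat.
      by rewrite -EFinB; congr EFin; field.
    by rewrite -[X in (X <= _)%E]h.
  apply/seteqP; split => r /=; first by case.
  rewrite !in_itv/= andbT => /andP[h1 h2]; split; first by rewrite h1.
  by rewrite (lt_trans _ h1)// invr_gt0.
apply: ge0_le_integral => //.
- by move=> r _; rewrite mule_ge0// lee_fin exprn_ge0// invr_ge0.
- by apply: emeasurable_funM => //; exact: measurable_funTS.
- apply: emeasurable_funM; last exact: measurable_funTS.
  by apply/measurable_EFinP; apply: measurable_funTS; exact: measurable_funX.
- move=> r /=; rewrite in_itv/= andbT => r0; rewrite /G indicE mem_setE in_itv/=.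
  case: (boolP (_ && _)) => [/andP[h1 h2]|]; last by rewrite !mule0.
  by rewrite !mule1 lee_fin lerXn2r ?nnegrE ?invr_ge0 ?ltW.
Qed.

End radial_bump.

(** * Rescaled test functions *)

Section testfun.
Context {R : realType} {n : nat}.
Implicit Types (u : 'rV[R]_n -> R) (g : 'rV[R]_n -> 'rV[R]_n).

Lemma cvge0_le (C : R) (a b : nat -> \bar R) : (forall k, 0 <= b k <= C%:E * a k)%E ->
  a @ \oo --> 0%E -> b @ \oo --> 0%E.
Proof.
move=> ba a0; apply: (@squeeze_cvge _ _ _ _ (cst 0%E) b (fun k => C%:E * a k)%E).
- by apply: nearW => k; exact: ba.
- exact: cvg_cst.
- by rewrite -[X in _ --> X](mule0 C%:E); apply: cvgeZl.
Qed.

Lemma measurable_sum_sqr_sub (F G : 'I_n -> rvec R n -> R) :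
  (forall i, measurable_fun setT (F i)) -> (forall i, measurable_fun setT (G i)) ->
  measurable_fun setT (fun x : rvec R n => (\sum_i (F i x - G i x) ^+ 2)%:E).
Proof.
move=> mF mG; apply/measurable_EFinP; apply: measurable_sum => i.
by apply: measurable_funX; exact: measurable_funB.
Qed.

Lemma Ccinf_meas (phi : 'rV[R]_n -> R^o) : Ccinf_ball n phi ->
  measurable_fun setT (phi : rvec R n -> R).
Proof. by move=> h; apply: continuous_rvec_measurable; exact: Ccinf_continuous. Qed.

Lemma Ccinf_partial_meas (phi : 'rV[R]_n -> R^o) i : Ccinf_ball n phi ->
  measurable_fun setT (partial i phi : rvec R n -> R).
Proof. by move=> h; apply: continuous_rvec_measurable; exact: Ccinf_partial_continuous. Qed.

(** The gradients of the approximants vanish outside the ball, so [g] may be cut off there. After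
    rescaling, the gradient then lives on the small ball only. *)
Lemma H10_restrict u g : H10 n u g -> H10 n u (fun x => \1_(ball1 n) x *: g x).
Proof.
move=> [bu [bg [phi [hphi [c1 c2]]]]]; split => //.
have mg i : measurable_fun setT (fun x : rvec R n => g x 0 i) by exact/borel_funP.
have mg' i : measurable_fun setT (fun x : rvec R n => (\1_(ball1 n) (x : 'rV[R]_n) *: g x) 0 i).
  rewrite (_ : (fun x => _) = fun x : rvec R n => \1_(ball1 n) (x : 'rV[R]_n) * g x 0 i).
    by apply: measurable_funM => //; exact: measurable_ind_ball.
  by apply/funext => x; rewrite mxE.
split; first by move=> i; apply/borel_funP; exact: mg'.
exists phi; split => //; split => //.
apply: (cvge0_le 1 _ _ _ c2) => k; rewrite mul1e; apply/andP; split.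
  by apply: iint_ge0 => x; rewrite lee_fin sum_sqr_ge0.
apply: le_iint.
- by apply: measurable_sum_sqr_sub => // i; exact: Ccinf_partial_meas.
- by apply: measurable_sum_sqr_sub => // i; exact: Ccinf_partial_meas.
- by move=> x; rewrite lee_fin sum_sqr_ge0.
move=> x; rewrite lee_fin; apply: ler_sum => i _; rewrite mxE ind_ballE.
case: ltP => x1; first by rewrite mul1r.
by rewrite (Ccinf_partial_out _ _ _ _ (hphi k) x1) mul0r subrr expr0n sqr_ge0.
Qed.

Section affine.
Context (a : R) (b : 'rV[R]_n).
Hypothesis a0 : 0 < a.
Hypothesis sub : forall x, enorm (a *: x + b) < 1 -> enorm x < 1.
Let T (x : 'rV[R]_n) := a *: x + b.
Let T' (y : 'rV[R]_n) := a^-1 *: y + (- (a^-1 *: b)).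

Let TK : cancel T T'.
Proof.
by move=> x; rewrite /T /T' scalerDr scalerA mulVf ?scale1r ?addrK// gt_eqF.
Qed.

Let T'K : cancel T' T.
Proof.
by move=> y; rewrite /T /T' scalerDr scalerN !scalerA mulfV ?scale1r ?subrK// gt_eqF.
Qed.

Let cT (c : R) (e : 'rV[R]_n) : continuous (fun x : 'rV[R]_n => c *: x + e).
Proof. by move=> x; exact: differentiable_continuous (differentiable_affine c e x). Qed.

Lemma Ccinf_affine (phi : 'rV[R]_n -> R^o) : Ccinf_ball n phi ->
  Ccinf_ball n (fun x => phi (a *: x + b)).
Proof.
move=> [sphi [cphi bphi]].
have incl : closure [set x | phi (a *: x + b) != 0] `<=` T @^-1` closure [set x | phi x != 0].
  have cl : closed (T @^-1` closure [set x | phi x != 0]).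
    apply: closed_comp; last exact: closed_closure.
    by move=> x _; exact: cT.
  rewrite [X in _ `<=` X](proj1 (closure_id _) cl); apply: closure_subset => x /= hx.
  exact: subset_closure.
split.
  move=> k; have := @smooth_k_affine R n k phi 1 a b (sphi k).
  by under eq_fun do rewrite mul1r.
split; last by move=> x /incl /bphi; exact: sub.
have cK : compact (T' @` closure [set x | phi x != 0]).
  by apply: continuous_compact => //; apply: continuous_subspaceT; exact: cT.
apply: (subclosed_compact _ cK); first exact: closed_closure.
by move=> x /incl hx; exists (T x) => //; exact: TK.
Qed.

Lemma partial_affine (phi : 'rV[R]_n -> R^o) i x : Ccinf_ball n phi ->
  partial i (fun x => phi (a *: x + b)) x = a * partial i phi (a *: x + b).
Proof.
move=> [/(_ 1%N)[dphi _] _].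
have h := is_derive_affine_comp phi a b x (delta_mx 0 i) (dphi _).
exact: derive_val.
Qed.

(** Rescaling the approximants multiplies the L^2 errors by [a^-n], with an extra [a^2] for
    gradients; [sub] keeps their supports in the unit ball. *)
Lemma H10_affine u g : H10 n u g ->
  H10 n (fun x => u (a *: x + b)) (fun x => a *: g (a *: x + b)).
Proof.
move=> [/borel_funP mu_ [bg [phi [hphi [c1 c2]]]]].
have mg i : measurable_fun setT (fun x : rvec R n => g x 0 i) by exact/borel_funP.
split; first by apply/borel_funP; exact: measurable_comp_affine_rv.
split.
  move=> i; apply/borel_funP.
  rewrite (_ : (fun x => _) = fun x : rvec R n => a * g (a *: (x : 'rV[R]_n) + b) 0 i).
    apply: measurable_funM => //.
    exact: (@measurable_comp_affine_rv R _ _ n a b (fun x => g x 0 i)).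
  by apply/funext => x; rewrite mxE.
exists (fun k x => phi k (a *: x + b)); split; first by move=> k; exact: Ccinf_affine.
have an0 : a != 0 by rewrite gt_eqF.
split.
  apply: (cvge0_le (`|a| ^- n) _ _ _ c1) => k; apply/andP; split.
    by apply: iint_ge0 => x; rewrite lee_fin sqr_ge0.
  rewrite -(iint_affine n a b (fun x => ((phi k x - u x) ^+ 2)%:E))//.
  - apply/measurable_EFinP; apply: measurable_funX; apply: measurable_funB => //.
    exact: Ccinf_meas.
  - by move=> x; rewrite lee_fin sqr_ge0.
apply: (cvge0_le (a ^+ 2 * `|a| ^- n) _ _ _ c2) => k; apply/andP; split.
  by apply: iint_ge0 => x; rewrite lee_fin sum_sqr_ge0.
have ms : measurable_fun setT
    (fun x : rvec R n => (\sum_(i < n) (partial i (phi k) x - g x 0 i) ^+ 2)%:E).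
  by apply: measurable_sum_sqr_sub => // i; exact: Ccinf_partial_meas.
have s0 (x : rvec R n) : (0 <= (\sum_(i < n) (partial i (phi k) x - g x 0 i) ^+ 2)%:E)%E.
  by rewrite lee_fin sum_sqr_ge0.
have a20 : 0 <= a ^+ 2 by exact: sqr_ge0.
have mc := @measurable_comp_affine_rv R _ _ n a b _ ms.
rewrite EFinM -muleA -(iint_affine n a b _ an0 ms s0) -(iintZl n _ _ a20 mc (fun x => s0 _)).
rewrite le_eqVlt; apply/orP; left; apply/eqP; apply: eq_iint => x.
rewrite -EFinM; congr EFin; rewrite mulr_sumr; apply: eq_bigr => i _.
by rewrite partial_affine// mxE -mulrBr exprMn.
Qed.

Lemma nonzero_affine u : nonzero n u -> nonzero n (fun x => u (a *: x + b)).
Proof.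
move=> nz [A [mA [A0 sA]]]; apply: nz.
exists (T' @^-1` A).
have mA1 : measurable_fun setT (fun x : rvec R n => (\1_A x)%:E : \bar R).
  by apply/measurable_EFinP; exact: measurable_indic.
split.
  have mT' : measurable_fun setT (T' : rvec R n -> rvec R n).
    by apply: measurable_rvecP => i; exact: measurable_affine_rv.
  by have := mT' measurableT A mA; rewrite setTI.
split.
  rewrite /lebN (_ : iint _ _ = iint n (fun y => (\1_A (a^-1 *: y + (- (a^-1 *: b))))%:E)); last first.
    by apply: eq_iint => y; rewrite !indicE.
  rewrite (iint_affine n a^-1 (- (a^-1 *: b)) (fun x => (\1_A x)%:E))//.
  - by rewrite -/(lebN n A) A0 mule0.
  - by rewrite invr_neq0// gt_eqF.
move=> y /= uy; apply: sA => /=.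
by rewrite -/(T (T' y)) T'K.
Qed.

(** The Dirichlet integral scales by [a^(2-n)]; the weighted integral is at least [v a^-n] times the
    unweighted one, since the weight is at least [v] where the rescaled ball lies. *)
Lemma quot_affine_le u g (V : R -> R) (p v : R) : H10 n u g -> 1 < p ->
  measurable_fun setT V -> (forall r, 0 <= V r) -> 0 < v ->
  (forall x, enorm (a *: x + b) < 1 -> v <= V (enorm x)) ->
  0 < quot n (fun=> 1) p u g ->
  quot n (fun x => V (enorm x)) p (fun x => u (a *: x + b))
    (fun x => a *: (\1_(ball1 n) (a *: x + b) *: g (a *: x + b))) <=
  (a ^+ 2 / a ^+ n) * (v / a ^+ n) `^ (- (2 / (p + 1))) * quot n (fun=> 1) p u g.
Proof.
move=> Hu p1 mV V0 v0 hv.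
have [/borel_funP mu_ [bg _]] := Hu.
have mg i : measurable_fun setT (fun x : rvec R n => g x 0 i) by exact/borel_funP.
set t := 2 / (p + 1).
have t0 : 0 < t by rewrite divr_gt0// addr_gt0// (lt_trans ltr01).
have an0 : 0 < a ^+ n by rewrite exprn_gt0.
have ane : a != 0 by rewrite gt_eqF.
have a20 : 0 <= a ^+ 2 by exact: sqr_ge0.
have nE : `|a| ^- n = (a ^+ n)^-1 by rewrite gtr0_norm.
pose F (x : rvec R n) : \bar R := (\1_(ball1 n) (x : 'rV[R]_n) * \sum_(i < n) g x 0 i ^+ 2)%:E.
pose K (x : rvec R n) : \bar R := (\1_(ball1 n) (x : 'rV[R]_n) * (1 * `|u x| `^ (p + 1)))%:E.
pose F' (x : rvec R n) : \bar R := (\1_(ball1 n) (x : 'rV[R]_n) *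
  \sum_(i < n) (a *: (\1_(ball1 n) (a *: (x : 'rV[R]_n) + b) *: g (a *: (x : 'rV[R]_n) + b))) 0 i ^+ 2)%:E.
pose K' (x : rvec R n) : \bar R := (\1_(ball1 n) (x : 'rV[R]_n) *
  (V (enorm (x : 'rV[R]_n)) * `|u (a *: (x : 'rV[R]_n) + b)| `^ (p + 1)))%:E.
have -> : quot n (fun=> 1) p u g = fine (iint n F) / fine (iint n K) `^ t by [].
have -> : quot n (fun x => V (enorm x)) p (fun x => u (a *: x + b))
    (fun x => a *: (\1_(ball1 n) (a *: x + b) *: g (a *: x + b))) =
  fine (iint n F') / fine (iint n K') `^ t by [].
have F0 x : (0 <= F x)%E by rewrite lee_fin mulr_ge0 ?ind_ballE// sum_sqr_ge0.
have K0 x : (0 <= K x)%E by rewrite lee_fin mulr_ge0 ?ind_ballE// mul1r powR_ge0.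
have F'0 x : (0 <= F' x)%E by rewrite lee_fin mulr_ge0 ?ind_ballE// sum_sqr_ge0.
have K'0 x : (0 <= K' x)%E by rewrite lee_fin mulr_ge0 ?ind_ballE// mulr_ge0 ?powR_ge0.
have mb : measurable_fun setT (\1_(ball1 n) : rvec R n -> R) by exact: measurable_ind_ball.
have mF : measurable_fun setT F.
  apply/measurable_EFinP; apply: measurable_funM => //.
  by apply: measurable_sum => i; exact: measurable_funX.
have mup : measurable_fun setT (fun x : rvec R n => `|u x| `^ (p + 1)).
  by apply: (measurableT_comp (measurable_powR (p + 1))); exact: measurableT_comp.
have mK : measurable_fun setT K.
  by apply/measurable_EFinP; apply: measurable_funM => //; exact: measurable_funM.
have mK' : measurable_fun setT K'.
  apply/measurable_EFinP; apply: measurable_funM => //; apply: measurable_funM.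
    exact: measurable_comp_enorm.
  exact: (@measurable_comp_affine_rv R _ _ n a b _ mup).
have mbT : measurable_fun setT (fun x : rvec R n => \1_(ball1 n) (a *: (x : 'rV[R]_n) + b) : R).
  exact: (@measurable_comp_affine_rv R _ _ n a b _ mb).
have mF' : measurable_fun setT F'.
  apply/measurable_EFinP; apply: measurable_funM => //.
  apply: measurable_sum => i; apply: measurable_funX.
  rewrite (_ : (fun x => _) = fun x : rvec R n =>
      a * (\1_(ball1 n) (a *: (x : 'rV[R]_n) + b) * g (a *: (x : 'rV[R]_n) + b) 0 i)).
    apply: measurable_funM => //; apply: measurable_funM => //.
    exact: (@measurable_comp_affine_rv R _ _ n a b _ (mg i)).
  by apply/funext => x; rewrite !mxE.
have mFT := @measurable_comp_affine_rv R _ _ n a b _ mF.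
have mKT := @measurable_comp_affine_rv R _ _ n a b _ mK.
have D' : (iint n F' <= (a ^+ 2 / a ^+ n)%:E * iint n F)%E.
  rewrite EFinM -muleA -nE -(iint_affine n a b F ane mF F0) -(iintZl n _ _ a20 mFT (fun x => F0 _)).
  apply: le_iint => //.
    exact: measurable_funeM.
  move=> x; rewrite /F' /F -EFinM lee_fin !ind_ballE.
  case: (ltP (enorm (a *: x + b)) 1) => h1; last first.
    by rewrite big1 ?mulr0 ?mul0r ?mulr0// => i _; rewrite scale0r scaler0 mxE expr0n.
  rewrite sub// !mul1r mulr_sumr; apply: ler_sum => i _.
  by rewrite scale1r mxE exprMn.
have I' : ((v / a ^+ n)%:E * iint n K <= iint n K')%E.
  rewrite EFinM -muleA -nE -(iint_affine n a b K ane mK K0).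
  rewrite -(iintZl n _ _ (ltW v0) mKT (fun x => K0 _)).
  apply: le_iint => //.
    exact: measurable_funeM.
    by move=> x; rewrite mule_ge0// lee_fin ltW.
  move=> x; rewrite /K' /K -EFinM lee_fin !ind_ballE.
  case: (ltP (enorm (a *: x + b)) 1) => h1; last first.
    by rewrite mul0r mulr0 mulr_ge0// mulr_ge0 ?powR_ge0.
  by rewrite sub// !mul1r ler_wpM2r ?powR_ge0// hv.
have := iint_ge0 _ _ F0; have := iint_ge0 _ _ K0.
have := iint_ge0 _ _ F'0; have := iint_ge0 _ _ K'0.
move: (iint n F) (iint n F') (iint n K) (iint n K') D' I'.
move=> D D' I I' hD hI I'0 D'0 I0 D0 qpos.
(* A positive quotient forces both integrals to be finite and nonzero, because [fine] sends infinity
   to 0. *)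
have Dn0 : fine D != 0 by apply/eqP => e; move: qpos; rewrite e mul0r ltxx.
have In0 : fine I != 0.
  by apply/eqP => e; move: qpos; rewrite e powR0 ?invr0 ?mulr0 ?ltxx// gt_eqF.
case: D D0 Dn0 hD qpos => [d d0 dn0 hD qpos| |]//=; last by rewrite eqxx.
case: I I0 In0 hI qpos => [i i0 in0 hI qpos| |]//=; last by rewrite eqxx.
rewrite /= in dn0 in0 qpos *; rewrite lee_fin in d0 i0.
have {}i0 : 0 < i by rewrite lt_neqAle eq_sym in0.
have {}d0 : 0 < d by rewrite lt_neqAle eq_sym dn0.
case: D' D'0 hD => [d' d'0 hD| |]//; rewrite ?lee_fin//= in d'0 hD *.
have va0 : 0 < v / a ^+ n by rewrite divr_gt0.
have RHS0 : 0 <= a ^+ 2 / a ^+ n * (v / a ^+ n) `^ (- t) * (d / i `^ t).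
  apply: mulr_ge0; last by rewrite divr_ge0 ?powR_ge0// ltW.
  by apply: mulr_ge0; [rewrite divr_ge0// ltW|exact: powR_ge0].
(* If the weighted integral is infinite, its [fine] is 0 and the left quotient is 0 by convention,
   so the bound still holds. *)
case: I' I'0 hI => [i' i'0 hI| |]//=; last first.
  by move=> _ _; rewrite powR0 ?invr0 ?mulr0// gt_eqF.
rewrite -EFinM lee_fin in hI.
have vi0 : 0 < v / a ^+ n * i by rewrite mulr_gt0.
have i'p : 0 < i' by exact: lt_le_trans hI.
rewrite ler_pdivrMr ?powR_gt0//.
apply: (le_trans hD).
have -> : a ^+ 2 / a ^+ n * (v / a ^+ n) `^ (- t) * (d / i `^ t) * i' `^ t =
    (a ^+ 2 / a ^+ n * d) * (i' `^ t / ((v / a ^+ n) `^ t * i `^ t)).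
  rewrite powRN; field.
  by rewrite !gt_eqF ?powR_gt0.
rewrite ler_peMr//.
  by rewrite mulr_ge0 ?divr_ge0 ?(ltW an0) ?(ltW d0).
rewrite -powRM ?(ltW va0) ?(ltW i0)// ler_pdivlMr ?powR_gt0// mul1r.
by rewrite ge0_ler_powR ?nnegrE ?(ltW t0) ?(ltW vi0) ?(ltW i'p).
Qed.

End affine.
End testfun.

(** * The weight *)

Section weight.
Context {R : realType}.
Local Notation mu := (@lebesgue_measure R).
Context (R0 : R).
Hypotheses (R00 : 0 <= R0) (R01 : R0 < 1).

Lemma Vw_ge0 (alpha r : R) : 0 <= Vw R0 alpha r.
Proof. by rewrite /Vw; repeat case: ifPn => _; exact: powR_ge0. Qed.

Lemma measurable_Vw (alpha : R) : measurable_fun setT (Vw R0 alpha).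
Proof.
rewrite /Vw; case: (R0 == 0); first exact: measurable_powR.
case: (R0 == 1).
  by apply: (measurableT_comp (measurable_powR alpha)); exact: measurable_funB.
apply: measurable_fun_ifT; first exact: measurable_fun_ltr.
  apply: (measurableT_comp (measurable_powR alpha)); apply: measurable_funB => //.
  exact: measurable_funM.
apply: (measurableT_comp (measurable_powR alpha)); apply: measurable_funB => //.
by apply: measurable_funM => //; exact: measurable_funB.
Qed.

Lemma VwE_lt (alpha r : R) : 0 < R0 -> r < R0 -> Vw R0 alpha r = (1 - r / R0) `^ alpha.
Proof. by move=> p0 rR; rewrite /Vw gt_eqF// lt_eqF// rR. Qed.

(** Includes [R0 = 0], where the outer branch reduces to [r^alpha]; later arguments need no separate
    treatment of that case on this side. *)
Lemma VwE_ge (alpha r : R) : R0 <= r -> Vw R0 alpha r = (1 - (1 - r) / (1 - R0)) `^ alpha.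
Proof.
move=> rR; rewrite /Vw; case: eqVneq => [->|_]; first by rewrite subr0 divr1 subKr.
by rewrite lt_eqF// ltNge rR.
Qed.

Lemma Vw_gt0 (alpha r : R) : 0 < r -> r < 1 -> r != R0 -> 0 < Vw R0 alpha r.
Proof.
move=> r0 r1 rR; have [h|h] := ltP r R0.
  have p0 : 0 < R0 by exact: lt_trans h.
  by rewrite VwE_lt// powR_gt0// subr_gt0 ltr_pdivrMr// mul1r.
have {}h : R0 < r by rewrite lt_neqAle eq_sym rR.
rewrite VwE_ge ?ltW// powR_gt0// subr_gt0 ltr_pdivrMr ?subr_gt0// mul1r.
by rewrite ltrD2l ltrN2.
Qed.

Lemma Vw_le_exp (alpha r : R) : 0 <= alpha -> 0 < r -> r < R0 ->
  Vw R0 alpha r <= expR (- (alpha / R0 * r)).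
Proof.
move=> a0 r0 rR; have p0 : 0 < R0 by exact: lt_trans rR.
rewrite VwE_lt//.
have -> : expR (- (alpha / R0 * r)) = expR (- (r / R0)) `^ alpha.
  by rewrite -expRM; congr expR; rewrite mulNr; congr (- _); rewrite mulrAC [RHS]mulrC mulrA.
apply: ge0_ler_powR => //; rewrite ?nnegrE ?expR_ge0//.
  by rewrite subr_ge0 ler_pdivrMr// mul1r ltW.
exact: expR_ge1Dx.
Qed.

(** The base is [(r - R0) / (1 - R0)], which is at most [r] for [r <= 1]. *)
Lemma Vw_le_pow (alpha r : R) : 0 <= alpha -> R0 <= r -> r < 1 ->
  Vw R0 alpha r <= r `^ alpha.
Proof.
move=> a0 rR r1; rewrite VwE_ge//.
have d0 : 0 < 1 - R0 by rewrite subr_gt0.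
have E : 1 - (1 - r) / (1 - R0) = (r - R0) / (1 - R0) by field; rewrite gt_eqF.
apply: ge0_ler_powR => //; rewrite ?nnegrE; rewrite ?E.
- by rewrite divr_ge0 ?subr_ge0// ltW.
- exact: le_trans rR.
- by rewrite ler_pdivrMr// mulrBr mulr1 lerD2l lerN2 ler_piMl// ltW.
Qed.

Lemma bernoulli_le (r : R) n : 0 <= r -> r <= 1 -> 1 - r ^+ n <= n%:R * (1 - r).
Proof.
move=> r0 r1; elim: n => [|n IH]; first by rewrite expr0 subrr mul0r.
have -> : 1 - r ^+ n.+1 = (1 - r ^+ n) + r ^+ n * (1 - r) by rewrite exprSr; ring.
rewrite -natr1 mulrDl mul1r; apply: lerD => //.
by rewrite ler_piMl ?subr_ge0// exprn_ile1.
Qed.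

Section bound.
Context (k : nat) (p : R).
Hypothesis p1 : 1 < p.
Let q := (p + 1) / 2.
Let m : R := k.+3%:R - q * k.+1%:R.
Hypothesis m0 : 0 < m.
Let q1 : 1 < q. Proof. by rewrite /q ltr_pdivlMr// mul1r -[2]/(1 + 1) ltrD2r. Qed.
Let q0 : 0 < q. Proof. exact: lt_trans q1. Qed.
Let c : R := k.+1%:R.
Let c0 : 0 < c. Proof. by rewrite ltr0n. Qed.

(** Collecting the powers of [r] gives the exponent [m - 1], hence Gamma(m) after the Laplace-type
    integration. *)
Lemma green_rad_pow (r : R) : 0 < r -> r < 1 ->
  r ^+ k.+2 * green_rad k r `^ q = c `^ (- q) * (r `^ (m - 1) * (1 - r ^+ k.+1) `^ q).
Proof.
move=> r0 r1.
have P0 : 0 < r ^+ k.+1 by rewrite exprn_gt0.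
have h1 : 0 <= 1 - r ^+ k.+1 by rewrite subr_ge0 exprn_ile1// ltW.
have -> : green_rad k r = r ^- k.+1 * ((1 - r ^+ k.+1) * c^-1).
  by rewrite /green_rad -/c; field; rewrite !gt_eqF.
rewrite !powRM ?invr_ge0 ?(ltW P0) ?(ltW c0)//; last by rewrite mulr_ge0// invr_ge0 ltW.
rewrite -[r ^- k.+1]powR_invn ?(ltW r0)// -powRrM -[r ^+ k.+2]powR_mulrn ?(ltW r0)//.
rewrite -[c^-1]powR_inv1 ?(ltW c0)// -powRrM mulN1r.
have -> : r `^ (m - 1) = r `^ k.+2%:R * r `^ (- k.+1%:R * q).
  rewrite -powRD; last by rewrite (gt_eqF r0) implybT.
  by congr (_ `^ _); rewrite /m -[in LHS]natr1; ring.
ring.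
Qed.

Lemma moment_inner_le (alpha r : R) : 0 < alpha -> 0 < r -> r < 1 -> r < R0 ->
  Vw R0 alpha r * (r ^+ k.+2 * green_rad k r `^ q) <=
  c `^ (- q) * (r `^ (m - 1) * expR (- (alpha / R0 * r))).
Proof.
move=> a0 r0 r1 rR; rewrite green_rad_pow// mulrCA; apply: ler_wpM2l; first exact: powR_ge0.
rewrite mulrCA; apply: ler_wpM2l; first exact: powR_ge0.
rewrite -[leRHS]mulr1; apply: ler_pM; rewrite ?Vw_ge0 ?powR_ge0//.
  by rewrite Vw_le_exp// ltW.
have h0 : 0 <= 1 - r ^+ k.+1 by rewrite subr_ge0 exprn_ile1// ltW.
rewrite [leRHS](_ : 1 = 1 `^ q); last by rewrite powR1.
apply: ge0_ler_powR; rewrite ?nnegrE ?(ltW q0)//.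
by rewrite gerBl exprn_ge0// ltW.
Qed.

(** As [q > 1], [(1 - r^(k+1))^q <= 1 - r^(k+1) <= c (1 - r)]; as [m > 0], [r^(alpha+m-1) <=
    r^(alpha-1) <= e^(-(alpha-1)(1-r))]. The exponent [2 - 1] matches [gamma_scale] at [s = 2]. *)
Lemma moment_outer_le (alpha r : R) : 1 < alpha -> 0 < r -> r < 1 -> R0 <= r ->
  Vw R0 alpha r * (r ^+ k.+2 * green_rad k r `^ q) <=
  c `^ (- q) * (c * ((1 - r) `^ (2 - 1) * expR (- ((alpha - 1) * (1 - r))))).
Proof.
move=> a1 r0 r1 rR; rewrite green_rad_pow// mulrCA; apply: ler_wpM2l; first exact: powR_ge0.
have a0 : 0 < alpha by exact: lt_trans a1.
have h0 : 0 <= 1 - r ^+ k.+1 by rewrite subr_ge0 exprn_ile1// ltW.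
have s0 : 0 < 1 - r by rewrite subr_gt0.
have -> : (1 - r) `^ (2 - 1) = 1 - r.
  by rewrite (_ : 2 - 1 = 1) ?powRr1 ?(ltW s0)//; ring.
have hb : (1 - r ^+ k.+1) `^ q <= c * (1 - r).
  apply: (@le_trans _ _ (1 - r ^+ k.+1)).
    have [->|hn] := eqVneq (1 - r ^+ k.+1) 0; first by rewrite powR0 ?gt_eqF.
    apply: ge1r_powR; last exact: ltW.
    by rewrite lt_neqAle eq_sym hn h0/= gerBl exprn_ge0// ltW.
  by apply: bernoulli_le; exact: ltW.
have hV := Vw_le_pow alpha r (ltW a0) rR r1.
have hp : Vw R0 alpha r * r `^ (m - 1) <= expR (- ((alpha - 1) * (1 - r))).
  apply: (@le_trans _ _ (r `^ alpha * r `^ (m - 1))); first by rewrite ler_wpM2r ?powR_ge0.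
  rewrite -powRD; last by rewrite (gt_eqF r0) implybT.
  apply: (@le_trans _ _ (r `^ (alpha - 1))).
    apply: ger_powR; first by rewrite r0 ltW.
    by rewrite addrA lerD2r lerDl ltW.
  have -> : expR (- ((alpha - 1) * (1 - r))) = expR (- (1 - r)) `^ (alpha - 1).
    by rewrite -expRM; congr expR; ring.
  apply: ge0_ler_powR; rewrite ?nnegrE ?expR_ge0 ?(ltW r0) ?subr_ge0 ?(ltW a1)//.
  by apply: le_trans (expR_ge1Dx _); rewrite opprB addrC subrK.
rewrite [leLHS]mulrA [leRHS]mulrA [leRHS]mulrC.
by apply: ler_pM => //; rewrite ?mulr_ge0 ?powR_ge0 ?Vw_ge0.
Qed.

(* The summand [+ 1] makes positivity immediate. *)
Definition radial_moment_bound (alpha : R) : R := c `^ (- q) *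
  ((R0 / alpha) `^ m * Gamma m + c * (Gamma 2 + 1) * (alpha - 1) ^- 2).

Lemma Gamma_ge0 (s : R) : 0 <= Gamma s.
Proof.
rewrite GammaE fine_ge0// integral_ge0// => t _.
by rewrite lee_fin mulr_ge0 ?expR_ge0// powR_ge0.
Qed.

Lemma radial_moment_bound_gt0 (alpha : R) : 1 < alpha -> 0 < radial_moment_bound alpha.
Proof.
move=> a1; apply: mulr_gt0; first by rewrite powR_gt0.
apply: ltr_wpDl; first by rewrite mulr_ge0 ?powR_ge0// Gamma_ge0.
apply: mulr_gt0; last by rewrite invr_gt0 exprn_gt0// subr_gt0.
by rewrite mulr_gt0// ltr_wpDl// Gamma_ge0.
Qed.

Lemma GammaK (s : R) : 0 < s -> gammaE s = (Gamma s)%:E.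
Proof.
move=> s0; rewrite GammaE fineK// ge0_fin_numE; first exact: gamma_fin.
by apply: integral_ge0 => t _; rewrite lee_fin mulr_ge0 ?expR_ge0// powR_ge0.
Qed.

Lemma radial_moment_bound_le (alpha : R) : 1 < alpha ->
  (\int[mu]_(r in `]0%R, 1%R[) (Vw R0 alpha r * (r ^+ k.+2 * green_rad k r `^ q))%:E <=
   (radial_moment_bound alpha)%:E)%E.
Proof.
move=> a1; have a0 : 0 < alpha by exact: lt_trans a1.
have a10 : 0 < alpha - 1 by rewrite subr_gt0.
pose E1 (r : R) : R := r `^ (m - 1) * expR (- (alpha / R0 * r)).
pose E2 (r : R) : R := r `^ (2 - 1) * expR (- ((alpha - 1) * r)).
have mE1 : measurable_fun setT E1.
  apply: measurable_funM; first exact: measurable_powR.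
  apply: (measurableT_comp (@measurable_expR R)).
  by apply: (measurableT_comp (@oppr_measurable R _)); exact: measurable_funM.
have mE2 : measurable_fun setT E2.
  apply: measurable_funM; first exact: measurable_powR.
  apply: (measurableT_comp (@measurable_expR R)).
  by apply: (measurableT_comp (@oppr_measurable R _)); exact: measurable_funM.
have E10 r : 0 <= E1 r by rewrite mulr_ge0 ?powR_ge0 ?expR_ge0.
have E20 r : 0 <= E2 r by rewrite mulr_ge0 ?powR_ge0 ?expR_ge0.
pose i0 := \1_(`]0%R, +oo[%classic : set R) : R -> R.
have mi0 : measurable_fun setT i0 by apply: measurable_indic; exact: measurable_itv.
have i00 r : 0 <= i0 r by rewrite /i0 indicE.
(* Switches the inner majorant off when [R0 = 0]: there is then no inner region, and [alpha / R0]
   would be 0, leaving no decay. *)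
pose e : R := (0 < R0)%R%:R.
pose A1 (r : R) : \bar R := ((c `^ (- q) * e) * (i0 r * E1 r))%:E.
pose A2 (r : R) : \bar R := ((c `^ (- q) * c) * (i0 r * E2 r))%:E.
have cq0 : 0 <= c `^ (- q) by exact: powR_ge0.
have e0 : 0 <= e by rewrite /e.
have mA1 : measurable_fun setT A1.
  by apply/measurable_EFinP; apply: measurable_funM => //; exact: measurable_funM.
have mA2 : measurable_fun setT A2.
  by apply/measurable_EFinP; apply: measurable_funM => //; exact: measurable_funM.
have A10 r : (0 <= A1 r)%E by rewrite lee_fin; apply: mulr_ge0; apply: mulr_ge0.
have A20 r : (0 <= A2 r)%E by rewrite lee_fin; apply: mulr_ge0; apply: mulr_ge0 => //; exact: ltW.
have mA2' : measurable_fun setT (fun r : R => A2 (-1 * r + 1)).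
  exact: (measurableT_comp mA2 (measurable_affine _ _)).
have intE (F : R -> R) (C : R) : measurable_fun setT F -> (forall r, 0 <= F r) -> 0 <= C ->
    (\int[mu]_r (C * (i0 r * F r))%:E = C%:E * \int[mu]_(r in `]0%R, +oo[) (F r)%:E)%E.
  move=> mF F0 C0; rewrite -ge0_integralZl_EFin//; last 2 first.
  - by move=> r _; rewrite lee_fin.
  - by apply/measurable_EFinP; exact: measurable_funTS.
  rewrite [RHS]integral_mkcond; apply: eq_integral => r _.
  rewrite patchE /i0 indicE; case: ifPn => _; first by rewrite mul1r EFinM.
  by rewrite mul0r mulr0.
have I1 : (\int[mu]_r A1 r <= (c `^ (- q) * ((R0 / alpha) `^ m * Gamma m))%:E)%E.
  rewrite intE ?mulr_ge0//.
  have [Rp|Rn] := ltP 0 R0; last first.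
    rewrite /e ltNge Rn/= mulr0 mul0e lee_fin mulr_ge0// mulr_ge0 ?powR_ge0// Gamma_ge0//.
  rewrite /e Rp mulr1 /E1 gamma_scale ?divr_gt0// GammaK// -!EFinM lee_fin.
  apply: ler_wpM2l => //; apply: ler_wpM2r; first exact: Gamma_ge0.
  by rewrite powRN -[R0 / alpha]invf_div -[in leRHS]powR_inv1 ?divr_ge0 ?(ltW a0)// -powRrM mulN1r powRN.
have I2 : (\int[mu]_r A2 (-1 * r + 1)%R <= (c `^ (- q) * (c * (Gamma 2 + 1) * (alpha - 1) ^- 2))%:E)%E.
  rewrite (integral_affine (-1) 1 A2)//.
  rewrite normrN normr1 invr1 mul1e intE ?mulr_ge0 ?(ltW c0)//.
  rewrite /E2 gamma_scale// GammaK// -!EFinM lee_fin.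
  rewrite -[leLHS]mulrA; apply: ler_wpM2l => //.
  rewrite -mulrA; apply: ler_wpM2l; first exact: ltW.
  rewrite powR_invn ?(ltW a10)// mulrC; apply: ler_wpM2r; last by rewrite lerDl.
  by rewrite invr_ge0 sqr_ge0.
apply: (@le_trans _ _ (\int[mu]_r (A1 r + A2 (-1 * r + 1)%R))%E); last first.
  rewrite ge0_integralD// /radial_moment_bound mulrDr EFinD.
  exact: leeD.
rewrite integral_mkcond; apply: ge0_le_integral => //.
- move=> r _; rewrite patchE; case: ifPn => //.
  rewrite inE/= in_itv/= => /andP[r0 _]; rewrite lee_fin mulr_ge0 ?Vw_ge0//.
  by rewrite mulr_ge0 ?powR_ge0// exprn_ge0// ltW.
- apply/(measurable_restrictT _ _).1; first exact: measurable_itv.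
  apply/measurable_EFinP; apply: measurable_funM; first by apply: measurable_funTS; exact: measurable_Vw.
  apply: measurable_funM; first by apply: measurable_funTS; exact: measurable_funX.
  apply: (measurableT_comp (measurable_powR q)).
  apply: measurable_funM => //; apply: measurable_funB => //.
  apply: open_continuous_measurable_fun; first exact: interval_open.
  move=> r; rewrite inE/= in_itv/= => /andP[r0 _].
  apply: cvgV; first by rewrite expf_neq0// gt_eqF.
  exact: exprn_continuous.
- by apply: emeasurable_funD.
move=> r _; rewrite patchE; case: ifPn => [|_]; last by rewrite adde_ge0.
rewrite inE/= in_itv/= => /andP[r0 r1].
have ir : i0 r = 1 by rewrite /i0 indicE mem_set//= in_itv/= r0.
have E1r : (-1 * r + 1) = 1 - r by ring.
have ir1 : i0 (1 - r) = 1 by rewrite /i0 indicE mem_set//= in_itv/= andbT subr_gt0.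
have [rR|rR] := ltP r R0.
  have Rp : 0 < R0 by exact: lt_trans rR.
  apply: (@le_trans _ _ (A1 r)); last by rewrite leeDl.
  by rewrite lee_fin ir mul1r /e Rp mulr1; exact: moment_inner_le.
apply: (@le_trans _ _ (A2 (-1 * r + 1))); last by rewrite leeDr.
by rewrite E1r lee_fin ir1 mul1r -mulrA; exact: moment_outer_le.
Qed.

End bound.
End weight.

(** * Where the test functions concentrate, and the weight there *)

Section concentration.
Context {R : realType}.

Lemma enormN n (x : 'rV[R]_n) : enorm (- x) = enorm x.
Proof. by rewrite -scaleN1r enormZ normrN1 mul1r. Qed.

Lemma enormD n (x y : 'rV[R]_n) : enorm (x + y) <= enorm x + enorm y.
Proof.
rewrite -ler_sqr ?nnegrE ?addr_ge0 ?enorm_ge0// sqrrD !sqr_enorm.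
have -> : \sum_(i < n) (x + y) 0 i ^+ 2 = \sum_(i < n) x 0 i ^+ 2 +
    (\sum_(i < n) x 0 i * y 0 i) *+ 2 + \sum_(i < n) y 0 i ^+ 2.
  rewrite -sumrMnl -!big_split/=; apply: eq_bigr => i _.
  by rewrite mxE sqrrD.
rewrite lerD2r lerD2l lerMn2r/=; apply: le_trans (ler_norm _) _.
rewrite -ler_sqr ?nnegrE ?mulr_ge0 ?enorm_ge0// real_normK ?num_real// exprMn !sqr_enorm.
exact: sum_cauchy_schwarz.
Qed.

Lemma enorm_delta n : enorm (delta_mx 0 0 : 'rV[R]_n.+1) = 1.
Proof.
rewrite /enorm big_ord_recl/= mxE/= big1 ?addr0 ?expr1n ?sqrtr1// => i _.
by rewrite mxE/= expr0n.
Qed.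

(* [b = 0] is the ball of radius [1/alpha] at the origin, [b = - (alpha - 1) e_0] the one tangent
   to the unit sphere at [e_0]. *)
Lemma Vw_concentrated n (R0 kappa alpha : R) : 0 <= R0 -> R0 < 1 ->
  (0 < R0 /\ kappa = 2 / R0) \/ kappa = 2 / (1 - R0) -> kappa < alpha ->
  exists b : 'rV[R]_n.+1,
    (forall x, enorm (alpha *: x + b) < 1 -> enorm x < 1) /\
    (forall x, enorm (alpha *: x + b) < 1 ->
       (1 - kappa / alpha) `^ alpha <= Vw R0 alpha (enorm x)).
Proof.
move=> R00 R01 hk ka.
have d0 : 0 < 1 - R0 by rewrite subr_gt0.
have k2 : 2 <= kappa.
  by case: hk => [[p0 ->]|->]; rewrite ler_pdivlMr//; lra.
have a2 : 2 < alpha by exact: le_lt_trans ka.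
have a0 : 0 < alpha by exact: lt_trans a2.
have base0 : 0 <= 1 - kappa / alpha by rewrite subr_ge0 ler_pdivrMr// mul1r ltW.
case: hk => [[p0 kE]|kE].
  exists 0; have ax x : enorm (alpha *: x + 0 : 'rV[R]_n.+1) < 1 -> enorm x < alpha^-1.
    by rewrite addr0 enormZ gtr0_norm// -ltr_pdivlMl// mulr1.
  split=> x /ax hx.
    apply: (lt_trans hx); rewrite -[ltRHS]invr1 ltf_pV2 ?posrE//; lra.
  have iaR : 2 / alpha < R0 by rewrite ltr_pdivrMr// mulrC -ltr_pdivrMr// -kE.
  have hxR : enorm x < R0.
    apply: (lt_trans hx); apply: le_lt_trans iaR; rewrite -[leLHS]mul1r.
    by rewrite ler_wpM2r ?invr_ge0 ?(ltW a0)// ler1n.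
  rewrite VwE_lt//; apply: ge0_ler_powR; rewrite ?nnegrE ?(ltW a0)//.
    by rewrite subr_ge0 ler_pdivrMr// mul1r ltW.
  rewrite lerD2l lerN2 kE mulrAC ler_wpM2r ?invr_ge0//.
  apply: (le_trans (ltW hx)); rewrite -[leLHS]mul1r.
  by rewrite ler_wpM2r ?invr_ge0 ?(ltW a0)// ler1n.
exists (- (alpha - 1) *: delta_mx 0 0).
have a10 : 0 < alpha - 1 by lra.
have eb : enorm ((alpha - 1) *: delta_mx 0 0 : 'rV[R]_n.+1) = alpha - 1.
  by rewrite enormZ enorm_delta mulr1 gtr0_norm.
(* The ball has radius [1/alpha] and centre at distance [1 - 1/alpha]; the two triangle inequalities
   place it between the radii [1 - 2/alpha] and 1. *)
have ax x : enorm (alpha *: x + - (alpha - 1) *: delta_mx 0 0 : 'rV[R]_n.+1) < 1 ->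
    enorm x < 1 /\ 1 - enorm x < 2 / alpha.
  rewrite scaleNr; set B := _ *: delta_mx 0 0 in eb *; move=> h.
  have E : enorm (alpha *: x) = alpha * enorm x by rewrite enormZ gtr0_norm.
  split.
    rewrite -(@ltr_pM2l _ alpha)// mulr1 -E.
    have -> : alpha *: x = (alpha *: x - B) + B by rewrite subrK.
    by apply: le_lt_trans (enormD _ _ _) _; rewrite eb; lra.
  have h2 : alpha - 1 <= enorm (alpha *: x) + enorm (alpha *: x - B).
    rewrite -eb -(enormN _ (alpha *: x - B)).
    by apply: le_trans (enormD _ _ _); rewrite opprB addrC subrK.
  by rewrite ltr_pdivlMr//; rewrite E in h2; lra.
split=> x /ax[x1 x2]; first by [].
have hxR : R0 <= enorm x.
  have : 2 / alpha < 1 - R0 by rewrite ltr_pdivrMr// mulrC -ltr_pdivrMr// -kE.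
  lra.
rewrite VwE_ge//; apply: ge0_ler_powR; rewrite ?nnegrE ?(ltW a0)//.
  by rewrite subr_ge0 ler_pdivrMr// mul1r; lra.
rewrite lerD2l lerN2 kE mulrAC ler_wpM2r ?invr_ge0 ?(ltW d0)//; exact: ltW.
Qed.

End concentration.

Section asymptotics.
Context {R : realType}.

(** From [-ln(1 - kappa/alpha) = ln(1 + kappa/(alpha - kappa)) <= kappa/(alpha - kappa)]. It
    replaces the limit [e^(-kappa)] by a bound with explicit threshold for each [theta > kappa]. *)
Lemma powR_1Bx_ge (kappa theta alpha : R) : 0 < kappa -> kappa < alpha ->
  theta * kappa <= alpha * (theta - kappa) ->
  expR (- theta) <= (1 - kappa / alpha) `^ alpha.
Proof.
move=> k0 ka h; have a0 : 0 < alpha by exact: lt_trans ka.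
have d0 : 0 < alpha - kappa by rewrite subr_gt0.
have b0 : 0 < 1 - kappa / alpha by rewrite subr_gt0 ltr_pdivrMr// mul1r.
rewrite /powR (gt_eqF b0) ler_expR lerNl -mulrN -lnV ?posrE//.
have -> : (1 - kappa / alpha)^-1 = 1 + kappa / (alpha - kappa) by field; rewrite !gt_eqF.
apply: (@le_trans _ _ (alpha * (kappa / (alpha - kappa)))).
  rewrite ler_pM2l//; apply: le_ln1Dx; apply: (@lt_trans _ _ 0) => //.
  by rewrite divr_gt0.
by rewrite mulrA ler_pdivrMr//; lra.
Qed.

(** A level [L] is put midway between [A] and [e^(-kappa)]. Beyond [x1] the right-hand side is at
    least [L]; beyond [x2] the [B] term is below [L - A]. *)
Lemma eventually_dominated (A B kappa m : R) : 0 <= A -> 0 <= B -> 0 < kappa ->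
  m < 2 -> A * expR kappa < 1 ->
  exists alpha0 : R, 0 < alpha0 /\ forall alpha, alpha0 < alpha ->
    [/\ 2 < alpha, kappa < alpha &
     A + B * (alpha `^ m * (alpha - 1) ^- 2) < (1 - kappa / alpha) `^ alpha].
Proof.
move=> A0 B0 k0 m2 hA.
have {}hA : A < expR (- kappa) by rewrite expRN -[ltRHS]mul1r ltr_pdivlMr ?expR_gt0.
pose L := (A + expR (- kappa)) / 2.
have [AL Lk] : A < L /\ L < expR (- kappa) by rewrite /L; split; lra.
have L0 : 0 < L by exact: le_lt_trans AL.
pose theta := - ln L.
have kt : kappa < theta by rewrite /theta ltrNr -[ltRHS]expRK ltr_ln ?posrE ?expR_gt0.
have LE : expR (- theta) = L by rewrite /theta opprK lnK.
have tk0 : 0 < theta - kappa by rewrite subr_gt0.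
have LA0 : 0 < L - A by rewrite subr_gt0.
have m20 : 0 < 2 - m by rewrite subr_gt0.
pose x1 := theta * kappa / (theta - kappa).
pose x2 := (4 * B / (L - A)) `^ (2 - m)^-1.
have x10 : 0 < x1 by rewrite /x1 divr_gt0// mulr_gt0// (lt_trans k0).
have x20 : 0 <= x2 by exact: powR_ge0.
exists (2 + kappa + x1 + x2); split; first by lra.
move=> alpha ha; have a2 : 2 < alpha by lra.
have a0 : 0 < alpha by lra.
have ka : kappa < alpha by lra.
split=> //; apply: (@lt_le_trans _ _ L); last first.
  rewrite -LE; apply: powR_1Bx_ge => //; rewrite -ler_pdivrMr// -/x1; lra.
have hp : 4 * B / (L - A) < alpha `^ (2 - m).
  have h : x2 < alpha by lra.
  have -> : 4 * B / (L - A) = x2 `^ (2 - m).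
    rewrite /x2 -powRrM mulVf ?gt_eqF// powRr1// divr_ge0 ?(ltW LA0)// mulr_ge0//.
  by apply: gt0_ltr_powR; rewrite ?nnegrE ?(ltW a0).
rewrite -ltrBrDl.
(* The factor 4 comes from [alpha - 1 >= alpha / 2]. *)
apply: (@le_lt_trans _ _ (4 * B * (alpha `^ (2 - m))^-1)).
  rewrite [leRHS]mulrAC [leLHS]mulrC -[leLHS]mulrA [4 * _]mulrC.
  have -> : (alpha `^ (2 - m))^-1 = alpha `^ m * alpha ^- 2.
    rewrite -powRN opprB powRD ?(gt_eqF a0) ?implybT//; congr (_ * _).
    by rewrite powR_invn// ltW.
  rewrite -!mulrA ler_wpM2l ?powR_ge0// [leRHS]mulrA ler_wpM2r//.
  have -> : 4 = (2^-1 ^- 2) :> R by rewrite exprVn invrK expr2 -natrM.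
  rewrite -invfM -exprMn lef_pV2 ?posrE ?exprn_gt0 ?mulr_gt0//; last by lra.
  by rewrite ler_sqr ?nnegrE; lra.
by rewrite ltr_pdivrMr ?powR_gt0// [ltRHS]mulrC -ltr_pdivrMr.
Qed.

End asymptotics.

(** * Comparison of the two infima *)

Section infima.
Context {R : realType}.

Lemma quot_num_ge0 n (g : 'rV[R]_n -> 'rV[R]_n) :
  0 <= fine (iint n (fun x => (\1_(ball1 n) x * \sum_(i < n) g x 0 i ^+ 2)%:E)).
Proof.
rewrite fine_ge0//; apply: iint_ge0 => x.
by rewrite lee_fin mulr_ge0 ?ind_ballE// sumr_ge0// => i _; rewrite sqr_ge0.
Qed.

Lemma quot_ge0 n W (p : R) u g : 0 <= quot n W p u g.
Proof. by rewrite /quot divr_ge0 ?powR_ge0// quot_num_ge0. Qed.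

Lemma quot_num_gt0 n W (p : R) u g : 0 < quot n W p u g ->
  0 < fine (iint n (fun x => (\1_(ball1 n) x * \sum_(i < n) g x 0 i ^+ 2)%:E)).
Proof.
move=> h; rewrite lt0r quot_num_ge0 andbT; apply: contraTneq h.
by rewrite /quot => ->; rewrite mul0r ltxx.
Qed.

Lemma Sinf_has_lbound n W (p : R) P :
  has_lbound [set q | exists u g, [/\ H10 n u g, nonzero n u, P u & q = quot n W p u g]].
Proof. by exists 0 => _ [u [g [_ _ _ ->]]]; exact: quot_ge0. Qed.

Lemma Sinf_le n W (p : R) (P : ('rV[R]_n -> R) -> Prop) u g :
  H10 n u g -> nonzero n u -> P u -> Sinf n W p P <= quot n W p u g.
Proof.
by move=> H nz Pu; apply: (ge_inf (Sinf_has_lbound n W p P)); exists u, g.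
Qed.

Lemma Sinf_approx n W (p : R) (P : ('rV[R]_n -> R) -> Prop) (eps : R) :
  (exists u g, [/\ H10 n u g, nonzero n u & P u]) -> 0 < eps ->
  exists u g, [/\ H10 n u g, nonzero n u, P u & quot n W p u g < Sinf n W p P + eps].
Proof.
move=> [u [g [H nz Pu]]] e0.
have hi : has_inf [set q | exists u g,
    [/\ H10 n u g, nonzero n u, P u & q = quot n W p u g]].
  by split; [exists (quot n W p u g), u, g|exact: Sinf_has_lbound].
have [_ [v [h [Hv nzv Pv ->]]] lt] := inf_adherent e0 hi.
by exists v, h.
Qed.

(** Raised to the power [q], the left side is [alpha^m Q^q / v], because
    [2 - (n+2) + (n+2)/q = m/q]. Both bounds thus compare at the same order in [alpha]. *)
Lemma scaled_quot_lt n (alpha v Q T q m : R) : 0 < alpha -> 0 < v -> 0 < Q -> 0 < T -> 0 < q ->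
  m = n.+2%:R - q * n%:R -> alpha `^ m * T * Q `^ q < v ->
  alpha ^+ 2 / alpha ^+ n.+2 * (v / alpha ^+ n.+2) `^ (- q^-1) * Q < T `^ (- q^-1).
Proof.
move=> a0 v0 Q0 T0 q0 mE h.
have qn0 : q != 0 by rewrite gt_eqF.
have A0 : 0 < alpha `^ m by rewrite powR_gt0.
have Qq0 : 0 < Q `^ q by rewrite powR_gt0.
have Nq : - q^-1 = -1 * q^-1 by rewrite mulN1r.
have -> : T `^ (- q^-1) = T^-1 `^ q^-1 by rewrite Nq powRrM powR_inv1 ?ltW.
have -> : alpha ^+ 2 / alpha ^+ n.+2 * (v / alpha ^+ n.+2) `^ (- q^-1) * Q =
    (alpha `^ m * Q `^ q * v^-1) `^ q^-1.
  rewrite !powRM ?mulr_ge0 ?invr_ge0 ?exprn_ge0 ?powR_ge0 ?(ltW a0) ?(ltW v0)//.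
  rewrite -!powRrM mulfV// (powRr1 (ltW Q0)).
  rewrite -[v^-1]powR_inv1 ?(ltW v0)// -powRrM mulN1r.
  rewrite -powR_invn ?(ltW a0)// -powRrM.
  have -> : alpha ^+ 2 = alpha `^ 2 by rewrite -powR_mulrn ?(ltW a0).
  have -> : alpha `^ (m * q^-1) = alpha `^ 2 * alpha `^ (- n.+2%:R) *
      alpha `^ (- n.+2%:R * - q^-1).
    rewrite -!powRD ?(gt_eqF a0) ?implybT//; congr (_ `^ _); rewrite mE.
    by rewrite -addn2 natrD; field.
  by ring.
apply: gt0_ltr_powR; rewrite ?nnegrE ?invr_gt0 ?invr_ge0 ?(ltW T0)//.
  by rewrite !mulr_ge0 ?invr_ge0 ?powR_ge0 ?ltW.
by rewrite ltr_pdivrMr// [ltRHS]mulrC ltr_pdivlMr// mulrAC.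
Qed.

End infima.

(** * Strict inequality and symmetry breaking *)

Section main.
Context {R : realType} (k : nat) (p R0 : R).
Hypotheses (p1 : 1 < p) (R00 : 0 <= R0) (R01 : R0 < 1).
Local Notation N := k.+3.
Let q : R := (p + 1) / 2.
Let c : R := k.+1%:R.
Let m : R := N%:R - q * c.
Let S : R := sphere_area N.
Let S0 : 0 < S. Proof. exact: (proj2 (sphere_measE k.+2)). Qed.
Let q0 : 0 < q. Proof. by rewrite divr_gt0// addr_gt0// (lt_trans ltr01). Qed.
Let c0 : 0 < c. Proof. by rewrite ltr0n. Qed.
Let qV : 2 / (p + 1) = q^-1. Proof. by rewrite invf_div. Qed.
Let p10 : p + 1 != 0. Proof. by rewrite gt_eqF// addr_gt0// (lt_trans ltr01). Qed.
Hypothesis m0 : 0 < m.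

Lemma exponent_lt2 : m < 2.
Proof.
have h : c < q * c by rewrite ltr_pMl// ltr_pdivlMr// mul1r -[2]/(1 + 1) ltrD2r.
by rewrite /m /c -addn2 natrD; rewrite /c in h; lra.
Qed.

Lemma KNpE : KNp N p = c `^ (- q) * S `^ (1 - q) * Gamma m.
Proof.
rewrite /KNp -/S -/q.
have -> : N%:R - 2 = c :> R by rewrite /c -addn2 natrD; ring.
congr (_ * _ `^ _ * Gamma _); first by rewrite /q; field.
by rewrite /m /q; field.
Qed.

(** The minimum in the condition selects where to concentrate: the origin for [2 / R0], the boundary
    for [2 / (1 - R0)], the latter being the only choice when [R0 = 0]. All exponents are written as
    multiples of [1/q]. *)
Lemma condLHSE : exists kappa : R,
  [/\ (0 < R0 /\ kappa = 2 / R0) \/ kappa = 2 / (1 - R0), 0 < kappa &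
      condLHS N p R0 = (R0 `^ m * expR kappa) `^ q^-1].
Proof.
have d0 : 0 < 1 - R0 by rewrite subr_gt0.
have E (t : R) : 0 < t -> expR (4 / (t * (p + 1))) = expR (2 / t) `^ q^-1.
  move=> t0; rewrite -expRM; congr expR; rewrite /q; field.
  by rewrite p10 gt_eqF.
have E2 : R0 `^ (2 * N%:R / (p + 1) - (N%:R - 2)) = (R0 `^ m) `^ q^-1.
  rewrite -powRrM; congr (_ `^ _); rewrite /m /q /c -addn2 natrD.
  by field; rewrite p10.
have E3 kappa : R0 `^ (2 * N%:R / (p + 1) - (N%:R - 2)) * expR kappa `^ q^-1 =
    (R0 `^ m * expR kappa) `^ q^-1.
  by rewrite E2 -powRM ?powR_ge0 ?expR_ge0.
rewrite /condLHS; case: eqVneq => [R0E|R0n].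
  exists (2 / (1 - R0)); rewrite E// E3; split=> //; first by right.
  by rewrite divr_gt0.
have p0 : 0 < R0 by rewrite lt_neqAle eq_sym R0n.
rewrite minEle !E//; case: ifP => _.
  by exists (2 / R0); rewrite E3 divr_gt0//; split=> //; left.
by exists (2 / (1 - R0)); rewrite E3 divr_gt0//; split=> //; right.
Qed.

Lemma S_alpha_rad_ge (alpha : R) : 1 < alpha ->
  (S `^ (1 - q) * radial_moment_bound R0 k p alpha) `^ (- q^-1) <= S_alpha_rad N p R0 alpha.
Proof.
move=> a1; apply: lb_le_inf.
  exists (quot N (fun x => Vw R0 alpha (enorm x)) p (@radial_bump R N)
    (fun x => \row_i partial i (@radial_bump R N) x)), (@radial_bump R N),
    (fun x => \row_i partial i (@radial_bump R N) x).
  by split; [exact: bump_H10|exact: bump_nonzero|exact: bump_radial|by []].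
move=> _ [u [g [H nz ru ->]]].
apply: (radial_quot_ge k u g H p (Vw R0 alpha) p1 (measurable_Vw R0 alpha)
  (Vw_ge0 R0 alpha) (radial_moment_bound R0 k p alpha) R0).
- by move=> r r0 r1; exact: Vw_gt0.
- exact: radial_moment_bound_le.
- exact: radial_moment_bound_gt0.
- exact: nz.
- exact: ru.
Qed.

Lemma S_alpha_le (kappa alpha : R) u g :
  (0 < R0 /\ kappa = 2 / R0) \/ kappa = 2 / (1 - R0) -> 0 < kappa -> kappa < alpha ->
  H10 N u g -> nonzero N u -> 0 < quot N (fun=> 1) p u g ->
  S_alpha N p R0 alpha <= alpha ^+ 2 / alpha ^+ N *
    ((1 - kappa / alpha) `^ alpha / alpha ^+ N) `^ (- q^-1) * quot N (fun=> 1) p u g.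
Proof.
move=> hk k0 ka H nz Q0; have a0 : 0 < alpha by exact: lt_trans ka.
have [b [sub Vb]] := Vw_concentrated k.+2 R0 kappa alpha R00 R01 hk ka.
have v0 : 0 < (1 - kappa / alpha) `^ alpha.
  by rewrite powR_gt0// subr_gt0 ltr_pdivrMr// mul1r.
rewrite -qV; apply: le_trans (quot_affine_le alpha b a0 sub u g (Vw R0 alpha) p _ H p1
  (measurable_Vw R0 alpha) (Vw_ge0 R0 alpha) v0 Vb Q0).
apply: Sinf_le.
- exact: (H10_affine alpha b a0 sub _ _ (H10_restrict _ _ H)).
- exact: (nonzero_affine alpha b a0 u nz).
- by [].
Qed.

Lemma S_alpha_lt_rad :
  condLHS N p R0 < KNp N p `^ (- (2 / (p + 1))) * (S_sob N p)^-1 ->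
  exists alpha0 : R, 0 < alpha0 /\
    forall alpha, alpha0 < alpha -> S_alpha N p R0 alpha < S_alpha_rad N p R0 alpha.
Proof.
have [kappa [hk k0 ->]] := condLHSE; rewrite qV KNpE => hyp.
set K := c `^ (- q) * _ * _ in hyp.
have K0 : 0 <= K by rewrite !mulr_ge0 ?powR_ge0// Gamma_ge0.
(* The right-hand side of the condition is positive, which excludes the junk values
   [0^-1 = 0] and [0 `^ x = 0]. *)
have [s0 Kp] : 0 < S_sob N p /\ 0 < K.
  have : 0 < K `^ (- q^-1) * (S_sob N p)^-1 by apply: le_lt_trans hyp; exact: powR_ge0.
  rewrite lt0r mulf_eq0 negb_or -andbA => /and3P[n1 n2 pos].
  have Kn : K != 0.
    by apply: contra_neq n1 => ->; rewrite powR0// oppr_eq0 invr_eq0 gt_eqF.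
  have Kp : 0 < K by rewrite lt0r Kn.
  split=> //; rewrite -invr_gt0 lt0r n2/=.
  by move: pos; rewrite pmulr_rge0// powR_gt0.
(* In terms of [y] the condition on [R0] reads [y S_sob < 1]. *)
pose y := (R0 `^ m * expR kappa * K) `^ q^-1.
have y0 : 0 <= y by exact: powR_ge0.
have yS : y * S_sob N p < 1.
  have yE : y = (R0 `^ m * expR kappa) `^ q^-1 * K `^ q^-1.
    by rewrite /y powRM// mulr_ge0 ?powR_ge0 ?expR_ge0.
  have Kq0 : 0 < K `^ q^-1 by rewrite powR_gt0.
  move: hyp; rewrite powRN -invfM -[ltRHS]mul1r ltr_pdivlMr ?mulr_gt0//.
  by rewrite yE mulrA.
(* Small enough that [y (S_sob + eps) < 1], and well defined even when [y = 0]. *)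
pose eps := (1 - y * S_sob N p) / (1 + y).
have y1 : 0 < 1 + y by lra.
have e0 : 0 < eps by rewrite divr_gt0// subr_gt0.
have [u [g [H nz _ Qlt]]] := Sinf_approx N (fun=> 1) p (fun=> True) eps
  (ex_intro _ _ (ex_intro _ _ (And3 (bump_H10 N) (bump_nonzero k.+2) I))) e0.
set Q := quot _ _ _ _ _ in Qlt.
have Q0 : 0 < Q by apply: (lt_le_trans s0); apply: Sinf_le.
have yQ : y * Q < 1.
  apply: (@le_lt_trans _ _ (y * (S_sob N p + eps))).
    by apply: ler_wpM2l => //; exact: ltW.
  rewrite mulrDr -ltrBrDl /eps mulrA ltr_pdivrMr// mulrC.
  by rewrite ltr_pM2l ?subr_gt0//; lra.
have cq0 : 0 < c `^ (- q) by rewrite powR_gt0.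
have Sq0 : 0 < S `^ (1 - q) by rewrite powR_gt0.
have Qq0 : 0 < Q `^ q by rewrite powR_gt0.
(* The product of [alpha^m], [Q^q], [S^(1-q)] and the radial moment bound equals
   [A + B alpha^m (alpha - 1)^-2]: the origin gives [A], the boundary gives [B]. *)
pose A := R0 `^ m * K * Q `^ q.
pose B := S `^ (1 - q) * Q `^ q * c `^ (- q) * (c * (Gamma 2 + 1)).
have A0 : 0 <= A by apply: mulr_ge0; [apply: mulr_ge0 => //|]; exact: powR_ge0.
have B0 : 0 <= B.
  apply: mulr_ge0; first by rewrite !mulr_ge0// ltW.
  by rewrite mulr_ge0 ?(ltW c0)// addr_ge0// Gamma_ge0.
have AE : A * expR kappa < 1.
  have -> : A * expR kappa = (y * Q) `^ q.
    rewrite powRM ?(ltW Q0)// /y -powRrM mulVf ?gt_eqF// powRr1.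
      by rewrite /A; ring.
    by apply: mulr_ge0 => //; apply: mulr_ge0; [exact: powR_ge0|exact: expR_ge0].
  rewrite [ltRHS](_ : 1 = 1 `^ q); last by rewrite powR1.
  apply: gt0_ltr_powR; rewrite ?nnegrE => //.
  by apply: mulr_ge0 => //; exact: ltW.
have [alpha0 [a00 ha]] := eventually_dominated A B kappa m A0 B0 k0 exponent_lt2 AE.
exists alpha0; split; first exact: a00.
move=> alpha /ha[a2 ka lt].
have a0 : 0 < alpha by exact: lt_trans ka.
have a1 : 1 < alpha by lra.
have J0 := radial_moment_bound_gt0 R0 k p alpha a1.
apply: lt_le_trans (S_alpha_rad_ge alpha a1).
apply: le_lt_trans (S_alpha_le kappa alpha u g hk k0 ka H nz Q0) _.
apply: (scaled_quot_lt k.+1 alpha _ Q _ q m a0 _ Q0 _ q0 erefl).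
- by rewrite powR_gt0// subr_gt0 ltr_pdivrMr// mul1r.
- by rewrite mulr_gt0.
apply: le_lt_trans lt; rewrite le_eqVlt; apply/orP; left; apply/eqP.
have RaE : (R0 / alpha) `^ m = R0 `^ m / alpha `^ m.
  rewrite powRM ?invr_ge0 ?(ltW a0)//; congr (_ * _).
  by rewrite -[alpha^-1]powR_inv1 ?(ltW a0)// -powRrM mulN1r powRN.
have am0 : alpha `^ m != 0 by rewrite gt_eqF// powR_gt0.
have a10 : alpha - 1 != 0 by rewrite gt_eqF// subr_gt0.
by rewrite /radial_moment_bound -/q -/c -/m RaE /A /B /K; field; rewrite a10 am0.
Qed.

(** If [u] is radial then so is the minimiser, the normalising factor being nonzero; its quotient
    [S_alpha] would then be at least [S_alpha_rad]. *)
Lemma groundstate_not_radial (alpha : R) u : 0 < S_sob N p ->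
  S_alpha N p R0 alpha < S_alpha_rad N p R0 alpha ->
  groundstate N p R0 alpha u -> ~ radial N u.
Proof.
move=> s0 lt [us [g [[H nz] _ Qe I1 ->]]] [h hr].
(* The unweighted quotient of the minimiser is at least [S_sob > 0], so its Dirichlet integral is
   positive; by the normalisation, this integral is [S_alpha]. *)
have Sp : 0 < S_alpha N p R0 alpha.
  have Q1 : 0 < quot N (fun=> 1) p us g by apply: (lt_le_trans s0); apply: Sinf_le.
  rewrite -Qe /quot I1/= powR1 divr1.
  exact: quot_num_gt0 Q1.
have C0 : S_alpha N p R0 alpha `^ (1 / (p - 1)) != 0.
  by apply: lt0r_neq0; apply: powR_gt0; exact: Sp.
move: (S_alpha N p R0 alpha `^ (1 / (p - 1))) C0 hr => C C0 hr.
have rus : radial N us.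
  case: hr => Z [bZ [Z0 sZ]]; exists (fun r => C^-1 * h r), Z.
  split; [exact: bZ|split; [exact: Z0|]].
  move=> x /= nx; apply: sZ => /= E; apply: nx.
  by rewrite -E mulKf.
have := Sinf_le N (fun x => Vw R0 alpha (enorm x)) p (radial N) us g H nz rus.
rewrite Qe => le.
by move: (lt_le_trans lt le); rewrite ltxx.
Qed.

End main.

Theorem mainTheorem2 (R : realType) (N : nat) (p R0 : R) :
  (3 <= N)%N ->
  1 < p -> p < (N%:R + 2) / (N%:R - 2) ->
  0 <= R0 -> R0 < 1 ->
  condLHS N p R0 < KNp N p `^ (- (2 / (p + 1))) * (S_sob N p)^-1 ->
  exists alpha0 : R, 0 < alpha0 /\
    forall alpha : R, alpha0 < alpha ->
      S_alpha N p R0 alpha < S_alpha_rad N p R0 alpha /\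
      (forall u : 'rV[R]_N -> R, groundstate N p R0 alpha u -> ~ radial N u).
Proof.
case: N => [|[|[|k]]]// _ p1 pN R00 R01 hyp.
(* Subcriticality of [p] is the same as [m > 0]. *)
have m0 : 0 < k.+3%:R - (p + 1) / 2 * k.+1%:R :> R.
  have c0 : 0 < k.+1%:R :> R by rewrite ltr0n.
  have E : k.+3%:R = k.+1%:R + 2 :> R by rewrite -addn2 natrD.
  move: pN; rewrite E addrK ltr_pdivlMr// => pN.
  by lra.
have [alpha0 [a0 ha]] := S_alpha_lt_rad k p R0 p1 R00 R01 m0 hyp.
exists alpha0; split; first exact: a0.
move=> alpha /ha lt; split; first exact: lt.
move=> u; apply: groundstate_not_radial; last exact: lt.
(* The left side of the condition is nonnegative, so the right side is positive, and with it
   [S_sob]. *)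
have : 0 < KNp k.+3 p `^ (- (2 / (p + 1))) * (S_sob k.+3 p)^-1.
  apply: le_lt_trans hyp; rewrite /condLHS mulr_ge0 ?powR_ge0//.
  by case: ifP => _; rewrite ?le_min ?expR_ge0.
rewrite lt0r mulf_eq0 negb_or -andbA => /and3P[n1 n2].
by rewrite pmulr_rge0 ?lt0r ?n1 ?powR_ge0// invr_ge0 => s0; rewrite s0 -invr_eq0 n2.
Qed.
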